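(* Let $1\leq n\in\mathbb N$. Then the set of Skolem functions $<2^{(n+1)^{\mathbf{x}}}$ has order type $\leq\omega_{n+2}$. Moreover, the set of archimedean classes (classes modulo $\asymp$) of the set of Skolem functions $<2^{(n+1)^{\mathbf{x}}}$ has order type $\leq\omega_{n+1}$.
   Context: $Sk$ is the smallest set of functions $\mathbb R^{>0}\to\mathbb R^{>0}$ containing the constant function $1$ and the identity function $\mathbf{x}$, and closed under $f+g$, $fg$ and $f^g$. It is ordered by $f<g$ iff $f(x)<g(x)$ for all sufficiently large $x$; this is a well order. For Skolem functions, $f\preceq g$ means $f\leq ng$ for some $n\in\mathbb N$, and $f\asymp g$ means $f\preceq g$ and $g\preceq f$; the archimedean classes are ordered by the order of their elements. Ordinals: $\omega_0=1$ and $\omega_{k+1}=\omega^{\omega_k}$. *)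

(* Defs.v *)
From mathcomp Require Import all_boot all_order all_algebra.
From mathcomp Require Import all_classical all_reals all_analysis.

Set Implicit Arguments.
Unset Strict Implicit.
Unset Printing Implicit Defensive.

Import Order.TTheory GRing.Theory Num.Theory.

Local Open Scope classical_set_scope.
Local Open Scope ring_scope.

(** * Ordinals, represented by well-ordered types *)

Record ordinal_rep := OrdinalRep {
  ord_sort :> Type;
  ord_le : rel ord_sort;
  ord_wo : wochoice.well_order ord_le }.

Arguments ord_le {o}.

Definition ord_lt (W : ordinal_rep) (x y : W) : Prop := ord_le x y /\ x <> y.

(* The order type of [A] under the strict order [lt] is the ordinal
   represented by [W]. *)
Definition has_order_type (T : Type) (lt : T -> T -> Prop) (A : set T)
    (W : ordinal_rep) : Prop :=
  exists2 phi : A -> W, bijective phi &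
    forall x y : A, lt (val x) (val y) <-> ord_lt (phi x) (phi y).

(* Isomorphism onto an initial segment. *)
Definition ordinal_le (V W : ordinal_rep) : Prop :=
  exists phi : V -> W,
    (forall x y, ord_lt x y <-> ord_lt (phi x) (phi y)) /\
    (forall x w, ord_le w (phi x) -> exists y, phi y = w).

Definition order_type_le (T : Type) (lt : T -> T -> Prop) (A : set T)
    (W : ordinal_rep) : Prop :=
  exists2 V : ordinal_rep, has_order_type lt A V & ordinal_le V W.

Section WellOrderTheory.
Variable W : ordinal_rep.
Implicit Types (x y z : W) (P : set W).

Lemma ord_min P : P !=set0 -> exists z, P z /\ forall x, P x -> ord_le z x.
Proof.
move=> [x Px].
have [|z [[zP zmin] _]] := @ord_wo W [pred x | `[< P x >]].
  by exists x; apply/asboolP.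
exists z; split; first exact/asboolP.
by move=> y Py; apply: zmin; apply/asboolP.
Qed.

Lemma ord_total x y : ord_le x y \/ ord_le y x.
Proof.
have [|z [[->|->] zmin]] := @ord_min [set u | u = x \/ u = y].
- by exists x; left.
- by left; apply: zmin; right.
- by right; apply: zmin; left.
Qed.

Lemma ord_refl x : ord_le x x.
Proof. by case: (ord_total x x). Qed.

Lemma ord_anti x y : ord_le x y -> ord_le y x -> x = y.
Proof.
move=> xy yx; have [|z [_ zu]] := @ord_wo W [pred u | `[< u = x \/ u = y >]].
  by exists x; apply/asboolP; left.
have zx : z = x.
  apply: zu; split; first by apply/asboolP; left.
  by move=> u /asboolP[]->; rewrite ?ord_refl.
rewrite -zx; apply: zu; split; first by apply/asboolP; right.
by move=> u /asboolP[]->; rewrite ?ord_refl.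
Qed.

Lemma ord_trans y x z : ord_le x y -> ord_le y z -> ord_le x z.
Proof.
move=> xy yz.
have [|w [[->|[->|->]] wmin]] := @ord_min [set u | u = x \/ u = y \/ u = z].
- by exists x; left.
- by apply: wmin; right; right.
- have <- : y = x by apply: ord_anti => //; apply: wmin; left.
  by [].
- have zy : ord_le z y by apply: wmin; right; left.
  by have -> : z = y by exact: ord_anti.
Qed.

Lemma ord_ltNge x y : ord_lt x y <-> ~ ord_le y x.
Proof.
split=> [[xy nxy] yx|nyx]; first exact/nxy/ord_anti.
have [xy|//] := ord_total x y.
by split=> // exy; apply: nyx; rewrite exy ord_refl.
Qed.

Lemma ord_lt_trans y x z : ord_lt x y -> ord_lt y z -> ord_lt x z.
Proof.
move=> [xy nxy] [yz nyz]; split; first exact: ord_trans yz.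
by move=> exz; apply: nxy; apply: ord_anti => //; rewrite exz.
Qed.

Lemma ord_cmp x y : ord_lt x y \/ x = y \/ ord_lt y x.
Proof.
have [exy|nxy] := pselect (x = y); first by right; left.
have [xy|yx] := ord_total x y; first by left.
by right; right; split=> // eyx; apply: nxy.
Qed.

Lemma ord_ltxx x : ~ ord_lt x x. Proof. by case. Qed.

Lemma ord_ind (Q : W -> Prop) :
  (forall x, (forall y, ord_lt y x -> Q y) -> Q x) -> forall x, Q x.
Proof.
move=> IH x; apply: contrapT => nQx.
have [|z [nQz zmin]] := @ord_min [set u | ~ Q u]; first by exists x.
apply: nQz; apply: IH => y /ord_ltNge yz; apply: contrapT => nQy.
exact/yz/zmin.
Qed.

Lemma ord_finite_max P : finite_set P -> P !=set0 ->
  exists z, P z /\ forall x, P x -> ord_le x z.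
Proof.
move=> finP; have /finite_seqP[s Ps] : finite_set (P : set {classic W}) by [].
rewrite {finP}Ps; elim: s => [|a s IH]; first by case=> x; rewrite /= in_nil.
move=> _; have [[x xs]|s0] := pselect (exists x : {classic W}, x \in s).
  have [|z [zs zmax]] := IH; first by exists x.
  have [az|za] := ord_total a z.
    exists z; split; first by rewrite /= inE; apply/orP; right.
    by move=> y /=; rewrite inE => /orP[/eqP->//|]; exact: zmax.
  exists a; split; first by rewrite /= mem_head.
  move=> y /=; rewrite inE => /orP[/eqP->|/zmax yz]; first exact: ord_refl.
  exact: ord_trans za.
exists a; split; first by rewrite /= mem_head.
move=> y /=; rewrite inE => /orP[/eqP->|ys]; first exact: ord_refl.
by case: s0; exists y.
Qed.

End WellOrderTheory.

(** ** The ordinal power [omega ^ W]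

   Finitely supported functions [W -> nat], compared at the largest argument
   where they differ. *)

Section OmegaExp.
Variable W : ordinal_rep.

Definition omega_exp_sort : Type :=
  {f : W -> nat | finite_set [set a | f a <> 0%N]}.

Definition omega_exp_lt (f g : omega_exp_sort) : Prop :=
  exists a : W, (sval f a < sval g a)%N /\
    forall b : W, ord_lt a b -> sval f b = sval g b.

Definition omega_exp_le : rel omega_exp_sort :=
  fun f g => `[< f = g \/ omega_exp_lt f g >].

Lemma omega_exp_val_inj (f g : omega_exp_sort) : sval f = sval g -> f = g.
Proof.
by case: f g => [f Pf] [g Pg] /= fg; subst g; congr exist; exact: Prop_irrelevance.
Qed.

Lemma omega_exp_lt_anti f g : omega_exp_lt f g -> ~ omega_exp_lt g f.
Proof.
move=> [a [fga Ha]] [b [gfb Hb]].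
have [ab|[ab|ba]] := ord_cmp a b.
- by move: gfb; rewrite Ha// ltnn.
- by move: gfb; rewrite -ab ltnNge (ltnW fga).
- by move: fga; rewrite Hb// ltnn.
Qed.

Lemma omega_exp_min (D : set W) :
  (forall a b, D b -> ord_lt a b -> D a) ->
  (forall d, D d -> forall (h : W -> nat) (P : set omega_exp_sort),
    P !=set0 -> (forall f b, P f -> ~ ord_lt b d -> sval f b = h b) ->
    exists z, P z /\ forall f, P f -> omega_exp_le z f) ->
  forall (h : W -> nat) (P : set omega_exp_sort),
    P !=set0 -> (forall f b, P f -> ~ D b -> sval f b = h b) ->
    exists z, P z /\ forall f, P f -> omega_exp_le z f.
Proof.
move=> Ddown IH h P [f0 Pf0] Ph.
have supp (f : omega_exp_sort) (E : set W) :
    finite_set [set a | E a /\ sval f a <> 0%N].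
  by apply: sub_finite_set (proj2_sig f) => a [].
have [[b0 Sb0]|S0] := pselect (exists b, D b /\ sval f0 b <> 0%N); last first.
  exists f0; split=> // f Pf; apply/asboolP.
  have [[c Sc]|T0] := pselect (exists b, D b /\ sval f b <> 0%N).
    right; have [|m [[Dm fm] mmax]] := ord_finite_max (supp f D); first by exists c.
    have f00 b : D b -> sval f0 b = 0%N.
      by move=> Db; apply: contrapT => ?; apply: S0; exists b.
    exists m; rewrite f00// lt0n; split; first exact/eqP.
    move=> b mb; have [Db|nDb] := pselect (D b); last by rewrite (Ph f)// (Ph f0).
    rewrite f00//; apply: contrapT => fb; move/ord_ltNge: mb; apply.
    by apply: mmax; split=> // fb0; apply: fb.
  left; apply: omega_exp_val_inj; apply/funext => b.
  have [Db|nDb] := pselect (D b); last by rewrite (Ph f)// (Ph f0).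
  have -> : sval f0 b = 0%N by apply: contrapT => ?; apply: S0; exists b.
  by apply/esym; apply: contrapT => ?; apply: T0; exists b.
have [|b [[Db f0b] bmax]] := ord_finite_max (supp f0 D); first by exists b0.
pose P' := [set f | P f /\ forall c, D c -> ord_lt b c -> sval f c = 0%N].
have P'f0 : P' f0.
  split=> // c Dc /ord_ltNge bc; apply: contrapT => f0c; apply: bc.
  by apply: bmax.
have exm : exists m, `[< exists2 f, P' f & sval f b = m >].
  by exists (sval f0 b); apply/asboolP; exists f0.
have [m /asboolP[f1 P'f1 f1m] mmin] := ex_minnP exm.
have [||z [[P'z zm] zmin]] := @IH b Db (sval f1) [set f | P' f /\ sval f b = m].
- by exists f1.
- move=> f c [[Pf Pf0'] fm] /=; have [bc|[<-|cb]] := ord_cmp b c => //.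
    move=> _; case: P'f1 => Pf1 f10.
    have [Dc|nDc] := pselect (D c); first by rewrite Pf0'// f10.
    by rewrite (Ph f)// (Ph f1).
  by move=> _; rewrite fm f1m.
exists z; split; first by case: P'z.
move=> g Pg; have [P'g|nP'g] := pselect (P' g); last first.
  apply/asboolP; right.
  have [|c [[[Dc bc] gc] cmax]] :=
    ord_finite_max (supp g [set c | D c /\ ord_lt b c]).
    apply: contrapT => ng; apply: nP'g; split=> // c Dc bc.
    by apply: contrapT => gc; apply: ng; exists c.
  exists c; rewrite (P'z.2 _ Dc bc) lt0n; split; first exact/eqP.
  move=> e ce; have [De|nDe] := pselect (D e); last first.
    by rewrite (Ph g)// (Ph z)//; case: P'z.
  have be := ord_lt_trans bc ce; rewrite (P'z.2 _ De be).
  apply: contrapT => ge; move/ord_ltNge: ce; apply; apply: cmax.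
  by split=> // ge0; apply: ge.
have [gm|gm] := pselect (sval g b = m); first exact: zmin.
apply/asboolP; right; exists b; rewrite zm; split.
  rewrite ltn_neqAle; apply/andP; split; first by apply/eqP => /esym.
  by apply: mmin; apply/asboolP; exists g.
move=> c bc; have [Dc|nDc] := pselect (D c).
  by rewrite (P'z.2 _ Dc bc) (P'g.2 _ Dc bc).
by rewrite (Ph g)// (Ph z)//; case: P'z.
Qed.

Lemma omega_exp_wo : wochoice.well_order omega_exp_le.
Proof.
apply: wochoice.antisymmetric_well_order.
  move=> f g /andP[/asboolP[//|fg] /asboolP[//|gf]].
  by case: (omega_exp_lt_anti fg).
have step d (h : W -> nat) (P : set omega_exp_sort) :
    P !=set0 -> (forall f b, P f -> ~ ord_lt b d -> sval f b = h b) ->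
    exists z, P z /\ forall f, P f -> omega_exp_le z f.
  elim/ord_ind: d h P => d IH; apply: (@omega_exp_min [set b | ord_lt b d]).
    by move=> a b /= bd ab; exact: ord_lt_trans bd.
  by move=> e /= ed; exact: IH.
move=> A [f0 Af0].
have min0 := @omega_exp_min setT (fun _ _ _ _ => I) (fun d _ => step d).
have [||z [Az zmin]] := min0 (fun=> 0%N) [set f | f \in A].
- by exists f0.
- by move=> f b _ /(_ I).
- by exists z; split=> // f fA; exact: zmin.
Qed.

Definition omega_exp : ordinal_rep := OrdinalRep omega_exp_wo.

End OmegaExp.

Lemma unit_wo : wochoice.well_order (fun _ _ : unit => true).
Proof. by move=> A [[] A0]; exists tt; split=> // -[]. Qed.

Definition ord_one : ordinal_rep := OrdinalRep unit_wo.

Fixpoint omega_tower (k : nat) : ordinal_rep :=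
  if k is k'.+1 then omega_exp (omega_tower k') else ord_one.

(** * Skolem functions *)

Section Skolem.
Variable R : realType.

(* Working with functions on the type of positive reals makes Leibniz equality
   coincide with equality of functions on the positive reals. *)
Definition pfun : Type := {posnum R} -> {posnum R}.

Implicit Types f g : pfun.

Inductive Skolem : set pfun :=
| Skolem_one : Skolem (fun=> 1%:pos)
| Skolem_id : Skolem (fun x => x)
| Skolem_add f g : Skolem f -> Skolem g ->
    Skolem (fun x => ((f x)%:num + (g x)%:num)%:pos)
| Skolem_mul f g : Skolem f -> Skolem g ->
    Skolem (fun x => ((f x)%:num * (g x)%:num)%:pos)
| Skolem_pow f g : Skolem f -> Skolem g ->
    Skolem (fun x => ((f x)%:num `^ (g x)%:num)%:pos).

Definition pfun_lt f g : Prop :=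
  exists M : R, forall x : {posnum R}, M < x%:num -> (f x)%:num < (g x)%:num.

Definition pfun_le f g : Prop := f = g \/ pfun_lt f g.

(* Multiples by [0] are left out: they are not functions into the positive
   reals, and no positive function is below them. *)
Definition arch_le f g : Prop :=
  exists n : nat, pfun_le f (fun x => (n.+1%:R * (g x)%:num)%:pos).

Definition arch_eq f g : Prop := arch_le f g /\ arch_le g f.

Definition arch_class (A : set pfun) f : set pfun :=
  [set g | A g /\ arch_eq f g].

Definition arch_classes (A : set pfun) : set (set pfun) :=
  [set arch_class A f | f in A].

Definition arch_class_lt (C D : set pfun) : Prop :=
  forall f g, C f -> D g -> pfun_lt f g.

Definition Skolem_below (b : pfun) : set pfun :=
  [set f | Skolem f /\ pfun_lt f b].

Definition two_pow_pow (n : nat) : pfun :=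
  fun x => (2 `^ (n.+1%:R `^ x%:num))%:pos.

End Skolem.

(* Main.v *)
Require Import Defs.
From HB Require Import structures.
From mathcomp Require Import all_boot all_order all_algebra.
From mathcomp Require Import all_classical all_reals all_analysis.
From mathcomp Require Import ring lra zify.

(** Along an ultrafilter at infinity the real field becomes an ordered field [K]
   with [exp], [ln] and an infinite element [X], and every Skolem function has a
   class in [K]. Skolem functions lie in Hardy fields and are analytic, so two of
   them are eventually comparable, and equal if eventually equal: the map to [K]
   is an order embedding.

   A Skolem element below [2^(n^X)] is a finite sum of products of [X] and of
   powers [h^(c^X X^j)]. Call such a product a component, and let [F m k] be the
   set of the elements [h] with [ln h = O(m^X X^k ln X)]. The logarithm of a
   component in [F n k] is the sum of the logarithm of a component in some
   [F (n-1) k'] and of terms [c^X X^j ln h] with [c] dividing [n] and [h] in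
   [F (n/c) (k-j)]. Bounds on order types are obtained by induction on [(n, k)]:
   sums of sets cost a natural sum of ordinals, while finite sums of components
   cost one exponentiation. What makes the induction work is a gap property: two
   elements [p] and [q] of this kind satisfy [p = O(q)] or [q X = O(p)], so that
   passing from [O(1)] to [O(X^-i)] multiplies the classes of logarithms only by
   finite sets. The gap property follows from expansions of logarithms in
   exponentials [exp(q X)] with coefficients that are Laurent series in [1/X]
   given by analytic functions, plus multiples of [ln X]. *)

Set Implicit Arguments.
Unset Strict Implicit.
Unset Printing Implicit Defensive.

Import Order.TTheory GRing.Theory Num.Theory.

Local Open Scope classical_set_scope.
Local Open Scope ring_scope.

(** * Natural sums of ordinals *)

(** The two statements of the theorem must be proved together: for finite sums of components, the
    height of their classes enters the exponent of the bound for the full order. So the classes of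
    logarithms modulo O(1) have to stay one exponential below the full order. For a summand
    [c^X X^j ln h] with [c >= 2] this is free, because [h] then comes from a smaller level, whose
    full order already fits. For [c = 1] the level is unchanged and only classes of [ln h] are
    affordable; but to know [X^j ln h] modulo O(1) is to know [ln h] modulo O(X^-j). The gap
    property pays for this refinement through the finiteness property [disc], which passes through
    sums of sets, finite sums, and between elements and logarithms. The gap itself comes from
    integrality: the coefficient of [ln X] in the logarithm of a quotient of moderate size is an
    integer, so an unbounded quotient has at least the order of [X]. *)

Lemma ord_le_eqVlt (W : ordinal_rep) (x y : W) :
  ord_le x y <-> x = y \/ ord_lt x y.
Proof.
split=> [xy|[->|[]//]]; last exact: ord_refl.
by have [|] := pselect (x = y); [left|right].
Qed.

Lemma ord_le_lt_trans (W : ordinal_rep) (y x z : W) :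
  ord_le x y -> ord_lt y z -> ord_lt x z.
Proof. by move=> /ord_le_eqVlt[->//|]; apply: ord_lt_trans. Qed.

Lemma ord_lt_le_trans (W : ordinal_rep) (y x z : W) :
  ord_lt x y -> ord_le y z -> ord_lt x z.
Proof. by move=> xy /ord_le_eqVlt[<-//|]; apply: ord_lt_trans. Qed.

Lemma ord_leNgt (W : ordinal_rep) (x y : W) : ord_le x y <-> ~ ord_lt y x.
Proof.
split=> [xy /ord_ltNge //|nyx]; apply: contrapT => nxy.
exact/nyx/ord_ltNge.
Qed.

Section OmegaExpArith.
Variable W : ordinal_rep.
Implicit Types (f g h : omega_exp W) (v w : W).

Lemma oexp_ltP f g : ord_lt f g <-> omega_exp_lt f g.
Proof.
split=> [[/asboolP[efg nfg|//]]|fg]; first by case: nfg.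
split; first by apply/asboolP; right.
by move=> efg; move: fg; rewrite efg => fg; apply: (omega_exp_lt_anti fg).
Qed.

Lemma oexp_ext f g : (forall v, sval f v = sval g v) -> f = g.
Proof. by move=> fg; apply: omega_exp_val_inj; apply/funext. Qed.

Definition oexp_of (f : W -> nat) (ff : finite_set [set a | f a <> 0%N]) :
  omega_exp W := exist _ f ff.

Fact oexp0_subproof : finite_set [set a : W | (fun=> 0%N) a <> 0%N].
Proof. by rewrite (_ : mkset _ = set0) // predeqE => a; split. Qed.
Definition oexp0 : omega_exp W := oexp_of oexp0_subproof.

Fact oexp_add_subproof f g :
  finite_set [set a : W | (sval f a + sval g a)%N <> 0%N].
Proof.
apply: (@sub_finite_set _ _
  ([set a | sval f a <> 0%N] `|` [set a | sval g a <> 0%N])).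
  move=> a /=; have [->|] := pselect (sval f a = 0%N); last by left.
  by rewrite add0n; right.
by rewrite finite_setU; split; [exact: (proj2_sig f)|exact: (proj2_sig g)].
Qed.
(** The Hessenberg natural sum: coefficients of Cantor normal forms are added. Unlike the ordinary
    ordinal sum it is commutative and strictly increasing in both arguments, on which the induction
    in [height_op] relies. *)
Definition oexp_add f g : omega_exp W :=
  @oexp_of (fun a => (sval f a + sval g a)%N) (oexp_add_subproof f g).

Fact oexp_pow_subproof v : finite_set [set a : W | nat_of_bool `[< a = v >] <> 0%N].
Proof.
apply: (@sub_finite_set _ _ [set v]); last exact: finite_set1.
by move=> a /=; case: asboolP.
Qed.
Definition oexp_pow v : omega_exp W := oexp_of (oexp_pow_subproof v).

Lemma oexp_addC f g : oexp_add f g = oexp_add g f.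
Proof. by apply: oexp_ext => v /=; rewrite addnC. Qed.

Lemma oexp_lt_add2r h f g : ord_lt f g -> ord_lt (oexp_add f h) (oexp_add g h).
Proof.
move=> /oexp_ltP[a [fga Ha]]; apply/oexp_ltP; exists a => /=; split.
  by rewrite ltn_add2r.
by move=> b ab; rewrite Ha.
Qed.

Lemma oexp_lt_add2l h f g : ord_lt f g -> ord_lt (oexp_add h f) (oexp_add h g).
Proof. by rewrite !(oexp_addC h); apply: oexp_lt_add2r. Qed.

Lemma oexp_le_add2r h f g : ord_le f g -> ord_le (oexp_add f h) (oexp_add g h).
Proof.
move=> /ord_le_eqVlt[->|fg]; first exact: ord_refl.
by apply/ord_le_eqVlt; right; apply: oexp_lt_add2r.
Qed.

Lemma oexp_le_add2l h f g : ord_le f g -> ord_le (oexp_add h f) (oexp_add h g).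
Proof. by rewrite !(oexp_addC h); apply: oexp_le_add2r. Qed.

Lemma oexp_ge0 f : ord_le oexp0 f.
Proof. by apply/ord_leNgt => /oexp_ltP[a [/=]]; rewrite ltn0. Qed.

Lemma oexp_add0 f : oexp_add f oexp0 = f.
Proof. by apply: oexp_ext => v /=; rewrite addn0. Qed.

Lemma oexp_le_addr f g : ord_le f (oexp_add f g).
Proof. by rewrite -{1}(oexp_add0 f); apply: oexp_le_add2l; apply: oexp_ge0. Qed.

Lemma oexp_pow_gt0 v : ord_lt oexp0 (oexp_pow v).
Proof.
apply/oexp_ltP; exists v => /=; rewrite asboolT//; split=> // b [vb nvb].
by rewrite asboolF// => bv; apply: nvb.
Qed.

(** The condition [f < omega^v], phrased through the support of [f]: in this form it is visibly
    stable under natural sums. *)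
Definition oexp_bd v f := forall b, sval f b <> 0%N -> ord_lt b v.

Lemma oexp_bd_lt v f : oexp_bd v f -> ord_lt f (oexp_pow v).
Proof.
move=> fv; apply/oexp_ltP; exists v => /=; rewrite asboolT//; split.
  by rewrite ltnS leqn0; apply/eqP; apply: contrapT => /fv /ord_ltxx.
move=> b vb; rewrite asboolF; last by move=> bv; move: vb; rewrite bv => /ord_ltxx.
by apply: contrapT => /fv /(ord_lt_trans vb) /ord_ltxx.
Qed.

Lemma oexp_bd_le v f g : ord_le f g -> oexp_bd v g -> oexp_bd v f.
Proof.
move=> /ord_le_eqVlt[->//|/oexp_ltP[a [fga Ha]]] gv b fb.
have av : ord_lt a v by apply: gv => ga; move: fga; rewrite ga ltn0.
have [/Ha fgb|[<-//|ba]] := ord_cmp a b; first by apply: gv; rewrite -fgb.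
exact: ord_lt_trans av.
Qed.

Lemma oexp_bd_pow v w : ord_lt w v -> oexp_bd v (oexp_pow w).
Proof. by move=> wv b /=; case: asboolP => [->|]. Qed.

Lemma oexp_bd_add v f g : oexp_bd v f -> oexp_bd v g -> oexp_bd v (oexp_add f g).
Proof.
move=> fv gv b /= fgb; have [f0|] := pselect (sval f b = 0%N); last exact: fv.
by apply: gv; move: fgb; rewrite f0.
Qed.

Lemma oexp_bd0 v : oexp_bd v oexp0. Proof. by move=> b. Qed.

Lemma oexp_bd_exists (nomax : forall v, exists w, ord_lt v w) f :
  inhabited W -> exists v, oexp_bd v f.
Proof.
move=> [v0]; have [[b fb]|f0] := pselect (exists b, sval f b <> 0%N); last first.
  by exists v0 => b fb; case: f0; exists b.
have [|z [_ zmax]] := ord_finite_max (proj2_sig f); first by exists b.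
have [w zw] := nomax z; exists w => c /zmax cz; exact: ord_le_lt_trans zw.
Qed.

Lemma oexp_nomax f : inhabited W -> exists g, ord_lt f g.
Proof.
move=> [v]; exists (oexp_add f (oexp_pow v)).
by rewrite -{1}(oexp_add0 f); apply: oexp_lt_add2l; apply: oexp_pow_gt0.
Qed.

End OmegaExpArith.

Section OmegaExpMap.
Variables (V W : ordinal_rep) (phi : V -> W).
Hypothesis phi_mono : forall x y, ord_lt x y -> ord_lt (phi x) (phi y).

Lemma strict_mono_reflect x y : ord_lt (phi x) (phi y) -> ord_lt x y.
Proof.
have [//|[->|yx]] := ord_cmp x y; first by move=> /ord_ltxx.
by move=> /(ord_lt_trans (phi_mono yx)) /ord_ltxx.
Qed.

Lemma strict_mono_inj x y : phi x = phi y -> x = y.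
Proof.
by have [/phi_mono + e|[//|/phi_mono + e]] := ord_cmp x y; rewrite e => /ord_ltxx.
Qed.

(** Pushes Cantor exponents forward along [phi]. Exponents outside the image get coefficient 0, so
    two images can differ only at exponents [phi a]. *)
Definition oexp_map_fun (f : omega_exp V) (b : W) : nat :=
  if pselect (exists a, phi a = b) is left e then sval f (projT1 (cid e)) else 0%N.

Lemma oexp_map_funE f a : oexp_map_fun f (phi a) = sval f a.
Proof.
rewrite /oexp_map_fun; case: pselect => [e|[]]; last by exists a.
by congr (sval f _); apply: strict_mono_inj; case: cid.
Qed.

Lemma oexp_map_fun0 f b : ~ (exists a, phi a = b) -> oexp_map_fun f b = 0%N.
Proof. by rewrite /oexp_map_fun; case: pselect. Qed.

Fact oexp_map_subproof f : finite_set [set b | oexp_map_fun f b <> 0%N].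
Proof.
apply: (@sub_finite_set _ _ (phi @` [set a | sval f a <> 0%N])).
  move=> b /=; have [[a <-]|/oexp_map_fun0 -> //] := pselect (exists a, phi a = b).
  by rewrite oexp_map_funE; exists a.
exact: finite_image (proj2_sig f).
Qed.
Definition oexp_map f : omega_exp W := oexp_of (oexp_map_subproof f).

Lemma oexp_map_mono f g : ord_lt f g -> ord_lt (oexp_map f) (oexp_map g).
Proof.
move=> /oexp_ltP[a [fga Ha]]; apply/oexp_ltP; exists (phi a) => /=.
rewrite !oexp_map_funE; split=> // b ab.
have [[c cb]|nb] := pselect (exists a, phi a = b); last by rewrite !oexp_map_fun0.
by rewrite -cb !oexp_map_funE Ha//; apply: strict_mono_reflect; rewrite cb.
Qed.

Lemma oexp_map_bd t f : (forall a, ord_lt (phi a) t) -> oexp_bd t (oexp_map f).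
Proof.
move=> bt b /=; have [[a <-]|/oexp_map_fun0 -> //] := pselect (exists a, phi a = b).
by move=> _; exact: bt.
Qed.

End OmegaExpMap.

Definition tower_zero k : omega_tower k :=
  if k is k'.+1 return omega_tower k then oexp0 (omega_tower k') else tt.

Definition tower_one k : omega_tower k.+1 := oexp_pow (tower_zero k).

Lemma tower_inhabited k : inhabited (omega_tower k).
Proof. exact: inhabits (tower_zero k). Qed.

(** The induction raises [omega] to the previous embedding and to its bound. The bound [t] later
    caps heights that depend on a parameter, at the price of one level. *)
Lemma tower_lift k : exists (iota : omega_tower k -> omega_tower k.+1)
    (t : omega_tower k.+1),
  (forall x y, ord_lt x y -> ord_lt (iota x) (iota y)) /\
  forall x, ord_lt (iota x) t.
Proof.
elim: k => [|k [iota [t [mono bd]]]].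
  exists (fun=> oexp0 _), (oexp_pow (W := ord_one) tt); split=> [[] [] /ord_ltxx//|_].
  exact: oexp_pow_gt0.
exists (oexp_map mono), (oexp_pow t); split; first exact: oexp_map_mono.
by move=> x; apply: oexp_bd_lt; apply: oexp_map_bd.
Qed.

Lemma tower_nomax k (v : omega_tower k.+1) : exists w, ord_lt v w.
Proof. exact: oexp_nomax (tower_inhabited k). Qed.

Lemma tower_bd k (f : omega_tower k.+2) : exists v, oexp_bd v f.
Proof. exact: oexp_bd_exists (@tower_nomax k) _ (tower_inhabited _). Qed.

(** * Heights *)

(* [height R g U] implies that [U] embeds, along [R], in the ordinal
   omega ^ g; unlike order types, heights are compatible with finite unions,
   which makes them easy to bound for sums of sets. *)
Inductive height (T : Type) (R : T -> T -> Prop) (W : ordinal_rep) :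
    W -> set T -> Prop :=
| Height g U : (forall u, U u -> below R g (U `&` [set v | R v u])) ->
    height R g U
with below (T : Type) (R : T -> T -> Prop) (W : ordinal_rep) :
    W -> set T -> Prop :=
| Below0 g V : V `<=` set0 -> below R g V
| BelowU g V g' V1 V2 : ord_lt g' g -> height R g' V1 -> below R g V2 ->
    V `<=` V1 `|` V2 -> below R g V.

Section HeightTheory.
Variables (T : Type) (R : T -> T -> Prop) (W : ordinal_rep).
Implicit Types (g : W) (U V : set T).

Lemma heightP g U : height R g U ->
  forall u, U u -> below R g (U `&` [set v | R v u]).
Proof. by case. Qed.

Lemma below_sub g U V : U `<=` V -> below R g V -> below R g U.
Proof.
move=> UV VB; case: VB UV => {}g {}V => [V0|g' V1 V2 lt H B VV] UV.
  by apply: Below0; exact: subset_trans V0.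
by apply: BelowU lt H B _; exact: subset_trans VV.
Qed.

Lemma belowS g g' V : ord_le g g' -> below R g V -> below R g' V.
Proof.
move=> gg' B; elim: B g' gg' => {}g {}V => [V0 g' gg'|g1 V1 V2 lt H _ IH VV g' gg'].
  exact: Below0.
by apply: BelowU H (IH _ gg') VV; exact: ord_lt_le_trans gg'.
Qed.

Lemma below_setU g V1 V2 : below R g V1 -> below R g V2 -> below R g (V1 `|` V2).
Proof.
move=> B; elim: B V2 => {}g V => [V0 V2|g' V1' V2' lt H _ IH VV V2] B2.
  by apply: below_sub B2 => x [/V0|].
apply: BelowU lt H (IH _ B2) _ => x [/VV[]|]; first by left.
  by right; left.
by right; right.
Qed.

Lemma below_height g g' V : ord_lt g' g -> height R g' V -> below R g V.
Proof.
move=> lt H; apply: BelowU lt H (@Below0 _ _ _ _ set0 _) _ => // x; left.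
Qed.

Lemma heightS g g' U : ord_le g g' -> height R g U -> height R g' U.
Proof. by move=> gg' /heightP H; constructor=> u /H; apply: belowS. Qed.

End HeightTheory.

(** A simulation argument: finite covers pull back through [S] piece by piece. A relation instead of
    a map allows each [u'] to be matched with any convenient [u], for instance one at distance
    O(1). *)
Lemma height_transfer (T T' : Type) (R : T -> T -> Prop) (R' : T' -> T' -> Prop)
    (S : T' -> T -> Prop) (W : ordinal_rep) :
  (forall u' v' u v, S u' u -> S v' v -> R' u' v' -> R u v) ->
  forall (g : W) (U : set T) (U' : set T'),
  (forall u', U' u' -> exists u, U u /\ S u' u) ->
  height R g U -> height R' g U'.
Proof.
move=> SR; elim/ord_ind => g IH U U' UU' /heightP H.
have step V : below R g V -> forall V' : set T',
    (forall v', V' v' -> exists v, V v /\ S v' v) -> below R' g V'.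
  move=> B; elim: B IH => {V H}{}g V.
    move=> V0 _ V' VV'; apply: Below0 => v' /VV'[v [/V0]]//.
  move=> g' V1 V2 lt H _ IHB VV IH V' VV'.
  apply: (@BelowU _ _ _ _ _ g' [set v' | exists v, V1 v /\ S v' v]
            (V' `&` [set v' | exists v, V2 v /\ S v' v])) => //.
  - by apply: (IH _ lt V1) => // v' [v [? ?]]; exists v.
  - by apply: IHB => // v' [].
  - move=> v' V'v'; have [v [/VV[]]] := VV' _ V'v'; first by left; exists v.
    by right; split=> //; exists v.
constructor=> u' U'u'; have [u [Uu Suu']] := UU' _ U'u'.
apply: (step _ (H _ Uu)) => v' [U'v' /= Rvu].
have [v [Uv Svv']] := UU' _ U'v'.
by exists v; split=> //; split=> //=; apply: SR Rvu.
Qed.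

Lemma height_sub (T : Type) (R : T -> T -> Prop) (W : ordinal_rep) (g : W) U V :
  U `<=` V -> height R g V -> height R g U.
Proof.
move=> UV; apply: (@height_transfer _ _ R R eq) => [u v _ _ <- <- //|u /UV Vu].
by exists u.
Qed.

Lemma height_map (T : Type) (R : T -> T -> Prop) (W W' : ordinal_rep)
    (phi : W -> W') : (forall x y, ord_lt x y -> ord_lt (phi x) (phi y)) ->
  forall (g : W) (U : set T), height R g U -> height R (phi g) U.
Proof.
move=> mono; elim/ord_ind => g IH U /heightP H; constructor=> u /H.
move=> B; elim: B IH => {H}{}g V.
  by move=> V0 _; apply: Below0.
move=> g' V1 V2 lt H _ IHB VV IH; apply: BelowU (mono _ _ lt) _ (IHB IH) VV.
exact: IH.
Qed.

(** An element below [op u0 v0] has its first argument below [u0] or its second below [v0]. So two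
    sets of the same shape cover what lies below; in each of them one of the two heights has
    dropped, and the natural sum drops with it. *)
Lemma height_op (T1 T2 T3 : Type) (R1 : T1 -> T1 -> Prop) (R2 : T2 -> T2 -> Prop)
    (R3 : T3 -> T3 -> Prop) (op : T1 -> T2 -> T3) (W : ordinal_rep) :
  (forall u u' v v', R3 (op u v) (op u' v') -> R1 u u' \/ R2 v v') ->
  forall (a b : omega_exp W) (U : set T1) (V : set T2),
  height R1 a U -> height R2 b V ->
  height R3 (oexp_add a b) [set w | exists u v, [/\ U u, V v & w = op u v]].
Proof.
move=> opR a b; elim/(@ord_ind (omega_exp W)): a b => a IHa b.
elim/(@ord_ind (omega_exp W)): b => b IHb U V HU HV.
pose sum U V := [set w | exists u v, [/\ U u, V v & w = op u v]].
constructor=> _ [u0 [v0 [Uu0 Vv0 ->]]].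
apply: (@below_sub _ _ _ _ _ (sum (U `&` [set u | R1 u u0]) V `|`
                              sum U (V `&` [set v | R2 v v0]))).
  move=> _ [[u [v [Uu Vv ->]]] /= /opR[Ru|Rv]].
    by left; exists u, v; split.
  by right; exists u, v; split.
apply: below_setU.
  elim: (heightP HU Uu0) IHa => a1 U1.
    by move=> U0 _; apply: Below0 => w [u [v [/U0]]].
  move=> a' V1 V2 lt H1 _ IH VV IHa.
  apply: BelowU (oexp_lt_add2r b lt) (IHa _ lt _ _ _ H1 HV) (IH IHa) _.
  by move=> _ [u [v [/VV[] ? ? ->]]]; [left|right]; exists u, v.
elim: (heightP HV Vv0) IHb => b1 U1.
  by move=> U0 _; apply: Below0 => w [u [v [_ /U0]]].
move=> b' V1 V2 lt H1 _ IH VV IHb.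
apply: BelowU (oexp_lt_add2l a lt) (IHb _ lt _ _ HU H1) (IH IHb) _.
by move=> _ [u [v [? /VV[] ? ->]]]; [left|right]; exists u, v.
Qed.

(** Type [omega^b] within each class and [omega^a] for the classes give [omega^(b+a)]: what is
    [Rf]-below [u] is either in a lower class, where [a] drops, or in the class of [u], where [b]
    applies. *)
Lemma height_lex (T : Type) (Rc Rf E : T -> T -> Prop) (W : ordinal_rep) :
  (forall u, E u u) -> (forall v u, Rf v u -> Rc v u \/ E v u) ->
  forall (a b : omega_exp W) (U : set T), height Rc a U ->
  (forall u, U u -> height Rf b (U `&` [set v | E v u])) ->
  height Rf (oexp_add b a) U.
Proof.
move=> Exx RE a b; elim/(@ord_ind (omega_exp W)): a => a IH U HU Hcl.
constructor=> u Uu.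
apply: (@below_sub _ _ _ _ _ ((U `&` [set v | Rc v u]) `|`
   (U `&` [set v | E v u] `&` [set v | Rf v u]))).
  move=> v [Uv /= Rvu]; have [Rc1|E1] := RE _ _ Rvu; first by left.
  by right.
apply: below_setU; last first.
  apply: belowS (oexp_le_addr b a) _.
  by apply: (heightP (Hcl _ Uu)); split.
suff step V : below Rc a V -> below Rf (oexp_add b a) (U `&` V).
  by apply: below_sub (step _ (heightP HU Uu)) => v [].
move=> B; elim: B IH => {V}a1 V.
  by move=> V0 _; apply: Below0 => v [_ /V0].
move=> a' V1 V2 lt H1 _ IHB VV IH.
apply: (@BelowU _ _ _ _ _ (oexp_add b a') (U `&` V1) (U `&` V2)).
- exact: oexp_lt_add2l.
- apply: IH => //; first by apply: height_sub H1 => v [].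
  by move=> v [Uv _]; apply: height_sub (Hcl _ Uv) => w [[]].
- exact: IHB.
- by move=> v [Uv /VV[]]; [left|right].
Qed.

(** * From heights to embeddings in ordinals *)

Section HeightEmbedding.
Variables (T : Type) (R : T -> T -> Prop) (W : ordinal_rep).
Hypothesis R_trans : forall v u w, R u v -> R v w -> R u w.
Implicit Types (U V : set T).

Definition embeds_below U (v : T) (z : omega_exp W) :=
  exists e : T -> omega_exp W, forall u, U u -> R u v -> ord_lt (e u) z /\
    forall u', U u' -> R u' u -> ord_lt (e u') (e u).

(** The least bound for an increasing map on the part of [U] below [v]. The value [oexp0] is a
    placeholder for the case without a bound; the lemmas on [rank] all assume that one exists. *)
Definition rank U (v : T) : omega_exp W :=
  if pselect (exists z, embeds_below U v z) is left e
  then projT1 (cid (@ord_min _ [set z | embeds_below U v z] e)) else oexp0 W.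

Lemma rankP U v z : embeds_below U v z ->
  embeds_below U v (rank U v) /\ ord_le (rank U v) z.
Proof.
move=> ez; rewrite /rank; case: pselect => [e|[]]; last by exists z.
by case: cid => /= r [er rmin]; split=> //; apply: rmin.
Qed.

Lemma rank_lt U u v z : U u -> R u v -> embeds_below U v z ->
  ord_lt (rank U u) (rank U v).
Proof.
move=> Uu Ruv /rankP[[e eP] _]; have [euv emono] := eP _ Uu Ruv.
apply: ord_le_lt_trans euv; apply: (proj2 (rankP _)); exists e => w Uw Rwu.
split; first exact: emono.
by move=> w' Uw' Rw'; apply: (proj2 (eP _ Uw _)) => //; apply: R_trans Ruv.
Qed.

Lemma rank_le U u v z : R u v -> embeds_below U v z ->
  ord_le (rank U u) (rank U v).
Proof.
move=> Ruv /rankP[[e eP] _]; apply: (proj2 (rankP _)); exists e => w Uw Rwu.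
have Rwv := R_trans Rwu Ruv.
by split=> [|w' Uw' Rw']; have [? e'] := eP _ Uw Rwv => //; apply: e'.
Qed.

(** Weak monotonicity is required everywhere, strictness only from points of [V]. Natural sums of
    such functions for [V1] and for [V2] then serve for the union: one summand grows strictly while
    the other does not decrease. *)
Definition ranking (g : W) V (s : T -> omega_exp W) :=
  [/\ forall v, oexp_bd g (s v), forall u v, R u v -> ord_le (s u) (s v) &
      forall u v, V u -> R u v -> ord_lt (s u) (s v)].

Lemma below_ranking_step (g : W) V :
  (forall g' U, ord_lt g' g -> height R g' U ->
     forall v, exists z, embeds_below U v z /\ oexp_bd g z) ->
  below R g V -> exists s, ranking g V s.
Proof.
move=> IH B; elim: B IH => {V}{}g V.
  move=> V0 _; exists (fun=> oexp0 W); split=> [v||u v /V0//].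
    exact: oexp_bd0.
  by move=> *; exact: ord_refl.
move=> g' V1 V2 lt H1 _ IHB VV IH; have [s [sbd sle slt]] := IHB IH.
have /choice [z zP] : forall v, exists z, embeds_below V1 v z /\ oexp_bd g z.
  exact: IH lt H1.
exists (fun v => oexp_add (rank V1 v) (s v)); split.
- move=> v; apply: oexp_bd_add => //; have [e b] := zP v.
  exact: oexp_bd_le (proj2 (rankP e)) b.
- move=> u v Ruv; apply: (@ord_trans _ (oexp_add (rank V1 u) (s v))).
    by apply: oexp_le_add2l; apply: sle.
  by apply: oexp_le_add2r; apply: rank_le Ruv (proj1 (zP v)).
- move=> u v /VV[V1u|V2u] Ruv.
    apply: (@ord_le_lt_trans _ (oexp_add (rank V1 u) (s v))).
      by apply: oexp_le_add2l; apply: sle.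
    by apply: oexp_lt_add2r; apply: rank_lt Ruv (proj1 (zP v)).
  apply: (@ord_lt_le_trans _ (oexp_add (rank V1 u) (s v))).
    by apply: oexp_lt_add2l; apply: slt.
  by apply: oexp_le_add2r; apply: rank_le Ruv (proj1 (zP v)).
Qed.

Lemma ranking_embeds (g : W) U u s :
  ranking g (U `&` [set v | R v u]) s ->
  embeds_below U u (s u).
Proof.
move=> [sbd sle slt]; exists s => v Uv Rvu; split; first exact: slt.
by move=> w Uw Rwv; apply: slt => //; split=> //=; apply: R_trans Rvu.
Qed.

(** What lies below a point [u] of [U] is a finite union of sets of height less than [g0]. By
    induction the rank of [u] is at most a natural sum of ordinals below [omega^g0], hence is below
    [omega^g0], and the latter bounds all ranks. *)
Lemma height_embeds (g g0 : W) U : ord_lt g0 g -> height R g0 U -> forall v,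
  exists z, embeds_below U v z /\ oexp_bd g z.
Proof.
elim/ord_ind: g0 g U => g0 IH g U lt H v.
have below_rk V : below R g0 V -> exists s, ranking g0 V s.
  apply: below_ranking_step => g' V' lt' H'; exact: (IH g' lt' g0 V' lt' H').
exists (oexp_pow g0); split; last exact: oexp_bd_pow.
have ex u : U u -> exists2 s, embeds_below U u (s u) & oexp_bd g0 (s u).
  move=> Uu; have [s rs] := below_rk _ (heightP H Uu).
  by exists s; [exact: ranking_embeds rs|case: rs].
exists (rank U) => u Uu _; have [s es bs] := ex _ Uu; split.
  by apply: oexp_bd_lt; apply: oexp_bd_le (proj2 (rankP es)) bs.
by move=> u' Uu' Ru'u; apply: rank_lt Ru'u es.
Qed.

Lemma below_ranking (g : W) V : below R g V -> exists s, ranking g V s.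
Proof.
by apply: below_ranking_step => g' U lt H; apply: height_embeds lt H.
Qed.

(** The exponent [g] may vary with [u]: no bound for [U] as a whole is needed to land in [omega^W].
    This is how the union of all fragments is treated at the end. *)
Lemma locally_height_embeds U :
  (forall u, U u -> exists g : W, below R g (U `&` [set v | R v u])) ->
  exists e : T -> omega_exp W, forall u v, U u -> U v -> R u v ->
    ord_lt (e u) (e v).
Proof.
move=> H; exists (rank U) => u v Uu Uv Ruv.
have [g /below_ranking[s rs]] := H _ Uv.
exact: rank_lt Ruv (ranking_embeds rs).
Qed.

Lemma height_minimal (g : W) U V : height R g U -> V `<=` U -> V !=set0 ->
  exists2 v, V v & forall w, V w -> ~ R w v.
Proof.
move=> H VU [v0 Vv0].
have [|e emono] := @locally_height_embeds U.
  by move=> u Uu; exists g; apply: heightP.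
have [|z [[v Vv <-] zmin]] := @ord_min _ (e @` V); first by exists (e v0), v0.
exists v => // w Vw Rwv; move/ord_ltNge: (emono _ _ (VU _ Vw) (VU _ Vv) Rwv).
by apply; apply: zmin; exists w.
Qed.

End HeightEmbedding.

(** * Order types of subsets of well-ordered types *)

Section OrderTypeLe.
Variables (T : Type) (lt : T -> T -> Prop) (A : set T) (W : ordinal_rep).
Hypothesis lt_irr : forall x, A x -> ~ lt x x.
Hypothesis lt_total : forall x y, A x -> A y -> x = y \/ lt x y \/ lt y x.
Variable e : T -> W.
Hypothesis e_mono : forall x y, A x -> A y -> lt x y -> ord_lt (e x) (e y).

Let leA : rel A := fun x y => `[< val x = val y \/ lt (val x) (val y) >].

Let AP (x : A) : A (val x). Proof. exact: set_valP. Qed.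

Let leA_e (x y : A) : leA x y <-> ord_le (e (val x)) (e (val y)).
Proof.
split=> [/asboolP[->|xy]|exy]; first exact: ord_refl.
  by apply/ord_le_eqVlt; right; apply: e_mono.
apply/asboolP; have [->|[xy|yx]] := lt_total (AP x) (AP y); [by left|by right|].
by move/ord_leNgt: exy; case; apply: e_mono.
Qed.

Lemma sub_wo : wochoice.well_order leA.
Proof.
apply: wochoice.antisymmetric_well_order.
  move=> x y /andP[/leA_e xy /leA_e yx]; apply: val_inj.
  have exy := ord_anti xy yx.
  by have [//|[|]] := lt_total (AP x) (AP y) => /e_mono-/(_ (AP _) (AP _));
    rewrite exy => /ord_ltxx.
move=> B [x0 Bx0].
have [|z [[x Bx <-] zmin]] := @ord_min W [set e (val x) | x in [set x | x \in B]].
  by exists (e (val x0)), x0.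
by exists x; split=> // y yB; apply/leA_e; apply: zmin; exists y.
Qed.

(** The image of an increasing map need not be an initial segment. Sending [x] to the least [z] that
    receives an increasing map from the predecessors of [x] corrects this; the map [e] shows that
    such [z] exist. *)
Lemma order_type_leP : order_type_le lt A W.
Proof.
pose V := OrdinalRep sub_wo.
have ltV (x y : V) : lt (val x) (val y) <-> ord_lt x y.
  split=> [xy|[/asboolP[/val_inj exy nxy|//]]]; last by case: nxy.
  split; first by apply/asboolP; right.
  by move=> exy; apply: (lt_irr (AP x)); rewrite {2}exy.
exists V; first by exists id; first exact: (Bijective (g := id)).
have eV (x y : V) : ord_lt x y -> ord_lt (e (val x)) (e (val y)).
  by move/ltV => ?; apply: e_mono => //; exact: AP.
pose below (x : V) (z : W) := exists f : V -> W, forall y, ord_lt y x ->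
  ord_lt (f y) z /\ forall y', ord_lt y' y -> ord_lt (f y') (f y).
have ex (x : V) : exists z, below x z /\ forall z', below x z' -> ord_le z z'.
  have [|z [? ?]] := @ord_min W [set z | below x z]; last by exists z.
  exists (e (val x)), (fun y => e (val y)) => y yx.
  by split; [exact: eV|move=> y'; exact: eV].
have [phi phiP] := choice ex.
have mono x y : ord_lt x y -> ord_lt (phi x) (phi y).
  move=> xy; have [[f fP] _] := phiP y; have [fx fmono] := fP _ xy.
  apply: ord_le_lt_trans fx; apply: (proj2 (phiP x)); exists f => w wx.
  split; first exact: fmono.
  by have [_ ] := fP _ (ord_lt_trans wx xy).
exists phi; split=> [x y|x w wx]; first split; first exact: mono.
  have [//|[->|yx]] := ord_cmp x y; first by move=> /ord_ltxx.
  by move=> /(ord_lt_trans (mono _ _ yx)) /ord_ltxx.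
(* [y0] is the first point whose value reaches [w]. All values before it are below [w], so [w] is
   itself a candidate for the value at [y0]. *)
have [|y0 [y0P y0min]] := @ord_min V [set y | ord_le w (phi y)]; first by exists x.
exists y0; apply: ord_anti y0P; apply: (proj2 (phiP y0)); exists phi => y yy0.
split; last by move=> y'; exact: mono.
by apply/ord_ltNge => /y0min; apply/ord_ltNge.
Qed.

End OrderTypeLe.

(** * Orders of magnitude in an ordered field *)

Section Magnitude.
Variable K : realFieldType.
Implicit Types (a b c d u v w : K) (U V : set K).

Definition bigO d a := exists N : nat, `|a| <= N%:R * d.

Lemma bigO0 d : bigO d 0.
Proof. by exists 0%N; rewrite normr0 mul0r. Qed.

Lemma bigOD d a b : bigO d a -> bigO d b -> bigO d (a + b).
Proof.
move=> [N aN] [M bM]; exists (N + M)%N; rewrite natrD mulrDl.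
exact: le_trans (ler_normD _ _) (lerD aN bM).
Qed.

Lemma bigON d a : bigO d (- a) <-> bigO d a.
Proof. by split=> -[N]; rewrite ?normrN => aN; exists N; rewrite ?normrN. Qed.

Lemma bigOB d a b : bigO d a -> bigO d b -> bigO d (a - b).
Proof. by move=> aN bN; apply: bigOD => //; apply/bigON. Qed.

Lemma bigO_id d : 0 <= d -> bigO d d.
Proof. by move=> d0; exists 1%N; rewrite mul1r ger0_norm. Qed.

Lemma bigO_le d a b : `|a| <= b -> bigO d b -> bigO d a.
Proof.
move=> ab [N bN]; exists N; apply: le_trans ab _; apply: le_trans bN.
exact: ler_norm.
Qed.

Lemma bigO_trans b d a : bigO b a -> bigO d b -> bigO d a.
Proof.
move=> [N aN] [M bM]; exists (N * M)%N; apply: le_trans aN _.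
rewrite natrM -mulrA; apply: ler_wpM2l => //.
exact: le_trans (ler_norm _) bM.
Qed.

Lemma bigOM c d a : 0 <= c -> bigO d a -> bigO (c * d) (c * a).
Proof.
move=> c0 [N aN]; exists N; rewrite normrM (ger0_norm c0) mulrCA.
exact: ler_wpM2l.
Qed.

Lemma bigO_mulr c d a : 0 <= c -> bigO d a -> bigO (d * c) (a * c).
Proof. by rewrite ![_ * c]mulrC; apply: bigOM. Qed.

(** The strict order on classes modulo O(d), so that a height for [ll d] bounds the order type of
    these classes. The case [d = 0] is the order of the field. *)
Definition ll d u v := forall N : nat, N%:R * d < v - u.

Lemma llP d u v : ~ ll d u v -> exists N : nat, v - u <= N%:R * d.
Proof. by move=> /existsNP[N /negP]; rewrite -leNgt => ?; exists N. Qed.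

Lemma ll_lt d u v : ll d u v -> u < v.
Proof. by move=> /(_ 0%N); rewrite mul0r subr_gt0. Qed.

Lemma ll0 u v : ll 0 u v <-> u < v.
Proof. by split=> [/ll_lt//|uv N]; rewrite mulr0 subr_gt0. Qed.

Lemma ll_trans d v u w : ll d u v -> ll d v w -> ll d u w.
Proof. by move=> uv /ll_lt vw N; apply: lt_trans (uv N) _; rewrite ltrD2r. Qed.

Lemma ll_bigO d u v : bigO d (v - u) -> ~ ll d u v.
Proof.
move=> [N vu] /(_ N); rewrite ltNge => /negP; apply.
exact: le_trans (ler_norm _) vu.
Qed.

Lemma ll_cmp d u v : 0 <= d -> ll d u v \/ bigO d (u - v) \/ ll d v u.
Proof.
move=> d0; have [|/llP[N vuN]] := pselect (ll d u v); first by left.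
have [|/llP[M uvM]] := pselect (ll d v u); first by right; right.
right; left; exists (N + M)%N; rewrite ler_norml natrD mulrDl.
by have := mulr_ge0 (ler0n K N) d0; have := mulr_ge0 (ler0n K M) d0; lra.
Qed.

Lemma ll_compat d u v u' v' : bigO d (u - u') -> bigO d (v - v') ->
  ll d u v -> ll d u' v'.
Proof.
move=> uu vv uv N; have [M ] := bigOB uu vv; rewrite ler_norml => /andP[h1 h2].
have := uv (N + M)%N; rewrite natrD mulrDl; lra.
Qed.

Definition sumset U V : set K := [set w | exists u v, [/\ U u, V v & w = u + v]].

Definition sumsets (l : seq (set K)) : set K := foldr sumset [set 0] l.

Lemma sumsets0 (l : seq (set K)) : (forall U, List.In U l -> U 0) -> sumsets l 0.
Proof.
elim: l => //= U l IH Ul; exists 0, 0; split; rewrite ?addr0 //.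
  by apply: Ul; left.
by apply: IH => V Vl; apply: Ul; right.
Qed.

Lemma sumsetsD (l : seq (set K)) :
  (forall U, List.In U l -> forall a b, U a -> U b -> U (a + b)) ->
  forall a b, sumsets l a -> sumsets l b -> sumsets l (a + b).
Proof.
elim: l => [|U l IH] Ul a b /=; first by move=> -> ->; rewrite addr0.
move=> [u [v [Uu lv ->]]] [u' [v' [Uu' lv' ->]]].
exists (u + u'), (v + v'); split; last by rewrite addrACA.
  by apply: Ul => //; left.
by apply: IH => // V Vl; apply: Ul; right.
Qed.

Lemma sumsets_in (l : seq (set K)) U u : (forall V, List.In V l -> V 0) ->
  List.In U l -> U u -> sumsets l u.
Proof.
elim: l => //= V l IH l0 [->|Ul] Uu.
  exists u, 0; split; rewrite ?addr0 //; apply: sumsets0 => V' ?.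
  by apply: l0; right.
exists 0, u; split; rewrite ?add0r //; first by apply: l0; left.
by apply: IH => // V' ?; apply: l0; right.
Qed.

Lemma sumsets_ind (Q : set K -> Prop) (l : seq (set K)) : Q [set 0] ->
  (forall U V, Q U -> Q V -> Q (sumset U V)) ->
  (forall U, List.In U l -> Q U) -> Q (sumsets l).
Proof.
move=> Q0 QD; elim: l => //= U l IH Ql; apply: QD; first by apply: Ql; left.
by apply: IH => V Vl; apply: Ql; right.
Qed.

Lemma height_sumset (W : ordinal_rep) d (a b : omega_exp W) U V : 0 <= d ->
  height (ll d) a U -> height (ll d) b V ->
  height (ll d) (oexp_add a b) (sumset U V).
Proof.
move=> d0; apply: height_op => u u' v v' uv.
have [|/llP[N uN]] := pselect (ll d u u'); first by left.
right=> M; have := uv (N + M)%N; rewrite natrD mulrDl; lra.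
Qed.

Inductive fsum (P : set K) : set K :=
| fsum0 : fsum P 0
| fsumD p s : P p -> fsum P s -> fsum P (p + s).

Lemma fsum_sub P P' : P `<=` P' -> fsum P `<=` fsum P'.
Proof. by move=> PP' s; elim=> [|p {}s /PP' Pp _]; [left|right]. Qed.

Lemma fsum1 (P : set K) p : P p -> fsum P p.
Proof. by move=> Pp; rewrite -[p]addr0; right=> //; left. Qed.

Lemma fsum_add (P : set K) s t : fsum P s -> fsum P t -> fsum P (s + t).
Proof.
move=> Ps; elim: Ps t => [|p {}s Pp _ IH] t Pt; first by rewrite add0r.
by rewrite -addrA; right=> //; apply: IH.
Qed.

Lemma fsum_split (P1 P2 P : set K) s : P `<=` P1 `|` P2 -> fsum P s ->
  exists s1 s2, [/\ fsum P1 s1, fsum P2 s2 & s = s1 + s2].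
Proof.
move=> PP; elim=> [|p {}s /PP Pp _ [s1 [s2 [f1 f2 ->]]]].
  by exists 0, 0; rewrite addr0; split=> //; left.
case: Pp => Pp; [exists (p + s1), s2|exists s1, (p + s2)]; split=> //.
- by right.
- by rewrite addrA.
- by right.
- by rewrite addrCA.
Qed.

Lemma fsum_ge0 (P : set K) s : (forall p, P p -> 0 < p) -> fsum P s -> 0 <= s.
Proof. by move=> P0; elim=> // p {}s /P0/ltW p0 _ s0; apply: addr_ge0. Qed.

Lemma fsum_dominant (P : set K) s : (forall p, P p -> 0 < p) -> fsum P s ->
  s != 0 -> exists p (N : nat), [/\ P p, p <= s & s <= N%:R * p].
Proof.
move=> P0; elim=> [|p {}s Pp fs IHs]; first by rewrite eqxx.
have p0 := P0 _ Pp; have s0 := fsum_ge0 P0 fs.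
move=> _; have [->|/IHs[q [N [Pq qs sN]]]] := eqVneq s 0.
  by exists p, 1%N; rewrite addr0 mul1r.
have [pq|qp] := leP p q.
  exists q, N.+1; split=> //; first by lra.
  by rewrite -natr1 mulrDl mul1r addrC lerD.
exists p, N.+1; split=> //; first by lra.
rewrite -natr1 mulrDl mul1r addrC lerD//.
by apply: le_trans sN _; apply: ler_wpM2l => //; apply: ltW.
Qed.

Fixpoint ksum (P : set K) (k : nat) : set K :=
  if k is k'.+1 then sumset P (ksum P k') else [set 0].

Lemma fsum_ksum (P : set K) m s : 0 < m -> (forall p, P p -> m <= p) -> fsum P s ->
  exists2 k, ksum P k s & k%:R * m <= s.
Proof.
move=> m0 mP; elim=> [|p {}s Pp _ [k ks kms]]; first by exists 0%N; rewrite ?mul0r.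
exists k.+1; first by exists p, s.
by rewrite -natr1 mulrDl mul1r addrC; apply: lerD => //; apply: mP.
Qed.

Definition arch_ll u v := forall N : nat, N%:R * u < v.

Lemma arch_llP u v : ~ arch_ll u v -> exists N : nat, v <= N%:R * u.
Proof. by move=> /existsNP[N /negP]; rewrite -leNgt => ?; exists N. Qed.

Lemma below_bigcup (T : Type) (R : T -> T -> Prop) (W : ordinal_rep) (g : W)
    (F : nat -> set T) n :
  (forall i, (i < n)%N -> below R g (F i)) ->
  below R g [set x | exists2 i, (i < n)%N & F i x].
Proof.
elim: n => [_|n IH FB]; first by apply: Below0 => x [].
apply: (@below_sub _ _ _ _ _ ([set x | exists2 i, (i < n)%N & F i x] `|` F n)).
  move=> x [i]; rewrite ltnS leq_eqVlt => /orP[/eqP->|ltn] Fx; first by right.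
  by left; exists i.
by apply: below_setU; [apply: IH => i ?; apply: FB; apply: leqW|exact: FB].
Qed.

Lemma height_ksum (W : ordinal_rep) (b : W) (a : omega_exp W) (P : set K) k :
  oexp_bd b a -> height (ll 0) a P ->
  exists2 g, oexp_bd b g & height (ll 0) g (ksum P k).
Proof.
move=> ab HP; elim: k => [|k [g gb Hg]].
  exists (oexp0 W); first exact: oexp_bd0.
  by constructor=> _ ->; apply: Below0 => v [-> /ll0]; rewrite ltxx.
exists (oexp_add a g); first exact: oexp_bd_add.
exact: height_sumset.
Qed.

(* A sum of elements of [P] that stays below a given bound has boundedly many
   summands of the dominant archimedean class, and the other summands are in
   lower classes. *)
Lemma height_fsum (W : ordinal_rep) (g one a : omega_exp W) (P : set K) :
  (forall p, P p -> 0 < p) -> ord_lt (oexp0 W) one ->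
  height (ll 0) (oexp_pow g) P -> height arch_ll a P ->
  height (ll 0) (oexp_pow (oexp_add (oexp_add g one) a)) (fsum P).
Proof.
move=> + one0; elim/(@ord_ind (omega_exp W)): a P => a IH P P0 HP HA.
(* The term [one] is for the case [a = 0]: [top] must exceed [g] strictly, since sums of boundedly
   many elements of [P] already need multiples of [omega^g]. *)
set top := oexp_add _ a.
have gtop : ord_lt g top.
  apply: ord_lt_le_trans (oexp_le_addr _ _).
  by rewrite -{1}(oexp_add0 g); apply: oexp_lt_add2l.
constructor=> s Ps.
have [->|s_neq0] := eqVneq s 0.
  apply: Below0 => t [Pt /ll0]; rewrite ltNge => /negP; apply.
  exact: fsum_ge0 Pt.
have [p1 [N [Pp1 _ sN]]] := fsum_dominant P0 Ps s_neq0.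
(* [Peq] holds the elements whose archimedean class is at least that of the dominant summand [p1].
   Its least element [m] limits the number of such summands in any smaller sum to [N * M]. *)
pose Peq := P `&` [set p | ~ arch_ll p p1].
pose Plt := P `&` [set p | arch_ll p p1].
have [||m [Pm pm_lt] mmin] := height_minimal (ll_trans (d := 0)) HP (V := Peq).
- by move=> p [].
- by exists p1; split=> // /(_ 1%N); rewrite mul1r ltxx.
have {}mmin p : Peq p -> m <= p.
  by move=> /mmin/ll0/negP; rewrite -leNgt.
have m0 := P0 _ Pm; have [M p1M] := arch_llP pm_lt.
have sm : s <= (N * M)%:R * m.
  by apply: le_trans sN _; rewrite natrM -mulrA; apply: ler_wpM2l.
have [gl glb Hlt] : exists2 gl, oexp_bd top gl & height (ll 0) gl (fsum Plt).
  have step V : below arch_ll a V ->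
      exists2 gl, oexp_bd top gl & height (ll 0) gl (fsum (P `&` V)).
    rewrite /top; move=> B; elim: B IH => {V}a1 V.
      move=> V0 _; exists (oexp0 _); first exact: oexp_bd0.
      have f0 t : fsum (P `&` V) t -> t = 0 by elim=> // p ? [_ /V0].
      by constructor=> t /f0 ->; apply: Below0 => u [/f0 -> /ll0]; rewrite ltxx.
    move=> a' V1 V2 lt H1 _ IHB VV IH; have [g2 g2b H2] := IHB IH.
    exists (oexp_add (oexp_pow (oexp_add (oexp_add g one) a')) g2).
      by apply: oexp_bd_add => //; apply: oexp_bd_pow; apply: oexp_lt_add2l.
    have H1' : height (ll 0) (oexp_pow (oexp_add (oexp_add g one) a'))
        (fsum (P `&` V1)).
      apply: IH => //; first by move=> p [/P0].
        by apply: height_sub HP => p [].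
      by apply: height_sub H1 => p [].
    apply: height_sub (height_sumset (lexx 0) H1' H2) => t.
    apply: fsum_split => p [Pp /VV[]]; [left|right]; split=> //.
  have [gl ? H] := step _ (heightP HA Pp1).
  by exists gl => //; apply: height_sub H; apply: fsum_sub => p [? ?]; split.
apply: (@below_sub _ _ _ _ _ [set t | exists2 k, (k < (N * M).+1)%N &
    sumset (ksum Peq k) (fsum Plt) t]).
  move=> t [Pt /ll0 ts].
  have [|t1 [t2 [f1 f2 tE]]] := fsum_split (P1 := Peq) (P2 := Plt) _ Pt.
    by move=> p Pp; have [|] := pselect (arch_ll p p1); [right|left].
  have [k kt1 kt] := fsum_ksum m0 mmin f1; exists k; last by exists t1, t2.
  have t20 : 0 <= t2 by apply: fsum_ge0 f2 => p [/P0].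
  have : k%:R * m < (N * M).+1%:R * m by rewrite -natr1 mulrDl mul1r; lra.
  by rewrite ltr_pM2r// ltr_nat.
apply: below_bigcup => k _.
have [gk gkb Hk] : exists2 gk, oexp_bd top gk & height (ll 0) gk (ksum Peq k).
  apply: height_ksum (oexp_bd_pow gtop) _.
  by apply: height_sub HP => p [].
apply: below_height (height_sumset (lexx 0) Hk Hlt).
by apply: oexp_bd_lt; apply: oexp_bd_add.
Qed.

Definition wo U := forall V, V `<=` U -> V !=set0 ->
  exists2 m, V m & forall v, V v -> m <= v.

Lemma wo_sub U V : U `<=` V -> wo V -> wo U.
Proof. by move=> UV HV S SU; apply: HV; apply: subset_trans UV. Qed.

Lemma height_wo (W : ordinal_rep) (g : W) U : height (ll 0) g U -> wo U.
Proof.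
move=> H V VU V0; have [m Vm mmin] := height_minimal (ll_trans (d := 0)) H VU V0.
by exists m => // v /mmin/ll0/negP; rewrite -leNgt.
Qed.

Lemma wo_ind U (Q : K -> Prop) : wo U ->
  (forall u, U u -> (forall v, U v -> v < u -> Q v) -> Q u) ->
  forall u, U u -> Q u.
Proof.
move=> HU IH u Uu; apply: contrapT => nQu.
have [||m [Um nQm] mmin] := HU (U `&` [set u | ~ Q u]); first by move=> v [].
  by exists u.
apply: nQm; apply: IH => // v Uv vm; apply: contrapT => nQv.
by have := mmin v (conj Uv nQv); rewrite leNgt vm.
Qed.

(** The finiteness lemma behind products of Hahn series, modulo O(c). With [u1] least among the
    first coordinates and [v1] its partner, a pair that is not congruent to [(u1, v1)] has [v < v1],
    and the recursion on [v1] along [V] ends. *)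
Lemma wo_pairs c U V : wo U -> wo V -> forall g, exists L : seq (K * K),
  (forall p, p \in L -> [/\ U p.1, V p.2 & bigO c (g - (p.1 + p.2))]) /\
  forall u v, U u -> V v -> bigO c (g - (u + v)) ->
    exists2 p, p \in L & bigO c (u - p.1) /\ bigO c (v - p.2).
Proof.
move=> HU HV g.
pose Q (B : set K) := exists L : seq (K * K),
  (forall p, p \in L -> [/\ U p.1, V p.2 & bigO c (g - (p.1 + p.2))]) /\
  forall u v, U u -> V v -> B v -> bigO c (g - (u + v)) ->
    exists2 p, p \in L & bigO c (u - p.1) /\ bigO c (v - p.2).
have step B : (forall v1, V v1 -> B v1 -> Q [set v | v < v1]) -> Q B.
  move=> IH; pose S := [set u | U u /\ exists v, [/\ V v, B v & bigO c (g - (u + v))]].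
  have [S0|nS] := pselect (S !=set0); last first.
    exists [::]; split=> // u v Uu Vv Bv uv; case: nS; exists u; split=> //.
    by exists v.
  have [|u1 [Uu1 [v1 [Vv1 Bv1 uv1]]] u1min] := HU S _ S0; first by move=> u [].
  have [L [LP Lcov]] := IH _ Vv1 Bv1; exists ((u1, v1) :: L); split.
    by move=> p; rewrite in_cons => /orP[/eqP->//|/LP].
  move=> u v Uu Vv Bv uv; have u1u : u1 <= u by apply: u1min; split=> //; exists v.
  have [uu1|nuu1] := pselect (bigO c (u - u1)).
    exists (u1, v1); first by rewrite mem_head.
    split=> //=; rewrite (_ : v - v1 = (g - (u1 + v1)) - (g - (u + v)) - (u - u1)).
      by apply: bigOB => //; apply: bigOB.
    by ring.
  have [|p pL pP] := Lcov u v Uu Vv _ uv; last first.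
    by exists p => //; rewrite in_cons pL orbT.
  rewrite /= ltNge; apply/negP => v1v; apply: nuu1.
  apply: (@bigO_le _ _ ((g - (u1 + v1)) - (g - (u + v)))); last exact: bigOB.
  by rewrite ger0_norm ?subr_ge0//; lra.
have [L [LP Lcov]] : Q setT.
  apply: (step) => v1 Vv1 _.
  apply: (@wo_ind _ (fun v1 => Q [set v | v < v1]) HV) Vv1 => v Vv IH.
  by apply: step => v2 Vv2 /= v2v; apply: IH.
by exists L; split=> // u v Uu Vv; apply: Lcov.
Qed.

Lemma wo_class_min c U u : wo U -> U u -> exists m, [/\ U m, bigO c (m - u) &
  forall v, U v -> bigO c (v - u) -> m <= v].
Proof.
move=> HU Uu.
have [||m [Um mu] mmin] := HU (U `&` [set v | bigO c (v - u)]).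
- by move=> v [].
- by exists u; split=> //=; rewrite subrr; apply: bigO0.
- by exists m; split=> // v Uv vu; apply: mmin.
Qed.

(** * Finiteness of classes in a window *)

Variable X : K.

(** In a window of width O(d X) below [g] only finitely many classes modulo O(d) occur. Looking only
    below [g] suffices for [height_disc], and the bound [g] is what limits the number of summands in
    [disc_fsum]. *)
Definition disc d U := forall g, exists L : seq K, forall v, U v -> v <= g ->
  bigO (d * X) (g - v) -> exists2 l, l \in L & bigO d (v - l).

Lemma disc_sub d U V : U `<=` V -> disc d V -> disc d U.
Proof. by move=> UV HV g; have [L LP] := HV g; exists L => v /UV; apply: LP. Qed.

Lemma disc_set1 d a : disc d [set a].
Proof.
move=> g; exists [:: a] => _ -> _ _; exists a; first by rewrite mem_head.
by rewrite subrr; apply: bigO0.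
Qed.

(** [wo_pairs] leaves finitely many pairs of classes modulo O(d X). In each of them the least
    elements [um] and [vm] are the reference points, because the one-sided windows need
    [u <= g - vm] and [v <= g - um]. *)
Lemma disc_sumset d U V : wo U -> wo V -> disc d U -> disc d V ->
  disc d (sumset U V).
Proof.
move=> HU HV DU DV g; have [Lp [LpP Lcov]] := wo_pairs (d * X) HU HV g.
have [LU LUP] := choice DU; have [LV LVP] := choice DV.
have /choice[um umP] : forall p : K * K, exists m, p \in Lp -> [/\ U m,
    bigO (d * X) (m - p.1) & forall v, U v -> bigO (d * X) (v - p.1) -> m <= v].
  move=> p; have [/LpP[Up _ _]|] := boolP (p \in Lp); last by exists 0.
  by have [m mP] := wo_class_min (d * X) HU Up; exists m.
have /choice[vm vmP] : forall p : K * K, exists m, p \in Lp -> [/\ V m,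
    bigO (d * X) (m - p.2) & forall v, V v -> bigO (d * X) (v - p.2) -> m <= v].
  move=> p; have [/LpP[_ Vp _]|] := boolP (p \in Lp); last by exists 0.
  by have [m mP] := wo_class_min (d * X) HV Vp; exists m.
exists (flatten [seq [seq x + y | x <- LU (g - vm p), y <- LV (g - um p)] | p <- Lp]).
move=> _ [u [v [Uu Vv ->]]] uvg guv.
have [p pL [up vp]] := Lcov _ _ Uu Vv guv.
have [Uum um1 ummin] := umP _ pL; have [Vvm vm2 vmmin] := vmP _ pL.
have umu := ummin _ Uu up; have vmv := vmmin _ Vv vp.
have [||x xL ux] := LUP (g - vm p) u Uu; first by lra.
  rewrite (_ : _ - u = (g - (u + v)) + ((v - p.2) - (vm p - p.2))); last by ring.
  by apply: bigOD => //; apply: bigOB.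
have [||y yL vy] := LVP (g - um p) v Vv; first by lra.
  rewrite (_ : _ - v = (g - (u + v)) + ((u - p.1) - (um p - p.1))); last by ring.
  by apply: bigOD => //; apply: bigOB.
exists (x + y); last first.
  by rewrite (_ : _ - _ = (u - x) + (v - y)); [apply: bigOD|ring].
apply/flattenP; exists [seq x + y | x <- LU (g - vm p), y <- LV (g - um p)].
  by apply/mapP; exists p.
by apply/allpairsP; exists (x, y).
Qed.

Lemma fsum_case (P Q : set K) s : fsum P s ->
  (exists p t, [/\ P p, ~ Q p, fsum P t & s = p + t]) \/ fsum (P `&` Q) s.
Proof.
elim=> [|p {}s Pp Ps [[q [t [Pq nQq Pt ->]]]|IH]]; first by right; left.
  left; exists q, (p + t); split=> //; first by right.
  by rewrite addrCA.
have [Qp|nQp] := pselect (Q p); first by right; right.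
by left; exists p, s.
Qed.

(** If all summands are O(d X), the gap makes those that are not O(d) at least a fixed fraction of
    [d X], so their number is bounded. Otherwise a larger summand is split off; the remainder is a
    smaller sum and is handled by induction along the well-ordered set of sums. *)
Lemma disc_fsum d P : 0 < d -> 1 <= X -> (forall p, P p -> 0 < p) ->
  (forall p, P p -> bigO d p \/ bigO p (d * X)) ->
  wo (fsum P) -> disc d P -> disc d (fsum P).
Proof.
move=> d0 X1 P0 gap HF DP; have X0 : 0 < X by apply: lt_le_trans X1.
have dX0 : 0 < d * X by apply: mulr_gt0.
have HP : wo P by apply: wo_sub HF => p; apply: fsum1.
have [LP LPP] := choice DP.
have small g : bigO (d * X) g -> exists L : seq K, forall s,
    fsum (P `&` [set p | bigO (d * X) p]) s -> s <= g ->
    exists2 l, l \in L & bigO d (s - l).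
  move=> [N gN].
  pose B := P `&` [set p | bigO (d * X) p /\ ~ bigO d p].
  have [M MP] : exists M : nat, forall p, B p -> d * X <= M%:R * p.
    have [B0|nB] := pselect (B !=set0); last first.
      by exists 0%N => p Bp; case: nB; exists p.
    have [|m [Pm [_ ndm]] mmin] := HP B _ B0; first by move=> p [].
    case: (gap _ Pm) => // -[M]; rewrite (gtr0_norm dX0) => mM; exists M => p Bp.
    by apply: le_trans mM _; apply: ler_wpM2l => //; apply: mmin.
  (* Sums of at most [k] representatives; the extra 0 makes the lists increase with [k]. *)
  pose Lk := fix Lk k := if k is k'.+1 then
    [seq x + y | x <- 0 :: LP g, y <- Lk k'] else [:: 0 : K].
  have Lk_le k l : l \in Lk k -> l \in Lk k.+1.
    by move=> lL; apply/allpairsP; exists (0, l); rewrite mem_head add0r.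
  have Lk_leq k k' l : (k <= k')%N -> l \in Lk k -> l \in Lk k'.
    by move=> /subnK <-; elim: (k' - k)%N => // i IH /IH; rewrite addSn; apply: Lk_le.
  exists (Lk (M * N)%N) => s Ps sg.
  (* [k] counts the summands that are not O(d); the others do not change the class and are
     dropped. *)
  suff [k [l [lk sl kM]]] : exists k l, [/\ l \in Lk k, bigO d (s - l) &
      k%:R * (d * X) <= M%:R * s].
    exists l => //; apply: Lk_leq lk.
    rewrite -(ler_nat K) -(ler_pM2r dX0); apply: le_trans kM _.
    rewrite natrM -mulrA; apply: ler_wpM2l => //; apply: le_trans sg _.
    exact: le_trans (ler_norm _) gN.
  elim: Ps sg => [|p {}s [Pp dXp] Ps IH] psg.
    by exists 0%N, 0; rewrite mem_head subrr mul0r mulr0; split=> //; apply: bigO0.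
  have s0 : 0 <= s by apply: fsum_ge0 Ps => q [/P0].
  have p0 := P0 _ Pp.
  have [|k [l [lk sl kM]]] := IH; first by lra.
  have [dp|ndp] := pselect (bigO d p).
    exists k, l; split=> //; first by rewrite -addrA; apply: bigOD.
    by apply: le_trans kM _; apply: ler_wpM2l => //; rewrite lerDr ltW.
  have [||l' l'L pl'] := LPP g p Pp; first by lra.
    by apply: bigOB => //; exists N.
  exists k.+1, (l' + l); split.
  - by apply/allpairsP; exists (l', l); rewrite in_cons l'L orbT.
  - by rewrite (_ : _ - _ = (p - l') + (s - l)); [apply: bigOD|ring].
  - rewrite -natr1 mulrDl mul1r mulrDr addrC; apply: lerD => //.
    by apply: MP; split.
have main s0 : fsum P s0 -> forall g, bigO (d * X) (g - s0) -> exists L : seq K,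
    forall s, fsum P s -> s <= g -> bigO (d * X) (g - s) ->
    exists2 l, l \in L & bigO d (s - l).
  apply: (@wo_ind _ (fun s0 => forall g, bigO (d * X) (g - s0) -> exists L : seq K,
    forall s, fsum P s -> s <= g -> bigO (d * X) (g - s) ->
    exists2 l, l \in L & bigO d (s - l)) HF) => {}s0 Ps0 IH g gs0.
  pose B := P `&` [set p | ~ bigO (d * X) p].
  have HB : wo B by apply: wo_sub HP => p [].
  have [Lp [LpP Lcov]] := wo_pairs (d * X) HB HF g.
  have /choice[um umP] : forall p : K * K, exists m, p \in Lp -> [/\ B m,
      bigO (d * X) (m - p.1) & forall v, B v -> bigO (d * X) (v - p.1) -> m <= v].
    move=> p; have [/LpP[Up _ _]|] := boolP (p \in Lp); last by exists 0.
    by have [m mP] := wo_class_min (d * X) HB Up; exists m.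
  have /choice[vm vmP] : forall p : K * K, exists m, p \in Lp -> [/\ fsum P m,
      bigO (d * X) (m - p.2) & forall v, fsum P v -> bigO (d * X) (v - p.2) -> m <= v].
    move=> p; have [/LpP[_ Vp _]|] := boolP (p \in Lp); last by exists 0.
    by have [m mP] := wo_class_min (d * X) HF Vp; exists m.
  have /choice[LV LVP] : forall p : K * K, exists L : seq K, p \in Lp ->
      forall s, fsum P s -> s <= g - um p -> bigO (d * X) (g - um p - s) ->
      exists2 l, l \in L & bigO d (s - l).
    move=> p; have [pL|] := boolP (p \in Lp); last by exists [::].
    have [[Pp1 np1] Pp2 gp] := LpP _ pL; have [[Pu nu] um1 _] := umP _ pL.
    have [||L LL] := IH _ Pp2 _ (g - um p); last by exists L.
      (* If [p.2] were at least [s0], then [p.1], which is [g - p.2] up to O(d X), would itself be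
         O(d X). *)
      rewrite ltNge; apply/negP => s0p; apply: np1.
      apply: (@bigO_le _ _ ((g - s0) - (g - (p.1 + p.2)))); last exact: bigOB.
      by rewrite gtr0_norm ?P0//; lra.
    rewrite (_ : _ - _ = (g - (p.1 + p.2)) - (um p - p.1)); last by ring.
    exact: bigOB.
  have [L0 L0P] : exists L : seq K, forall s,
      fsum (P `&` [set p | bigO (d * X) p]) s -> s <= g -> bigO (d * X) (g - s) ->
      exists2 l, l \in L & bigO d (s - l).
    have [/small[L LL]|ng] := pselect (bigO (d * X) g).
      by exists L => s Ps sg _; apply: LL.
    exists [::] => s Ps sg gs; case: ng.
    rewrite -(subrK s g); apply: bigOD => //.
    by elim: Ps => [|p t [_ dp] _ IHt]; [exact: bigO0|exact: bigOD].
  exists (L0 ++ flatten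
    [seq [seq x + y | x <- LP (g - vm p), y <- LV p] | p <- Lp]) => s Ps sg gs.
  have [[u [v [Pu nu Pv sE]]]|] := fsum_case [set p | bigO (d * X) p] Ps; last first.
    by move=> /L0P-/(_ sg gs)[l lL sl]; exists l => //; rewrite mem_cat lL.
  rewrite {}sE in Ps sg gs *; have Bu : B u by [].
  have [p pL [up vp]] := Lcov _ _ Bu Pv gs.
  have [Uum um1 ummin] := umP _ pL; have [Vvm vm2 vmmin] := vmP _ pL.
  have umu := ummin _ Bu up; have vmv := vmmin _ Pv vp.
  have [||x xL ux] := LPP (g - vm p) u Pu; first by lra.
    rewrite (_ : _ - u = (g - (u + v)) + ((v - p.2) - (vm p - p.2))); last by ring.
    by apply: bigOD => //; apply: bigOB.
  have [||y yL vy] := LVP p pL v Pv; first by lra.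
    rewrite (_ : _ - v = (g - (u + v)) + ((u - p.1) - (um p - p.1))); last by ring.
    by apply: bigOD => //; apply: bigOB.
  exists (x + y); last first.
    by rewrite (_ : _ - _ = (u - x) + (v - y)); [apply: bigOD|ring].
  rewrite mem_cat; apply/orP; right; apply/flattenP.
  exists [seq x + y | x <- LP (g - vm p), y <- LV p]; first by apply/mapP; exists p.
  by apply/allpairsP; exists (x, y).
move=> g; have [[s [Ps sg gs]]|ns] :=
    pselect (exists s, [/\ fsum P s, s <= g & bigO (d * X) (g - s)]).
  by have [L LL] := main s Ps g gs; exists L.
by exists [::] => s Ps sg gs; case: ns; exists s.
Qed.

(** Within one class modulo O(d X) each element has finitely many classes modulo O(d) below it.
    Refining therefore costs at most a factor [omega], and any nonzero [one] will do in the
    exponent. *)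
Lemma height_disc (W : ordinal_rep) (a one : omega_exp W) d U :
  0 <= d -> 0 <= X -> ord_lt (oexp0 W) one -> disc d U ->
  height (ll (d * X)) a U -> height (ll d) (oexp_add one a) U.
Proof.
move=> d0 X0 one0 DU HU.
apply: (@height_lex _ (ll (d * X)) (ll d) (fun v u => bigO (d * X) (v - u))) => //.
- by move=> u; rewrite subrr; apply: bigO0.
- move=> v u /ll_lt vu; have [?|[?|/ll_lt]] := ll_cmp v u (mulr_ge0 d0 X0).
  + by left.
  + by right.
  + by rewrite ltNge (ltW vu).
move=> u0 Uu0; constructor=> u [Uu /= uu0]; have [L LP] := DU u.
have sub : (U `&` [set v | bigO (d * X) (v - u0)] `&` [set v | ll d v u]) `<=`
    [set v | exists2 l, l \in L & bigO d (v - l)].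
  move=> v [[Uv vu0] /ll_lt vu]; apply: LP => //; first exact: ltW.
  by rewrite (_ : u - v = (u - u0) - (v - u0)); [apply: bigOB|ring].
apply: below_sub sub _.
elim: L {LP} => [|l L IH]; first by apply: Below0 => v [].
apply: (@BelowU _ _ _ _ _ (oexp0 W) [set v | bigO d (v - l)]
  [set v | exists2 l, l \in L & bigO d (v - l)]) => //.
  constructor=> v vl; apply: Below0 => w [wl /= wv].
  apply: ll_bigO wv; rewrite (_ : v - w = (v - l) - (w - l)); last by ring.
  exact: bigOB.
move=> v [l']; rewrite in_cons => /orP[/eqP->|l'L] vl'; first by left.
by right; exists l'.
Qed.

End Magnitude.

(** * Exponential ordered fields with an infinite element *)

(** [kexp_ge] is the only analytic axiom: monotonicity of [exp], the bounds on [ln] and the slow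
    growth of [ln X] are all derived with it. *)
Record exp_field := ExpField {
  ef_field :> realFieldType;
  kexp : ef_field -> ef_field;
  kln : ef_field -> ef_field;
  kX : ef_field;
  kexp_gt0 : forall a, 0 < kexp a;
  kexpD : forall a b, kexp (a + b) = kexp a * kexp b;
  kexp_ge : forall a, 1 + a <= kexp a;
  kexpK : forall a, kln (kexp a) = a;
  klnK : forall a, 0 < a -> kexp (kln a) = a;
  kX_gt : forall n : nat, n%:R < kX }.

Section ExpField.
Variable K : exp_field.
Implicit Types (a b d f g h p q s u v : K) (c j k m n : nat).
Local Notation X := (kX K).
Local Notation exp := (@kexp K).
Local Notation ln := (@kln K).
Local Notation bigO := (@bigO K).

Lemma kexp0 : exp 0 = 1.
Proof.
by apply: (mulfI (lt0r_neq0 (kexp_gt0 (0 : K)))); rewrite -kexpD addr0 mulr1.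
Qed.

Lemma kexpN a : exp (- a) = (exp a)^-1.
Proof.
apply: (mulfI (lt0r_neq0 (kexp_gt0 a))).
by rewrite -kexpD subrr kexp0 divff// lt0r_neq0// kexp_gt0.
Qed.

Lemma kexp_ltr a b : a < b -> exp a < exp b.
Proof.
move=> ab; rewrite -(subrK a b) addrC kexpD -[ltLHS]mulr1 ltr_pM2l ?kexp_gt0//.
by apply: lt_le_trans (kexp_ge _); rewrite ltrDl subr_gt0.
Qed.

Lemma kexp_lt a b : (exp a < exp b) = (a < b).
Proof.
apply/idP/idP; last exact: kexp_ltr.
by apply: contraTT; rewrite -!leNgt le_eqVlt => /orP[/eqP->//|/kexp_ltr/ltW].
Qed.

Lemma kexp_le a b : (exp a <= exp b) = (a <= b).
Proof. by rewrite !leNgt kexp_lt. Qed.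

Lemma kln_lt a b : 0 < a -> 0 < b -> (ln a < ln b) = (a < b).
Proof. by move=> a0 b0; rewrite -kexp_lt !klnK. Qed.

Lemma kln_le a b : 0 < a -> 0 < b -> (ln a <= ln b) = (a <= b).
Proof. by move=> a0 b0; rewrite -kexp_le !klnK. Qed.

Lemma klnM a b : 0 < a -> 0 < b -> ln (a * b) = ln a + ln b.
Proof. by move=> a0 b0; rewrite -[RHS]kexpK kexpD !klnK. Qed.

Lemma kln1 : ln 1 = 0. Proof. by rewrite -kexp0 kexpK. Qed.

Lemma klnV a : 0 < a -> ln a^-1 = - ln a.
Proof. by move=> a0; rewrite -[RHS]kexpK kexpN klnK. Qed.

Lemma kln_div a b : 0 < a -> 0 < b -> ln (a / b) = ln a - ln b.
Proof. by move=> a0 b0; rewrite klnM ?invr_gt0// klnV. Qed.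

Lemma kln_ge0 a : 1 <= a -> 0 <= ln a.
Proof.
by move=> a1; rewrite -kln1 kln_le//; apply: lt_le_trans a1; exact: ltr01.
Qed.

Lemma kln_leB1 a : 0 < a -> ln a <= a - 1.
Proof. by move=> a0; have := kexp_ge (ln a); rewrite klnK//; lra. Qed.

Lemma kln_geBV a : 0 < a -> 1 - a^-1 <= ln a.
Proof.
by move=> a0; have := @kln_leB1 a^-1; rewrite invr_gt0 klnV// => /(_ a0); lra.
Qed.

Lemma kexp_nat n a : exp (n%:R * a) = exp a ^+ n.
Proof.
elim: n => [|n IH]; first by rewrite mul0r kexp0.
by rewrite -natr1 mulrDl mul1r addrC kexpD IH exprS.
Qed.

Lemma kln_exprn n a : 0 < a -> ln (a ^+ n) = n%:R * ln a.
Proof. by move=> a0; rewrite -[RHS]kexpK kexp_nat klnK. Qed.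

Lemma kX_gt0 : 0 < X. Proof. exact: (kX_gt K 0). Qed.
Lemma kX_ge1 : 1 <= X. Proof. exact: ltW (kX_gt K 1). Qed.
Hint Resolve kX_gt0 kX_ge1 : core.

Lemma kX_big n : n%:R <= X. Proof. exact/ltW/kX_gt. Qed.

Lemma kln2_ge : 2^-1 <= ln 2.
Proof. by have := @kln_geBV 2 ltac:(lra); lra. Qed.

Lemma kln2_le1 : ln 2 <= 1.
Proof. by have := @kln_leB1 2 ltac:(lra); lra. Qed.

(** The crude base 4 replaces e: [1/2 <= ln 2] gives [exp (1/2) <= 2], hence [exp 1 <= 4]. *)
Lemma kexp_nat_le n : exp n%:R <= (4 ^ n)%:R.
Proof.
have h : exp 2^-1 <= 2 by rewrite -[leRHS]klnK// kexp_le kln2_ge.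
rewrite -[n%:R]mulr1 kexp_nat natrX; apply: lerXn2r; rewrite ?nnegrE//.
  exact/ltW/kexp_gt0.
rewrite [X in exp X](_ : _ = 2^-1 + 2^-1); last by lra.
have := kexp_gt0 (2^-1 : K); rewrite kexpD; nra.
Qed.

Lemma klnX_gt n : n%:R < ln X.
Proof.
rewrite -kexp_lt klnK//; apply: le_lt_trans (kexp_nat_le n) _; exact: kX_gt.
Qed.

Lemma klnX_gt0 : 0 < ln X. Proof. exact: (klnX_gt 0). Qed.
Hint Resolve klnX_gt0 : core.

(** [exp X] is the power of order [n+1] of [exp (X/(n+1))], which is at least [X/(n+1)]. As [X]
    exceeds the number [(n+1)^(n+1)], this power is at least [X^n]. *)
Lemma klnX_small n : n%:R * ln X <= X.
Proof.
rewrite -kexp_le kexp_nat klnK//.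
pose r : K := n.+1%:R; have r0 : 0 < r by rewrite ltr0n.
rewrite -[X in leRHS](divfK (lt0r_neq0 r0)) [X in kexp X]mulrC kexp_nat.
apply: (@le_trans _ _ ((X / r) ^+ n.+1)); last first.
  apply: lerXn2r; rewrite ?nnegrE ?(ltW (kexp_gt0 _))//.
    by rewrite divr_ge0// ltW.
  by apply: le_trans (kexp_ge _); rewrite lerDr.
rewrite expr_div_n exprSr -mulrA ler_peMr ?exprn_ge0 ?(ltW kX_gt0)//.
by rewrite ler_pdivlMr ?exprn_gt0// mul1r -natrX kX_big.
Qed.

Lemma kX_not_lnX n : ~ X <= n%:R * ln X.
Proof.
move=> h; have := klnX_small n.+1; rewrite -natr1 mulrDl mul1r.
by have := klnX_gt0; lra.
Qed.

(** * Skolem elements *)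

Inductive skS : set K :=
| skS_one : skS 1
| skS_X : skS X
| skS_add f g : skS f -> skS g -> skS (f + g)
| skS_mul f g : skS f -> skS g -> skS (f * g)
| skS_pow f g : skS f -> skS g -> skS (exp (g * ln f)).

Definition kE c j : K := exp (X * ln c%:R) * X ^+ j.

Inductive skA : set K :=
| skA_one : skA 1
| skA_X : skA X
| skA_add f g : skA f -> skA g -> skA (f + g)
| skA_mul f g : skA f -> skA g -> skA (f * g)
| skA_pow h c j : (0 < c)%N -> skA h -> skA (exp (kE c j * ln h)).

Lemma kE_gt0 c j : 0 < kE c j.
Proof. by rewrite mulr_gt0 ?kexp_gt0 ?exprn_gt0. Qed.
Hint Resolve kE_gt0 : core.

Lemma kEM c j c' j' : (0 < c)%N -> (0 < c')%N ->
  kE c j * kE c' j' = kE (c * c') (j + j').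
Proof.
move=> c0 c'0; rewrite /kE natrM klnM ?ltr0n// mulrDr kexpD exprD; ring.
Qed.

Lemma kE_ge1 c j : (0 < c)%N -> 1 <= kE c j.
Proof.
move=> c0; apply: mulr_ege1; last exact: exprn_ege1.
rewrite -[leLHS]kexp0 kexp_le; apply: mulr_ge0; first exact: ltW.
by apply: kln_ge0; rewrite ler1n.
Qed.

Lemma kE1 j : kE 1 j = X ^+ j.
Proof. by rewrite /kE kln1 mulr0 kexp0 mul1r. Qed.

(** A larger base absorbs powers of [X]: [ln (m'/m)] is at least [1/m'], while [k ln X <= X/m']. *)
Lemma kE_lt m m' k : (0 < m)%N -> (m < m')%N -> kE m k <= kE m' 0.
Proof.
move=> m0 mm'; have m'0 : (0 < m')%N by apply: leq_ltn_trans mm'.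
have m0' : (0 : K) < m%:R by rewrite ltr0n.
have m'0' : (0 : K) < m'%:R by rewrite ltr0n.
rewrite /kE expr0 mulr1 -[X ^+ k]klnK ?exprn_gt0// kln_exprn// -kexpD kexp_le.
rewrite -lerBrDl -mulrBr -kln_div//.
apply: (@le_trans _ _ (X * m'%:R^-1)).
  rewrite ler_pdivlMr// mulrAC -natrM; exact: klnX_small.
rewrite ler_pM2l//; apply: le_trans (kln_geBV _); last by rewrite divr_gt0.
rewrite invf_div lerBrDr -[X in X + _]mul1r -mulrDl ler_pdivrMr// mul1r.
by rewrite -(natrD _ 1) add1n ler_nat.
Qed.

Lemma kE_le m k k' : (k <= k')%N -> kE m k <= kE m k'.
Proof. by move=> kk'; rewrite ler_pM2l ?kexp_gt0//; apply: ler_weXn2l. Qed.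

Lemma kE_leq m m' k : (0 < m)%N -> (m <= m')%N -> kE m k <= kE m' k.
Proof.
move=> m0; rewrite leq_eqVlt => /orP[/eqP->//|mm'].
by apply: le_trans (kE_lt k m0 mm') _; apply: kE_le.
Qed.

Lemma skS_ge1 s : skS s -> 1 <= s.
Proof.
elim=> // [f g _ f1 _ g1|f g _ f1 _ g1|f g _ f1 _ g1]; first by lra.
  exact: mulr_ege1.
rewrite -kexp0 kexp_le mulr_ge0 ?kln_ge0//; lra.
Qed.

Lemma kX2_le_pow2 : X ^+ 2 <= exp (X * ln 2).
Proof.
rewrite -[leLHS]klnK ?exprn_gt0// kexp_le kln_exprn//.
have := klnX_small 4; have := kln2_ge; have := kX_gt0; nra.
Qed.

(** Serves for powers with a numerical base [f >= 2]: [f^g] is below some [N^X] only if [g] is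
    linear, and for [g = a X + b] it is the number [f^b] times [kE (f^a) 0]. *)
Lemma skS_linear s : skS s ->
  (exists a b : nat, (0 < a + b)%N /\ s = a%:R * X + b%:R) \/ X ^+ 2 <= s.
Proof.
have lin (a b : nat) : (0 < a + b)%N -> [\/ a%:R * X + b%:R = 1 :> K,
    (2 <= b)%N /\ a%:R * X + b%:R = b%:R :> K | X <= a%:R * X + b%:R].
  case: a => [|a] ab; last first.
    by apply: Or33; rewrite -natr1 mulrDl mul1r; have := kX_gt0;
      have := mulr_ge0 (ler0n K a) (ltW kX_gt0); have := ler0n K b; lra.
  rewrite mul0r add0r; case: b ab => [//|[|b]] _; first by apply: Or31.
  by apply: Or32.
have nat_lin (b : nat) : (0 < b)%N ->
    (exists a b' : nat, (0 < a + b')%N /\ b%:R = a%:R * X + b'%:R) \/ X ^+ 2 <= b%:R.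
  by move=> b0; left; exists 0%N, b; rewrite mul0r add0r.
have tri s' : (exists a b : nat, (0 < a + b)%N /\ s' = a%:R * X + b%:R) \/
      X ^+ 2 <= s' -> [\/ s' = 1, exists2 b : nat, (2 <= b)%N & s' = b%:R | X <= s'].
  move=> [[a [b [ab ->]]]|h]; last first.
    by apply: Or33; apply: le_trans h; rewrite expr2 ler_peMl// ltW.
  have [->|[b2 ->]|h] := lin _ _ ab; [exact: Or31|apply: Or32; by exists b|exact: Or33].
have XX f g : X <= f -> X <= g -> X ^+ 2 <= f * g.
  by move=> fX gX; rewrite expr2; apply: ler_pM => //; apply: ltW.
elim=> [||f g Sf If Sg Ig|f g Sf If Sg Ig|f g Sf If Sg Ig].
- by left; exists 0%N, 1%N; rewrite mul0r add0r.
- by left; exists 1%N, 0%N; rewrite mul1r addr0.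
- have f1 := skS_ge1 Sf; have g1 := skS_ge1 Sg.
  case: If => [[a [b [ab fE]]]|If]; last by right; lra.
  case: Ig => [[a' [b' [ab' gE]]]|Ig]; last by right; lra.
  left; exists (a + a')%N, (b + b')%N; split; first by rewrite addnACA ltn_addr.
  by rewrite fE gE !natrD; ring.
- have f1 := skS_ge1 Sf; have g1 := skS_ge1 Sg.
  have [fE|[b b2 fE]|fX] := tri _ If.
  + by rewrite fE mul1r.
  + case: Ig => [[a' [b' [ab' gE]]]|Ig].
      left; exists (b * a')%N, (b * b')%N; split; first by rewrite -mulnDr muln_gt0 ab' andbT ltnW.
      by rewrite fE gE !natrM; ring.
    by right; apply: le_trans Ig _; rewrite ler_peMl//; lra.
  + have [gE|[b b2 gE]|gX] := tri _ Ig.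
    * by rewrite gE mulr1.
    * case: If => [[a' [b' [ab' fE]]]|If].
        left; exists (b * a')%N, (b * b')%N; split; first by rewrite -mulnDr muln_gt0 ab' andbT ltnW.
        by rewrite fE gE !natrM; ring.
      by right; apply: le_trans If _; rewrite ler_peMr//; lra.
    * by right; apply: XX.
- have f1 := skS_ge1 Sf; have g1 := skS_ge1 Sg.
  have f0 : 0 < f by lra.
  have [gE|[b b2 gE]|gX] := tri _ Ig.
  + by rewrite gE mul1r klnK.
  + rewrite gE kexp_nat klnK//; have [fE|[b' b'2 fE]|fX] := tri _ If.
    * by rewrite fE expr1n; apply: (nat_lin 1%N).
    * by rewrite fE -natrX; apply: nat_lin; rewrite expn_gt0 ltnW.
    * right; apply: (@le_trans _ _ (f ^+ 2)); last exact: ler_weXn2l.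
      by apply: lerXn2r => //; rewrite nnegrE ltW.
  + have f2 : f = 1 \/ 2 <= f.
      have [|[b' b'2 fE]|fX] := tri _ If; first by left.
        by right; rewrite fE ler_nat.
      by right; apply: le_trans fX; apply: (kX_big 2).
    case: f2 => [->|f2].
      by rewrite kln1 mulr0 kexp0; apply: (nat_lin 1%N).
    right; apply: le_trans kX2_le_pow2 _; rewrite kexp_le.
    apply: ler_pM => //; [exact: ltW|apply: kln_ge0; lra|].
    by rewrite kln_le//; lra.
Qed.

Lemma skS_cases s : skS s ->
  [\/ s = 1, exists2 b : nat, (2 <= b)%N & s = b%:R | X <= s].
Proof.
move=> /skS_linear[[a [b [ab ->]]]|h]; last first.
  by apply: Or33; apply: le_trans h; rewrite expr2 ler_peMl// ltW.
case: a ab => [|a] ab; last first.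
  by apply: Or33; rewrite -natr1 mulrDl mul1r; have := kX_gt0;
    have := mulr_ge0 (ler0n K a) (ltW kX_gt0); have := ler0n K b; lra.
rewrite mul0r add0r; case: b ab => [//|[|b]] _; first exact: Or31.
by apply: Or32; exists b.+2.
Qed.

Lemma skS_ge2 s : skS s -> s = 1 \/ 2 <= s.
Proof.
move=> /skS_cases[->|[b b2 ->]|sX]; [by left|by right; rewrite ler_nat|right].
exact: le_trans (kX_big 2) sX.
Qed.

Definition kEs : set K := fsum [set e | exists c j, (0 < c)%N /\ e = kE c j].

Lemma kEs1 c j : (0 < c)%N -> kEs (kE c j).
Proof. by move=> c0; apply: fsum1; exists c, j. Qed.

Lemma kEsM e e' : kEs e -> kEs e' -> kEs (e * e').
Proof.
elim=> [|e1 e2 [c [j [c0 ->]]] _ IH] e'P; first by rewrite mul0r; left.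
rewrite mulrDl; apply: fsum_add (IH e'P).
elim: e'P => [|e3 e4 [c' [j' [c'0 ->]]] _ IH']; first by rewrite mulr0; left.
by rewrite mulrDr kEM//; right=> //; exists (c * c')%N, (j + j')%N; rewrite muln_gt0 c0.
Qed.

Lemma kEs_nat n : kEs n%:R.
Proof.
elim: n => [|n IH]; first exact: fsum0.
by rewrite -natr1 addrC; right=> //; exists 1%N, 0%N; rewrite kE1.
Qed.

(** For a power [f^g] below [N^X]: a numerical base [f >= 2] forces a linear exponent, and an
    infinite base [f >= X] forces a numerical exponent, as [X^X] is above [N^X]. *)
Lemma skS_kEs s : skS s -> forall N, (0 < N)%N -> s < exp (X * ln N%:R) -> kEs s.
Proof.
elim=> [||f g Sf If Sg Ig|f g Sf If Sg Ig|f g Sf If Sg Ig] N N0 sN.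
- exact: (kEs_nat 1).
- by rewrite -[X]expr1 -kE1; apply: kEs1.
- have := skS_ge1 Sf; have := skS_ge1 Sg => *; apply: fsum_add.
    by apply: (If N) => //; lra.
  by apply: (Ig N) => //; lra.
- have f1 := skS_ge1 Sf; have g1 := skS_ge1 Sg; apply: kEsM.
    by apply: (If N) => //; apply: le_lt_trans sN; rewrite ler_peMr//; lra.
  by apply: (Ig N) => //; apply: le_lt_trans sN; rewrite ler_peMl//; lra.
have f1 := skS_ge1 Sf; have g1 := skS_ge1 Sg; have f0 : 0 < f by lra.
rewrite kexp_lt in sN.
have lnN : ln N%:R <= N%:R.
  by have := @kln_leB1 N%:R; rewrite ltr0n => /(_ N0); lra.
have [fE|[b b2 fE]|fX] := skS_cases Sf.
- by rewrite fE kln1 mulr0 kexp0; apply: (kEs_nat 1).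
- have lnb : 2^-1 <= ln f.
    by apply: le_trans kln2_ge _; rewrite kln_le// fE ler_nat.
  have [[a [b' [_ gE]]]|gX] := skS_linear Sg; last first.
    have := kX_gt K (2 * N)%N; rewrite natrM => NX.
    have : g * 2^-1 < X * N%:R.
      apply: le_lt_trans (lt_le_trans sN _); first by apply: ler_wpM2l => //; lra.
      by rewrite ler_pM2l.
    by move: gX; rewrite expr2 => gX; have := kX_gt0; nra.
  have -> : exp (g * ln f) = exp (X * ln (f ^+ a)) * f ^+ b'.
    by rewrite gE mulrDl kexpD kexp_nat klnK// kln_exprn//; congr (exp _ * _); ring.
  rewrite fE -!natrX; apply: kEsM; last exact: kEs_nat.
  by rewrite -[exp _]mulr1 -(expr0 X); apply: kEs1; rewrite expn_gt0 ltnW.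
have lnXf : ln X <= ln f by rewrite kln_le.
have [gE|[b b2 gE]|gX] := skS_cases Sg.
- rewrite gE mul1r klnK//; apply: (If N) => //.
  by rewrite -[ltLHS]klnK// kexp_lt; move: sN; rewrite gE mul1r.
- rewrite gE kexp_nat klnK//; have kf : kEs f.
    apply: (If N) => //; rewrite -[ltLHS]klnK// kexp_lt.
    apply: le_lt_trans sN; rewrite gE ler_peMl ?ler1n 1?ltnW//.
    by apply: kln_ge0; lra.
  elim: (b) => [|i IH]; first by rewrite expr0; apply: (kEs_nat 1).
  by rewrite exprS; apply: kEsM.
- exfalso; have : X * ln X < X * N%:R.
    apply: le_lt_trans (lt_le_trans sN _); last by rewrite ler_pM2l.
    by apply: ler_pM => //; apply: ltW.
  by rewrite ltr_pM2l// ltNge (ltW (klnX_gt N)).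
Qed.

Lemma skS_skA s : skS s -> forall N, (0 < N)%N -> ln s < exp (X * ln N%:R) -> skA s.
Proof.
elim=> [||f g Sf If Sg Ig|f g Sf If Sg Ig|f g Sf If Sg Ig] N N0 sN.
- exact: skA_one.
- exact: skA_X.
- have := skS_ge1 Sf; have := skS_ge1 Sg => *.
  by apply: skA_add; [apply: (If N)|apply: (Ig N)] => //; apply: le_lt_trans sN;
    rewrite kln_le//; lra.
- have f1 := skS_ge1 Sf; have g1 := skS_ge1 Sg.
  have lf := kln_ge0 f1; have lg := kln_ge0 g1.
  move: sN; rewrite klnM; [|lra|lra] => sN.
  by apply: skA_mul; [apply: (If N)|apply: (Ig N)] => //; lra.
have f1 := skS_ge1 Sf; have g1 := skS_ge1 Sg; have f0 : 0 < f by lra.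
rewrite kexpK in sN.
have [->|f2] := skS_ge2 Sf; first by rewrite kln1 mulr0 kexp0; apply: skA_one.
have lf : 2^-1 <= ln f by apply: le_trans kln2_ge _; rewrite kln_le.
have Af : skA f.
  by apply: (If N) => //; apply: le_lt_trans sN; rewrite ler_peMl//; lra.
(* From [g ln f < N^X] and [ln f >= 1/2] follows [g < 2 N^X], which is at most [(2 N)^X]. The
   exponent is then a sum of terms [c^X X^j], and the power a product of generators of [skA]. *)
have : kEs g.
  apply: (@skS_kEs _ Sg (2 * N)%N); first by rewrite muln_gt0.
  rewrite natrM klnM ?ltr0n// mulrDr kexpD.
  have : 2 <= exp (X * ln 2).
    apply: le_trans kX2_le_pow2; apply: le_trans (kX_big 2) _.
    by rewrite expr2 ler_peMl// ltW.
  by have := kexp_gt0 (X * ln N%:R); nra.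
elim=> [|_ e [c [j [c0 ->]]] _ IH]; first by rewrite mul0r kexp0; apply: skA_one.
by rewrite mulrDl kexpD; apply: skA_mul => //; apply: skA_pow.
Qed.

Lemma skA_ge1 s : skA s -> 1 <= s.
Proof.
elim=> // [f g _ f1 _ g1|f g _ f1 _ g1|h c j c0 _ h1]; first by lra.
  exact: mulr_ege1.
by rewrite -kexp0 kexp_le mulr_ge0 ?kln_ge0// ltW.
Qed.

Lemma skA_gt0 s : skA s -> 0 < s. Proof. by move=> /skA_ge1; lra. Qed.

Lemma skA_exprn h n : skA h -> skA (h ^+ n).
Proof.
by move=> Ah; elim: n => [|n IH]; [exact: skA_one|rewrite exprS; exact: skA_mul].
Qed.

Lemma skA_kE c j : (0 < c)%N -> skA (kE c j).
Proof.
move=> c0; apply: skA_mul; last exact/skA_exprn/skA_X.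
have An (n : nat) : (0 < n)%N -> skA n%:R.
  elim: n => [//|[_ _|n IH _]]; first exact: skA_one.
  by rewrite -natr1; apply: skA_add; [exact: IH|exact: skA_one].
rewrite -[X in exp (X * _)]expr1 -(kE1 1).
by apply: skA_pow => //; apply: An.
Qed.

(** ** Sizes *)

Definition kF m k : set K :=
  [set h | skA h /\ bigO (kE m k * ln X) (ln h)].

Lemma bigO_kE_1 m k : (0 < m)%N -> bigO (kE m k * ln X) 1.
Proof.
move=> m0; exists 1%N; rewrite normr1 mul1r; apply: mulr_ege1; first exact: kE_ge1.
exact: ltW (klnX_gt 1).
Qed.

(** The two bounds differ by a factor O(ln X), which is smaller than [X]; hence [h] determines [m]
    and [k], by [kE_size_le]. The constant [ln 2] matches the base 2 of the bound in the theorem. *)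
Lemma skA_size h : skA h -> h = 1 \/ exists m k,
  [/\ (0 < m)%N, kE m k * ln 2 <= ln h & bigO (kE m k * ln X) (ln h)].
Proof.
elim=> [||f g Af If Ag Ig|f g Af If Ag Ig|f c j c0 Af If].
- by left.
- right; exists 1%N, 0%N; rewrite kE1 expr0 !mul1r kln_le// (kX_big 2).
  by split=> //; apply: bigO_id; apply: ltW.
- wlog fg : f g Af If Ag Ig / f <= g.
    move=> H; have [fg|/ltW gf] := leP f g; first exact: H.
    by rewrite addrC; apply: H.
  have f1 := skA_ge1 Af; have g1 := skA_ge1 Ag.
  have l2g : ln (f + g) <= ln 2 + ln g.
    have g0 : 0 < g by lra.
    by rewrite -klnM// kln_le//; lra.
  have lg : ln g <= ln (f + g) by rewrite kln_le//; lra.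
  have l0 : 0 <= ln (f + g) by apply: kln_ge0; lra.
  right; case: Ig => [gE|[m [k [m0 lo hi]]]].
    have fE : f = 1 by lra.
    rewrite {l2g lg l0}gE fE; exists 1%N, 0%N; rewrite kE1 expr0 !mul1r; split=> //.
    exists 1%N; rewrite mul1r ger0_norm ?kln_ge0//; last by lra.
    by rewrite kln_le//; exact: (kX_big 2).
  exists m, k; split=> //; first exact: le_trans lo lg.
  apply: (@bigO_le _ _ _ (1 + ln g)).
    by rewrite ger0_norm//; have := kln2_le1; lra.
  by apply: bigOD => //; apply: bigO_kE_1.
- wlog fg : f g Af If Ag Ig / f <= g.
    move=> H; have [fg|/ltW gf] := leP f g; first exact: H.
    by rewrite mulrC; apply: H.
  have f1 := skA_ge1 Af; have g1 := skA_ge1 Ag.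
  have lfg : ln f <= ln g by rewrite kln_le//; lra.
  have lf := kln_ge0 f1.
  have lE : ln (f * g) = ln f + ln g by rewrite klnM//; lra.
  case: Ig => [gE|[m [k [m0 lo hi]]]]; first by left; rewrite gE mulr1; lra.
  right; exists m, k; split=> //; first by lra.
  apply: (@bigO_le _ _ _ (ln g + ln g)); last exact: bigOD.
  by rewrite ger0_norm; lra.
- case: If => [->|[m [k [m0 lo hi]]]]; first by left; rewrite kln1 mulr0 kexp0.
  right; exists (c * m)%N, (j + k)%N; rewrite -kEM// kexpK; split.
  + by rewrite muln_gt0 c0.
  + by rewrite -mulrA ler_pM2l.
  + by rewrite -mulrA; apply: bigOM => //; apply: ltW.
Qed.

Lemma kE_size_le m k n K0 : (0 < m)%N -> (0 < n)%N ->
  bigO (kE n K0 * ln X) (kE m k * ln 2) ->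
  (m < n)%N \/ (m = n /\ (k <= K0)%N).
Proof.
move=> m0 n0 [C]; rewrite ger0_norm; last first.
  by apply: mulr_ge0; [exact: ltW|have := kln2_ge; lra].
move=> h.
suff contra : ~ kE n K0.+1 <= kE m k.
  have [?|nm|mn] := ltngtP m n; first by left.
    case: contra; apply: le_trans (kE_lt _ n0 nm) _; exact: kE_le.
  right; split=> //; rewrite leqNgt; apply/negP => kK; case: contra.
  by rewrite mn; apply: kE_le.
move=> le; apply: (@kX_not_lnX (2 * C)).
have : kE n K0 * X * 2^-1 <= C%:R * (kE n K0 * ln X).
  apply: le_trans h; apply: ler_pM.
  - by apply: mulr_ge0; apply: ltW.
  - by lra.
  - by move: le; rewrite {1}/kE exprSr mulrA.
  - exact: kln2_ge.
rewrite natrM mulrCA -mulrA ler_pM2l//; lra.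
Qed.

Lemma kF_mul m k f g : kF m k f -> kF m k g -> kF m k (f * g).
Proof.
move=> [Af lf] [Ag lg]; split; first exact: skA_mul.
by rewrite klnM ?skA_gt0//; apply: bigOD.
Qed.

Lemma kF_one m k : kF m k 1.
Proof. by split; [exact: skA_one|rewrite kln1; exact: bigO0]. Qed.

Lemma kF_le m k f g : skA f -> f <= g -> kF m k g -> kF m k f.
Proof.
move=> Af fg [Ag lg]; split=> //; apply: bigO_le lg.
by rewrite ger0_norm ?kln_ge0 ?skA_ge1// kln_le// skA_gt0.
Qed.

Lemma kF_leq m m' k k' : (0 < m)%N -> (m <= m')%N -> (k <= k')%N ->
  kF m k `<=` kF m' k'.
Proof.
move=> m0 mm' kk' h [Ah lh]; split=> //; apply: bigO_trans lh _.
exists 1%N; rewrite mul1r ger0_norm; last by apply: mulr_ge0; apply: ltW.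
rewrite ler_pM2r//; apply: le_trans (kE_leq _ m0 mm') _; exact: kE_le.
Qed.

(** ** Components *)

(** The pair [(1, 0)] is left out because [kE 1 0 = 1] would make every element a component. All
    other powers are components, even when the base is a sum. *)
Inductive kP : set K :=
| kP_one : kP 1
| kP_X : kP X
| kP_mul p q : kP p -> kP q -> kP (p * q)
| kP_pow h c j : (0 < c)%N -> (c, j) != (1%N, 0%N) -> skA h ->
    kP (exp (kE c j * ln h)).

Lemma kP_skA p : kP p -> skA p.
Proof.
elim=> [||{}p q _ ? _ ?|h c j c0 _ Ah].
- exact: skA_one.
- exact: skA_X.
- exact: skA_mul.
- exact: skA_pow.
Qed.

Lemma kP_gt0 p : kP p -> 0 < p. Proof. by move=> /kP_skA/skA_gt0. Qed.

Lemma skA_fsum h : skA h -> fsum kP h.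
Proof.
elim=> [||f g _ If _ Ig|f g _ If _ Ig|f c j c0 Af If].
- exact/fsum1/kP_one.
- exact/fsum1/kP_X.
- exact: fsum_add.
- elim: If => [|p s Pp _ IH]; first by rewrite mul0r; left.
  rewrite mulrDl; apply: fsum_add IH.
  elim: Ig => [|q t Pq _ IH]; first by rewrite mulr0; left.
  by rewrite mulrDr; right=> //; apply: kP_mul.
have [|cj] := eqVneq (c, j) (1%N, 0%N); last exact/fsum1/kP_pow.
by case=> -> ->; rewrite kE1 expr0 mul1r klnK// skA_gt0.
Qed.

Definition kPF m k : set K := kP `&` kF m k.

Lemma kF_fsum m k : kF m k `<=` fsum (kPF m k).
Proof.
move=> h Fh.
have H s : fsum kP s -> s <= h -> fsum (kP `&` [set p | p <= h]) s.
  elim=> [|p {}s Pp Ps IH] psh; first by left.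
  have p0 := kP_gt0 Pp; have s0 : 0 <= s by apply: fsum_ge0 Ps => q /kP_gt0.
  by right; [split=> //=; lra|apply: IH; lra].
apply: fsum_sub (H _ (skA_fsum (proj1 Fh)) (lexx h)) => p [Pp ph]; split=> //; apply: kF_le Fh => //; exact: kP_skA.
Qed.

(** Logarithms of components of lower level, the first summand in [kPF_decomp]. There is no fragment
    of level 0; its place is taken by the powers of [X]. *)
Definition kB n : set K := if n is 0 then [set v | exists i : nat, v = i%:R * ln X]
  else [set v | exists q k, [/\ kP q, kF n k q & v = ln q]].

Lemma kB0 n : kB n 0.
Proof.
case: n => [|n]; first by exists 0%N; rewrite mul0r.
by exists 1, 0%N; rewrite kln1; split=> //; [exact: kP_one|exact: kF_one].
Qed.

Lemma kBD n u v : kB n u -> kB n v -> kB n (u + v).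
Proof.
case: n => [[i ->] [j ->]|n [q [k [Pq Fq ->]]] [q' [k' [Pq' Fq' ->]]]].
  by exists (i + j)%N; rewrite natrD mulrDl.
exists (q * q'), (maxn k k'); split; first exact: kP_mul.
  by apply: kF_mul; [apply: kF_leq Fq|apply: kF_leq Fq'] => //;
    rewrite ?leq_maxl ?leq_maxr.
by rewrite klnM ?kP_gt0.
Qed.

Definition kU n K0 c j : set K :=
  [set v | exists h, [/\ kF (n %/ c) (K0 - j) h & v = kE c j * ln h]].

(** A finite list, so that its sum costs finitely many natural sums. Only divisors [c] of [n] occur,
    because a term outside the base part has level exactly [n]. *)
Definition kUs n K0 : seq (set K) :=
  [seq kU n K0 x.1 x.2 | x <- [seq (c, j) | c <- iota 1 n, j <- iota 0 K0.+1] &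
    (x.1 %| n)%N && (x != (1%N, 0%N))].

Lemma kUsP n K0 U : List.In U (kUs n K0) <-> exists c j,
  [/\ (0 < c <= n)%N, (j <= K0)%N, (c %| n)%N, (c, j) != (1%N, 0%N) &
      U = kU n K0 c j].
Proof.
have E : List.In U (kUs n K0) <-> exists x, x \in
    [seq x <- [seq (c, j) | c <- iota 1 n, j <- iota 0 K0.+1] |
    (x.1 %| n)%N && (x != (1%N, 0%N))] /\ U = kU n K0 x.1 x.2.
  rewrite /kUs; set l0 := (seq.filter _ _); elim: l0 => [|x l IH] /=; first by split=> // -[x []].
  split=> [[<-|/IH[y [yl ->]]]|[y []]].
  - by exists x; rewrite mem_head.
  - by exists y; rewrite in_cons yl orbT.
  - by rewrite in_cons => /orP[/eqP->|yl] UE; [left|right; apply/IH; exists y].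
split=> [/E[[c j] []]|[c [j [c0 jK cn cj UE]]]].
  rewrite mem_filter => /andP[/andP[cn cj] /allpairsPdep[c' [j' [c'I j'I [cE jE]]]]] UE.
  exists c, j; move: c'I j'I; rewrite !mem_iota -cE -jE.
  by rewrite add1n add0n !ltnS => ? /andP[_ ?]; split.
apply/E; exists (c, j); split=> //; rewrite mem_filter cn cj; apply/allpairsP.
by exists (c, j); rewrite !mem_iota add1n add0n !ltnS c0.
Qed.

(** If [h] has size [(m, k)], the power [h^(c^X X^j)] has size [(c m, j + k)]. When [c m <= n] it is
    a component of lower level; when [c m = n+1], the number [c] divides [n+1] and [h] has level
    [(n+1)/c]. *)
Lemma kPF_decomp n K0 p : kPF n.+1 K0 p ->
  sumset (kB n) (sumsets (kUs n.+1 K0)) (ln p).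
Proof.
have U0 U : List.In U (kUs n.+1 K0) -> U 0.
  move=> /kUsP[c [j [_ _ _ _ ->]]]; exists 1; rewrite kln1 mulr0.
  by split=> //; apply: kF_one.
have UD U : List.In U (kUs n.+1 K0) -> forall a b, U a -> U b -> U (a + b).
  move=> /kUsP[c [j [_ _ _ _ ->]]] _ _ [h [Fh ->]] [h' [Fh' ->]].
  exists (h * h'); split; first exact: kF_mul.
  by rewrite klnM ?mulrDr// skA_gt0//; [case: Fh|case: Fh'].
have in0 : sumset (kB n) (sumsets (kUs n.+1 K0)) 0.
  by exists 0, 0; rewrite addr0; split=> //; [exact: kB0|exact: sumsets0].
have inB v : kB n v -> sumset (kB n) (sumsets (kUs n.+1 K0)) v.
  by move=> Bv; exists v, 0; rewrite addr0; split=> //; exact: sumsets0.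
have inU U v : List.In U (kUs n.+1 K0) -> U v ->
    sumset (kB n) (sumsets (kUs n.+1 K0)) v.
  move=> Ul Uv; exists 0, v; rewrite add0r; split=> //; [exact: kB0|].
  exact: sumsets_in Ul Uv.
move=> [Pp]; elim: Pp => [||{}p q Pp Ip Pq Iq|h c j c0 cj Ah] Fp.
- by rewrite kln1.
- apply: inB; case: (n) => [|n']; first by exists 1%N; rewrite mul1r.
  exists X, 0%N; split=> //; [exact: kP_X|split; first exact: skA_X].
  by rewrite -[X in bigO _ X]mul1r; apply: bigO_mulr (ltW klnX_gt0) _; exists 1%N; rewrite normr1 mul1r kE_ge1.
- have p1 := skA_ge1 (kP_skA Pp); have q1 := skA_ge1 (kP_skA Pq).
  have [|u [v [Bu Uv pE]]] := Ip.
    by apply: kF_le Fp; [exact: kP_skA|rewrite ler_peMr//; lra].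
  have [|u' [v' [Bu' Uv' qE]]] := Iq.
    by apply: kF_le Fp; [exact: kP_skA|rewrite ler_peMl//; lra].
  rewrite klnM ?kP_gt0// pE qE; exists (u + u'), (v + v'); split.
  + exact: kBD.
  + exact: sumsetsD.
  + by rewrite addrACA.
have [hE|[m [k [m0 lo hi]]]] := skA_size Ah; first by rewrite hE kln1 mulr0 kexp0 kln1.
have [_ ] := Fp; rewrite kexpK => Fp'.
have l0 : 0 <= ln h by apply: kln_ge0; apply: skA_ge1.
have := @kE_size_le (c * m) (j + k) n.+1 K0; case=> //.
- by rewrite muln_gt0 c0.
- rewrite -kEM// -mulrA; apply: bigO_le Fp'.
  rewrite ger0_norm; first by rewrite ler_pM2l.
  by do 2?[apply: mulr_ge0; first exact: ltW]; have := kln2_ge; lra.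
- move=> cmn; apply: inB; case: n cmn {U0 UD in0 inU Fp Fp'} => [|n].
    by rewrite ltnS leqn0 muln_eq0; case: (c) (m) c0 m0 => [|?] [].
  rewrite ltnS => cmn; exists (exp (kE c j * ln h)), (j + k)%N; split; last by rewrite kexpK.
    exact: kP_pow.
  split; first exact: skA_pow.
  rewrite kexpK; apply: (@bigO_trans _ (kE (c * m) (j + k) * ln X)).
    by rewrite -kEM// -mulrA; apply: bigOM => //; apply: ltW.
  exists 1%N; rewrite mul1r ger0_norm; last by apply: mulr_ge0; apply: ltW.
  by rewrite ler_pM2r//; apply: kE_leq => //; rewrite muln_gt0 c0.
move=> [cmn jkK]; apply: (inU (kU n.+1 K0 c j)).
  apply/kUsP; exists c, j; split=> //.
  - by rewrite c0 -cmn leq_pmulr.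
  - exact: leq_trans (leq_addr _ _) jkK.
  - by rewrite -cmn dvdn_mulr.
exists h; split=> //; apply: (@kF_leq m _ k) => //.
- by rewrite -cmn mulKn.
- by rewrite leq_subRL// (leq_trans (leq_addr _ _) jkK).
Qed.

End ExpField.

(** * Heights of the fragments *)

Section Counting.
Variable K : exp_field.
Implicit Types (a b d f g h p q r s t u v : K) (c j k m n : nat).
Local Notation X := (kX K).
Local Notation exp := (@kexp K).
Local Notation ln := (@kln K).
Local Notation bigO := (@bigO K).
Local Notation skA := (@skA K).
Local Notation skS := (@skS K).
Local Notation kF := (@kF K).
Local Notation kPF := (@kPF K).
Local Notation kB := (@kB K).
Local Notation kU := (@kU K).
Local Notation kUs := (@kUs K).
Local Notation kE := (@kE K).
Local Notation kP := (@kP K).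
Let X_gt0 : 0 < X. Proof. exact: kX_gt0. Qed.
Let X_ge1 : 1 <= X. Proof. exact: kX_ge1. Qed.
Let lnX_gt0 : 0 < ln X. Proof. exact: klnX_gt0. Qed.
Let E_gt0 c j : 0 < kE c j. Proof. exact: kE_gt0. Qed.
Hint Resolve X_gt0 X_ge1 lnX_gt0 E_gt0 : core.

Hypothesis gap : forall p q, skA p -> skA q -> bigO q p \/ bigO p (q * X).

(** The scales at which classes are taken. Passing between elements and logarithms multiplies and
    divides scales by Skolem elements, so quotients are needed; [gap_ratio] extends the gap to them
    by clearing denominators. *)
Definition ratio d := exists f g, [/\ skA f, skA g & d = f / g].

Lemma ratio_gt0 d : ratio d -> 0 < d.
Proof. by move=> [f [g [Af Ag ->]]]; rewrite divr_gt0// skA_gt0. Qed.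

Lemma ratioMA d p : ratio d -> skA p -> ratio (d * p).
Proof.
move=> [f [g [Af Ag ->]]] Ap; exists (f * p), g; split=> //; first exact: skA_mul.
by rewrite mulrAC.
Qed.

Lemma ratio_divA d p : ratio d -> skA p -> ratio (d / p).
Proof.
move=> [f [g [Af Ag ->]]] Ap; exists f, (g * p); split=> //; first exact: skA_mul.
by rewrite invfM mulrA.
Qed.

Lemma gap_ratio r p : ratio r -> skA p -> bigO r p \/ bigO p (r * X).
Proof.
move=> [f [g [Af Ag ->]]] Ap.
have g0 := skA_gt0 Ag; have gn0 := lt0r_neq0 g0.
have gV0 : 0 <= g^-1 by rewrite invr_ge0 ltW.
have [h|h] := gap (skA_mul Ap Ag) Af; [left|right].
  by have := bigO_mulr gV0 h; rewrite mulfK.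
by have := bigO_mulr gV0 h; rewrite mulfK// mulrAC.
Qed.

(** For these scales a window of width O(d X) for logarithms is bounded, so it fixes an element up
    to a bounded factor. Scale [d] for logarithms then corresponds to scale [d p] for elements near
    [p]. *)
Definition sratio d := ratio d /\ bigO 1 (d * X).

Lemma sratio_small d (N : nat) : sratio d -> N%:R * d <= 2^-1.
Proof.
move=> [rd [M]]; have d0 := ratio_gt0 rd; rewrite mulr1 ger0_norm; last first.
  by apply: mulr_ge0; apply: ltW.
move=> dM; have := kX_big K (2 * N * M)%N; rewrite !natrM => XM.
have N0 := ler0n K N; have X0 := @kX_gt0 K.
rewrite -(ler_pM2r X0); nra.
Qed.

Lemma sratio_divE d c j : (0 < c)%N -> sratio d -> sratio (d / kE c j).
Proof.
move=> c0 [rd dX]; split; first by apply: ratio_divA => //; apply: skA_kE.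
have d0 := ratio_gt0 rd; apply: bigO_le dX.
rewrite ger0_norm; last by rewrite !mulr_ge0 ?invr_ge0// ltW.
by rewrite ler_pM2r// ler_pdivrMr// ler_peMr ?kE_ge1// ltW.
Qed.

Lemma kexp_near t : `|t| <= 2^-1 -> `|exp t - 1| <= 2 * `|t|.
Proof.
rewrite ler_norml => /andP[t1 t2]; have h1 := kexp_ge t.
have h2 := kexp_ge (- t); have h3 : exp t * exp (- t) = 1.
  by rewrite -kexpD subrr kexp0.
have h0 := kexp_gt0 t; rewrite ler_norml.
have [t0|t0] := ger0P t; apply/andP; split; nra.
Qed.

Lemma kexpB1_le t : exp t - 1 <= t * exp t.
Proof.
have h2 := kexp_ge (- t); have h3 : exp t * exp (- t) = 1.
  by rewrite -kexpD subrr kexp0.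
have h0 := kexp_gt0 t; nra.
Qed.

Lemma bigO1_kexp t : bigO 1 t -> bigO 1 (exp t).
Proof.
move=> [N]; rewrite mulr1 => tN; exists (4 ^ N)%N; rewrite mulr1.
rewrite ger0_norm ?(ltW (kexp_gt0 _))//; apply: le_trans (kexp_nat_le K N).
by rewrite kexp_le; apply: le_trans (ler_norm _) tN.
Qed.

Lemma bigO1_mull a b d : bigO 1 a -> bigO d b -> bigO d (a * b).
Proof.
move=> [N aN] [M bM]; exists (N * M)%N; rewrite normrM natrM -mulrA.
by apply: ler_pM => //; rewrite -[N%:R]mulr1.
Qed.

(** The elements that are O(r) form one class. For any other [p] in the window the gap gives
    [r X = O(p)], so [p] is comparable with [g] and with a fixed such element [p0]; distances O(r)
    are then logarithmic distances O(r/p0). *)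
Lemma disc_kPF n k :
  (forall d, sratio d -> disc X d (ln @` kPF n k)) ->
  forall r, ratio r -> disc X r (kPF n k).
Proof.
move=> D r rr g; have r0 := ratio_gt0 rr.
have [[p0 [[Pp0 Fp0] p0g gp0 np0]]|nW] := pselect (exists p,
    [/\ kPF n k p, p <= g, bigO (r * X) (g - p) & ~ bigO r p]); last first.
  exists [:: 0] => p Pp pg gp; exists 0; first by rewrite mem_head.
  by rewrite subr0; apply: contrapT => np; apply: nW; exists p.
have Ap0 := kP_skA Pp0; have p00 := skA_gt0 Ap0.
have big p : kPF n k p -> p <= g -> bigO (r * X) (g - p) -> ~ bigO r p ->
    [/\ 0 < p, bigO p (r * X) & bigO p g].
  move=> [Pp _] pg gp np; have Ap := kP_skA Pp; have p_gt0 := skA_gt0 Ap.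
  have [//|rXp] := gap_ratio rr Ap; split=> //.
  rewrite -(subrK p g); apply: bigOD; last exact: bigO_id (ltW _).
  exact: bigO_trans gp rXp.
have [_ rXp0 p0g'] := big _ (conj Pp0 Fp0) p0g gp0 np0.
have g0 : 0 < g by apply: lt_le_trans p0g.
pose d := r / p0.
have sd : sratio d.
  split; first exact: ratio_divA.
  have p0V : 0 <= p0^-1 by rewrite invr_ge0 ltW.
  by have := bigO_mulr p0V rXp0; rewrite divff ?lt0r_neq0// mulrAC.
have d0 := ratio_gt0 (proj1 sd).
have [L LP] := D d sd (ln g); exists (0 :: [seq exp l | l <- L]) => p PFp pg gp.
have [rp|np] := pselect (bigO r p); first by exists 0; rewrite ?mem_head ?subr0.
have [p_gt0 rXp pg'] := big _ PFp pg gp np.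
have p0p : bigO p0 p by apply: bigO_le p0g'; rewrite gtr0_norm.
have pp0 : bigO p p0 by apply: bigO_le pg'; rewrite gtr0_norm.
have pV : 0 <= p^-1 by rewrite invr_ge0 ltW.
have p0V : 0 <= p0^-1 by rewrite invr_ge0 ltW.
have [|||l lL pl] := LP (ln p).
- by exists p.
- by rewrite kln_le.
- apply: (@bigO_le _ _ _ ((g - p) / p)).
    rewrite ger0_norm ?subr_ge0 ?kln_le// -kln_div//.
    apply: le_trans (kln_leB1 _) _; first exact: divr_gt0.
    by rewrite mulrBl divff ?lt0r_neq0.
  apply: (@bigO_trans _ (r * X / p)); first exact: bigO_mulr.
  rewrite /d (_ : r * X / p = (p0 / p) * (r / p0 * X)).
    apply: bigO1_mull; last by apply: bigO_id; rewrite mulr_ge0// ltW.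
    by have := bigO_mulr pV pp0; rewrite divff ?lt0r_neq0.
  by field; rewrite !lt0r_neq0.
exists (exp l); first by rewrite in_cons map_f ?orbT.
have [N pN] := pl; pose t := l - ln p.
have tN : `|t| <= N%:R * d by rewrite /t distrC.
have t2 : `|t| <= 2^-1 by apply: le_trans tN _; apply: sratio_small.
have lE : exp l = p * exp t by rewrite /t -{1}(klnK p_gt0) -kexpD addrC subrK.
apply: (@bigO_le _ _ _ (p * (2 * (N%:R * d)))).
  rewrite lE -[X in X - _]mulr1 -mulrBr normrM (gtr0_norm p_gt0) ler_pM2l//.
  rewrite distrC; apply: le_trans (kexp_near t2) _.
  by rewrite ler_pM2l.
rewrite (_ : _ * _ = (p / p0) * ((2 * N)%:R * r)).
  apply: bigO1_mull.
    by have := bigO_mulr p0V p0p; rewrite divff ?lt0r_neq0.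
  by exists (2 * N)%N; rewrite ger0_norm// mulr_ge0// ltW.
by rewrite natrM /d; field; rewrite lt0r_neq0.
Qed.

(** The passage opposite to [disc_kPF]: logarithms in a window of width O(d X), which is bounded,
    belong to elements comparable with a fixed [s0], and scale [d] becomes scale [d s0]. *)
Lemma disc_ln_kF n k :
  (forall r, ratio r -> disc X r (kF n k)) ->
  forall d, sratio d -> disc X d (ln @` kF n k).
Proof.
move=> D d sd g; have d0 := ratio_gt0 (proj1 sd).
have [[s0 [Fs0 s0g gs0]]|nW] := pselect (exists s,
    [/\ kF n k s, ln s <= g & bigO (d * X) (g - ln s)]); last first.
  by exists [::] => _ [s Fs <-] sg gs; case: nW; exists s.
have As0 : skA s0 by case: Fs0.
have s0_gt0 := skA_gt0 As0.
have [L LP] := D _ (ratioMA (proj1 sd) As0) (exp g).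
exists [seq ln l | l <- L] => _ [s Fs <-] sg gs.
have As : skA s by case: Fs.
have s_gt0 := skA_gt0 As.
have expE s' : 0 < s' -> exp g = s' * exp (g - ln s').
  by move=> s'0; rewrite -{1}(klnK s'0) -kexpD addrC subrK.
have b1 s' : bigO (d * X) (g - ln s') -> bigO 1 (exp (g - ln s')).
  by move=> h; apply: bigO1_kexp; apply: bigO_trans h (proj2 sd).
have s0s : bigO s s0.
  apply: (@bigO_le _ _ _ (exp g)).
    by rewrite gtr0_norm// -[leLHS]klnK// kexp_le.
  by rewrite (expE s)// mulrC; apply: bigO1_mull (b1 _ gs) _; apply/bigO_id/ltW.
have ss0 : bigO s0 s.
  apply: (@bigO_le _ _ _ (exp g)).
    by rewrite gtr0_norm// -[leLHS]klnK// kexp_le.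
  by rewrite (expE s0)// mulrC; apply: bigO1_mull (b1 _ gs0) _; apply/bigO_id/ltW.
have sg' : s <= exp g by rewrite -[leLHS]klnK// kexp_le.
have [|l lL sl] := LP s Fs sg'.
  apply: (@bigO_le _ _ _ (s * ((g - ln s) * exp (g - ln s)))).
    rewrite ger0_norm ?subr_ge0// (expE s)// -[X in _ - X]mulr1 -mulrBr ler_pM2l//.
    exact: kexpB1_le.
  have -> : d * s0 * X = s0 * (d * X) by ring.
  have -> : s * ((g - ln s) * exp (g - ln s)) = exp (g - ln s) * (s * (g - ln s)).
    by ring.
  apply: bigO1_mull; first exact: b1.
  apply: (@bigO_trans _ (s * (d * X))); first by apply: bigOM => //; apply: ltW.
  by apply: bigO_mulr => //; apply: mulr_ge0; apply: ltW.
exists (ln l); first exact: map_f.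
have [N slN] : bigO (s * d) (s - l).
  apply: bigO_trans sl _; rewrite [s * d]mulrC; apply: bigOM => //; exact: ltW.
have := @sratio_small d N sd; rewrite mulrCA in slN; set e := N%:R * d in slN * => e2.
have e0 : 0 <= e by apply: mulr_ge0 => //; apply: ltW.
move: slN; rewrite ler_norml => /andP[sl1 sl2].
have l2 : s <= 2 * l by nra.
have l0 : 0 < l by nra.
exists (2 * N)%N; rewrite natrM -mulrA -/e ler_norml; apply/andP; split.
  have : ln l - ln s <= l / s - 1.
    by rewrite -kln_div//; apply: kln_leB1; apply: divr_gt0.
  have : l / s - 1 <= e.
    by rewrite lerBlDr ler_pdivrMr//; nra.
  by lra.
have : ln s - ln l <= s / l - 1.
  by rewrite -kln_div//; apply: kln_leB1; apply: divr_gt0.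
have : s / l - 1 <= 2 * e.
  by rewrite lerBlDr ler_pdivrMr//; nra.
by lra.
Qed.

Lemma disc_scale d e (U : set K) : 0 < e -> disc X (d / e) U ->
  disc X d [set v | exists2 u, U u & v = e * u].
Proof.
move=> e0 D g; have [L LP] := D (g / e); exists [seq e * l | l <- L].
have eV : 0 <= e^-1 by rewrite invr_ge0 ltW.
have en0 := lt0r_neq0 e0.
move=> _ [u Uu ->] ug gu; have [||l lL ul] := LP u Uu.
- by rewrite ler_pdivlMr// mulrC.
- have := bigO_mulr eV gu; rewrite mulrBl mulrAC.
  by rewrite [e * u]mulrC mulfK.
exists (e * l); first exact: map_f.
have := bigOM (ltW e0) ul; rewrite mulrBr mulrCA divff// mulr1.
by [].
Qed.

Let one_gt0 n : ord_lt (oexp0 (omega_tower n)) (tower_one n).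
Proof. exact: oexp_pow_gt0. Qed.

Lemma ll_scale e d u v : 0 < e -> ll d (e * u) (e * v) -> ll (d / e) u v.
Proof.
move=> e0 uv N; have := uv N; rewrite -mulrBr mulrA ltr_pdivrMr//.
by rewrite [e * _]mulrC.
Qed.

Lemma height_ln (W : ordinal_rep) (a : W) (U : set K) :
  (forall u, U u -> 0 < u) -> height (ll 0) a (ln @` U) <-> height (ll 0) a U.
Proof.
move=> U0; split.
  apply: (@height_transfer _ _ (ll 0) (ll 0) (fun u v => U u /\ v = ln u)).
    move=> u' v' u v [Uu ->] [Uv ->] /ll0 uv; apply/ll0.
    by rewrite kln_lt// U0.
  by move=> u Uu; exists (ln u); split=> //; exists u.
apply: (@height_transfer _ _ (ll 0) (ll 0) (fun v u => U u /\ v = ln u)).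
  move=> u' v' u v [Uu ->] [Uv ->] /ll0 uv; apply/ll0.
  by move: uv; rewrite kln_lt// U0.
by move=> _ [u Uu <-]; exists u.
Qed.

Lemma arch_ll_ln p q : 0 < p -> 0 < q -> arch_ll p q -> ll 1 (ln p) (ln q).
Proof.
move=> p0 q0 pq N; rewrite mulr1 ltrBrDr -kexp_lt kexpD !klnK//.
apply: le_lt_trans (pq (4 ^ N)%N); rewrite ler_pM2r//; exact: kexp_nat_le.
Qed.

Lemma height_arch (W : ordinal_rep) (a : W) (U : set K) :
  (forall u, U u -> 0 < u) -> height (ll 1) a (ln @` U) -> height (@arch_ll K) a U.
Proof.
move=> U0; apply: (@height_transfer _ _ _ _ (fun u v => U u /\ v = ln u)).
  by move=> u' v' u v [Uu ->] [Uv ->]; apply: arch_ll_ln; apply: U0.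
by move=> u Uu; exists (ln u); split=> //; exists u.
Qed.

Lemma kF_gt0 n k h : kF n k h -> 0 < h.
Proof. by move=> [/skA_gt0]. Qed.

(** The index is shifted: [n] stands for level [n.+1]. Heights are exponents, so an element of
    [omega_tower n.+2] stands for an order type below [omega_(n+3)]. The last clause makes the
    second one refinable to classes modulo O(X^-i). *)
Definition fragment_bounds n k :=
  [/\ exists g : omega_tower n.+2, height (ll 0) g (kF n.+1 k),
      exists a : omega_tower n.+1, height (ll 1) a (ln @` kF n.+1 k) &
      forall d, sratio d -> disc X d (ln @` kF n.+1 k)].

Definition base_bounds n :=
  [/\ exists g : omega_tower n.+2, height (ll 0) g (kB n),
      exists a : omega_tower n.+1, height (ll 1) a (kB n) &
      forall d, sratio d -> disc X d (kB n)].

Lemma sratio_Xn i : sratio (X ^- i.+1).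
Proof.
split; first exists 1, (X ^+ i.+1); first by split; [exact: skA_one|exact/skA_exprn/skA_X|rewrite mul1r].
exists 1%N; rewrite mul1r exprS invfM mulrAC mulVf ?lt0r_neq0// mul1r.
rewrite ger0_norm ?invr_ge0 ?exprn_ge0 ?(ltW X_gt0)//.
by rewrite invf_le1 ?exprn_gt0// exprn_ege1.
Qed.

(** One application of [height_disc] for each factor [X], starting from classes modulo O(1). Each
    adds only 1 to the exponent, so the tower level does not change. *)
Lemma height_ln_fine n k i : fragment_bounds n k ->
  exists b : omega_tower n.+1, height (ll (X ^- i)) b (ln @` kF n.+1 k).
Proof.
move=> [_ [a Ha] D]; elim: i => [|i [b Hb]]; first by exists a; rewrite expr0 invr1.
exists (oexp_add (tower_one n) b).
apply: (@height_disc _ X) (one_gt0 n) (D _ (sratio_Xn i)) _ => //.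
- by rewrite invr_ge0 exprn_ge0// ltW.
- exact: ltW.
- by rewrite exprS invfM mulrAC mulVf ?lt0r_neq0// mul1r.
Qed.

Lemma base_bounds0 : base_bounds 0.
Proof.
(* Only finitely many multiples of [ln X] lie below a given one, so height 1 suffices for every
   relation contained in the order. *)
have H (R : K -> K -> Prop) (W : ordinal_rep) (one : omega_exp W) :
    ord_lt (oexp0 W) one -> (forall u v, R u v -> u < v) -> height R one (kB 0).
  move=> one0 Rlt; constructor=> _ [i ->].
  apply: (@below_sub _ _ _ _ _ [set v | exists2 i', (i' < i)%N & v = i'%:R * ln X]).
    move=> _ [[i' ->] /Rlt]; rewrite ltr_pM2r// ltr_nat => i'i.
    by exists i'.
  apply: (below_bigcup (F := fun i' => [set v | v = i'%:R * ln X])) => i' _.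
  apply: below_height one0 _; constructor=> _ ->; apply: Below0 => _ [-> /Rlt].
  by rewrite ltxx.
split; first by exists (tower_one 1); apply: H (one_gt0 1) _ => u v /ll_lt.
  by exists (tower_one 0); apply: H (one_gt0 0) _ => u v /ll_lt.
move=> d [rd dX] g; have [[v0 [Bv0 v0g gv0]]|nW] := pselect (exists v,
    [/\ kB 0 v, v <= g & bigO (d * X) (g - v)]); last first.
  by exists [::] => v Bv vg gv; case: nW; exists v.
(* Two different multiples of [ln X] are never at bounded distance, so the window contains at most
   one. *)
exists [:: v0] => v Bv vg gv; exists v0; first by rewrite mem_head.
have : bigO 1 (v - v0).
  rewrite (_ : v - v0 = (g - v0) - (g - v)); last by ring.
  by apply: bigO_trans dX; apply: bigOB.
case: Bv Bv0 => [i ->] [i0 ->]; rewrite -mulrBl => -[N]; rewrite mulr1 normrM.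
have [->|ii0] := eqVneq i i0; first by rewrite subrr mul0r => _; apply: bigO0.
rewrite (gtr0_norm lnX_gt0) => h; exfalso.
have : 1 <= `|i%:R - i0%:R : K|.
  wlog lt : i i0 ii0 {h} / (i0 < i)%N.
    move=> H'; have [/H'|/H'|/eqP] := ltngtP i0 i.
    - exact.
    - by rewrite distrC eq_sym; apply.
    - by rewrite eq_sym (negbTE ii0).
  by rewrite -natrB 1?ltnW// normr_nat ler1n subn_gt0.
move=> h1; have := klnX_gt K N; rewrite ltNge => /negP; apply.
by apply: le_trans h; rewrite ler_peMl// ltW.
Qed.

(** The union over all [k] costs one level: the heights for the various [k] are capped by the single
    bound [t] of [tower_lift]. Discreteness needs no cap, as elements whose logarithms are at
    bounded distance lie in the same fragment. *)
Lemma base_boundsS n : (forall k, fragment_bounds n k) -> base_bounds n.+1.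
Proof.
move=> FB.
have dn q q' k : kP q' -> kF n.+1 k q -> ln q' <= ln q -> kF n.+1 k q'.
  move=> Pq' Fq qq'; have q0 := kF_gt0 Fq; have q'0 := kP_gt0 Pq'.
  apply: kF_le Fq; first exact: kP_skA.
  by rewrite -kln_le.
have H (R : K -> K -> Prop) m :
    (forall u v, R u v -> u < v) ->
    (forall k, exists g : omega_tower m, height R g (ln @` kF n.+1 k)) ->
    exists g : omega_tower m.+1, height R g (kB n.+1).
  move=> Rlt HF; have [iota [t [mono bd]]] := tower_lift m.
  exists t; constructor=> _ [q [k [Pq Fq ->]]].
  have [g Hg] := HF k; apply: below_sub (below_height (bd g) (height_map mono Hg)).
  move=> _ [[q' [k' [Pq' Fq' ->]]] /Rlt/ltW/(dn _ _ _ Pq' Fq) ?].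
  by exists q'.
split.
- apply: H => [u v /ll_lt//|k]; have [[g Hg] _ _] := FB k.
  by exists g; apply/height_ln => // u /kF_gt0.
- by apply: H => [u v /ll_lt//|k]; have [_ [a Ha] _] := FB k; exists a.
move=> d [rd dX] g; have [[v0 [Bv0 v0g gv0]]|nW] := pselect (exists v,
    [/\ kB n.+1 v, v <= g & bigO (d * X) (g - v)]); last first.
  by exists [::] => v Bv vg gv; case: nW; exists v.
have [q [k [Pq Fq v0E]]] := Bv0.
have [_ _ D] := FB k; have [|L LP] := D d _ g; first by split.
exists L => _ [q' [k' [Pq' Fq' ->]]] vg gv; apply: LP => //; exists q' => //.
split; first exact: kP_skA.
rewrite -(subrK (ln q) (ln q')); apply: bigOD; last by case: Fq.
apply: (@bigO_trans _ 1); last exact: bigO_kE_1.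
rewrite (_ : _ - _ = (g - v0) - (g - ln q')); last by rewrite v0E; ring.
by apply: bigO_trans dX; apply: bigOB.
Qed.

(** Logarithms of components are bounded through [kPF_decomp], and sums through [height_fsum] and
    [disc_fsum]. The delicate bound is the one for [ll 1], which must not leave
    [omega_tower n.+1]. *)
Lemma fragment_step n k : base_bounds n ->
  (forall n', n = n'.+1 -> forall k', fragment_bounds n' k') ->
  (forall k', (k' < k)%N -> fragment_bounds n k') -> fragment_bounds n k.
Proof.
move=> [[gB HgB] [aB HaB] DB] FBn FBk.
have [iota [t [mono bd]]] := tower_lift n.+1.
have UP U : List.In U (kUs n.+1 k) ->
    [/\ exists g : omega_tower n.+2, height (ll 0) g U,
        exists a : omega_tower n.+1, height (ll 1) a U &
        forall d, sratio d -> disc X d U].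
  move=> /kUsP[c [j [/andP[c0 cn] jk cdvd cj UE]]].
  have tr (R R' : K -> K -> Prop) (W : ordinal_rep) (g : W) m i :
      (forall u v, R' (kE c j * u) (kE c j * v) -> R u v) ->
      kF (n.+1 %/ c) (k - j) `<=` kF m i ->
      height R g (ln @` kF m i) -> height R' g U.
    move=> RR sub; rewrite UE.
    apply: (@height_transfer _ _ R R' (fun v u => v = kE c j * u)).
      by move=> _ _ u v -> ->; apply: RR.
    by move=> _ [h [/sub Fh ->]]; exists (ln h); split=> //; exists h.
  have trd m i d : kF (n.+1 %/ c) (k - j) `<=` kF m i ->
      disc X (d / kE c j) (ln @` kF m i) -> disc X d U.
    move=> sub D; apply: disc_sub (disc_scale (E_gt0 c j) D).
    by rewrite UE => _ [h [/sub Fh ->]]; exists (ln h) => //; exists h.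
  have E0 := E_gt0 c j.
  have lt0 u v : ll 0 (kE c j * u) (kE c j * v) -> ll 0 u v.
    by move=> /ll0; rewrite ltr_pM2l// => uv; apply/ll0.
  (* For [c = 1] the level stays and only [k] drops. Here [ll 1] for [X^j ln h] is [ll (X^-j)] for
     [ln h], to which [height_ln_fine] applies. *)
  have [c1|c1] := eqVneq c 1%N.
    have j0 : (0 < j)%N by rewrite lt0n; apply: contraNneq cj => ->; rewrite c1.
    have sub : kF (n.+1 %/ c) (k - j) `<=` kF n.+1 (k - j) by rewrite c1 divn1.
    have kj : (k - j < k)%N by rewrite -subn_gt0 subKn.
    have FB := FBk _ kj; have [[g Hg] _ D] := FB; split.
    - exists g; apply: (tr (ll 0)) sub _ => //.
      by apply/height_ln => // u /kF_gt0.
    - have [b Hb] := height_ln_fine j FB; exists b; apply: (tr (ll (X ^- j))) sub Hb.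
      by move=> u v /(ll_scale E0); rewrite c1 kE1 mul1r.
    - by move=> d sd; apply: trd sub (D _ _); apply: sratio_divE.
  (* For [c >= 2] the level drops, and the full order of the lower fragment already has its height
     in the tower allowed for classes modulo O(1). *)
  have c2 : (1 < c)%N by rewrite ltn_neqAle eq_sym c1.
  case: n gB HgB aB HaB DB FBn FBk cn cdvd UE tr trd iota t mono bd => [|n].
    by move=> ? ? ? ? ? ? ? cn; move: (leq_trans c2 cn).
  move=> gB _ aB _ _ FBn _ cn cdvd UE tr trd iota t mono bd.
  have sub : kF (n.+2 %/ c) (k - j) `<=` kF n.+1 (k - j).
    apply: kF_leq => //; first by rewrite divn_gt0.
    by rewrite -ltnS; apply: ltn_Pdiv.
  have [[g Hg] _ D] := FBn n erefl (k - j)%N.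
  have {}Hg : height (ll 0) g (ln @` kF n.+1 (k - j)).
    by apply/height_ln => // u /kF_gt0.
  split.
  - by exists (iota g); apply: (tr (ll 0)) sub _ => //; apply: height_map mono _ _ Hg.
  - exists g; apply: (tr (ll 0)) sub Hg => // u v /ll_lt.
    by rewrite ltr_pM2l// => uv; apply/ll0.
  - by move=> d sd; apply: trd sub (D _ _); apply: sratio_divE.
have set0_height (R : K -> K -> Prop) (W : ordinal_rep) :
    (forall u v, R u v -> u < v) -> height R (oexp0 W) [set 0].
  by move=> Rlt; constructor=> _ ->; apply: Below0 => v [-> /Rlt]; rewrite ltxx.
have subP : ln @` kPF n.+1 k `<=` sumset (kB n) (sumsets (kUs n.+1 k)).
  by move=> _ [p PFp <-]; apply: kPF_decomp.
have PF0 p : kPF n.+1 k p -> 0 < p by move=> [/kP_gt0].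
have [gP HgP] : exists g : omega_tower n.+2, height (ll 0) g (ln @` kPF n.+1 k).
  have [g Hg] : exists g : omega_tower n.+2, height (ll 0) g (sumsets (kUs n.+1 k)).
    apply: (@sumsets_ind _ (fun U => exists g : omega_tower n.+2, height (ll 0) g U))
      => [|U V [g Hg] [g' Hg']|U /UP[]//].
      by exists (oexp0 _); apply: set0_height => u v /ll_lt.
    by exists (oexp_add g g'); apply: height_sumset.
  by exists (oexp_add gB g); apply: height_sub subP _; apply: height_sumset.
have [aP HaP] : exists a : omega_tower n.+1, height (ll 1) a (ln @` kPF n.+1 k).
  have [g Hg] : exists g : omega_tower n.+1, height (ll 1) g (sumsets (kUs n.+1 k)).
    apply: (@sumsets_ind _ (fun U => exists g : omega_tower n.+1, height (ll 1) g U))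
      => [|U V [g Hg] [g' Hg']|U /UP[]//].
      by exists (oexp0 _); apply: set0_height => u v /ll_lt.
    by exists (oexp_add g g'); apply: height_sumset.
  by exists (oexp_add aB g); apply: height_sub subP _; apply: height_sumset.
have DP d : sratio d -> disc X d (ln @` kPF n.+1 k).
  move=> sd; apply: disc_sub subP _.
  have [[g Hg] D] : (exists g : omega_tower n.+2,
      height (ll 0) g (sumsets (kUs n.+1 k))) /\ disc X d (sumsets (kUs n.+1 k)).
    apply: (@sumsets_ind _ (fun U => (exists g : omega_tower n.+2,
      height (ll 0) g U) /\ disc X d U)).
    - split; last exact: disc_set1.
      by exists (oexp0 _); apply: set0_height => u v /ll_lt.
    - move=> U V [[g Hg] DU] [[g' Hg'] DV]; split.
        by exists (oexp_add g g'); apply: height_sumset.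
      by apply: disc_sumset => //; [exact: height_wo Hg|exact: height_wo Hg'].
    - by move=> U /UP[? _ /(_ _ sd)].
  apply: disc_sumset => //; [exact: height_wo HgB|exact: height_wo Hg|exact: DB].
have [gS HgS] : exists g : omega_tower n.+2, height (ll 0) g (fsum (kPF n.+1 k)).
  (* [height_fsum] expects a bound of the form [omega^v]. Both [v] and [aP] lie in
     [omega_tower n.+1], so the resulting power of [omega] lies in [omega_tower n.+2]. *)
  have [v gv] := tower_bd gP.
  exists (oexp_pow (oexp_add (oexp_add v (tower_one n)) aP)).
  apply: height_fsum => //; last exact: height_arch.
  apply: heightS (proj1 (oexp_bd_lt gv)) _.
  by apply/height_ln.
split.
- by exists gS; apply: height_sub HgS; apply: kF_fsum.
(* A sum differs from its dominant summand by a bounded factor. Modulo O(1) the logarithms of sums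
   are those of components, and the bound [aP] is kept. *)
- exists aP; apply: (height_transfer (S := fun u v => bigO 1 (u - v))) HaP.
    by move=> u' v' u v uu vv; apply: ll_compat.
  move=> _ [s Fs <-]; have s0 := kF_gt0 Fs.
  have [|p [N [PFp ps sN]]] := fsum_dominant PF0 (kF_fsum Fs).
    exact: lt0r_neq0.
  have p0 := PF0 _ PFp.
  exists (ln p); split; first by exists p.
  exists N; rewrite mulr1 ger0_norm ?subr_ge0 ?kln_le// -kln_div//.
  apply: le_trans (kln_leB1 _) _; first exact: divr_gt0.
  have : s / p <= N%:R by rewrite ler_pdivrMr.
  by lra.
- apply: disc_ln_kF => r rr; apply: disc_sub (@kF_fsum _ _ _) _.
  apply: disc_fsum => //; first exact: ratio_gt0.
  + by move=> p [Pp _]; apply: gap_ratio => //; apply: kP_skA.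
  + exact: height_wo HgS.
  + exact: disc_kPF.
Qed.

Lemma fragment_boundsP n k : fragment_bounds n k.
Proof.
elim: n k => [|n IHn] k.
  elim/ltn_ind: k => k IHk; apply: fragment_step IHk => //.
  exact: base_bounds0.
elim/ltn_ind: k => k IHk; apply: fragment_step IHk.
  exact: base_boundsS.
by move=> n' [<-].
Qed.

Definition skS_below n : set K :=
  [set s | skS s /\ ln s < exp (X * ln n.+1%:R) * ln 2].

(** The lower size bound [m^X X^k ln 2 <= ln s] is incompatible with [ln s < (n+1)^X ln 2] as soon
    as [m > n]. *)
Lemma skS_below_kF n s : (0 < n)%N -> skS_below n s -> exists k, kF n k s.
Proof.
move=> n0 [Ss sn]; have E1 := kexp_gt0 (X * ln n.+1%:R).
have As : skA s.
  apply: (skS_skA Ss (N := n.+1)) => //; apply: lt_le_trans sn _.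
  by rewrite ler_piMr ?kln2_le1// ltW.
have [->|[m [k [m0 lo hi]]]] := skA_size As; first by exists 0%N; apply: kF_one.
exists k; apply: (@kF_leq _ m n k k) => //.
rewrite leqNgt; apply/negP => nm.
have : kE m k * ln 2 < kE n.+1 0 * ln 2.
  by apply: le_lt_trans lo _; rewrite /kE expr0 mulr1.
rewrite ltr_pM2r; last by have := kln2_ge K; lra.
apply/negP; rewrite -leNgt; apply: le_trans (kE_leq K 0 _ nm) _ => //.
exact: kE_le.
Qed.

(** Everything below [t] lies in the fragment of [t], whose height is therefore a local bound;
    [locally_height_embeds] adds the last exponential. *)
Theorem skS_below_embeds n : (0 < n)%N ->
  (exists e : K -> omega_tower n.+2, forall s t, skS_below n s -> skS_below n t ->
    s < t -> ord_lt (e s) (e t)) /\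
  (exists e : K -> omega_tower n.+1, forall s t, skS_below n s -> skS_below n t ->
    arch_ll s t -> ord_lt (e s) (e t)).
Proof.
case: n => [//|n] n0.
have dn s t k : skS_below n.+1 s -> kF n.+1 k t -> s <= t -> kF n.+1 k s.
  move=> Ss Ft st; apply: kF_le st Ft.
  by have [k' []] := skS_below_kF n0 Ss.
split.
  have [|e eP] := @locally_height_embeds _ (@ll K 0) (omega_tower n.+2)
      (@ll_trans K 0) (skS_below n.+1).
    move=> t St; have [k Ft] := skS_below_kF n0 St.
    have [[g Hg] _ _] := fragment_boundsP n k; have [g' gg'] := tower_nomax g.
    exists g'; apply: below_sub (below_height gg' Hg) => s [Ss /ll_lt/ltW st].
    exact: dn st.
  by exists e => s t Ss St st; apply: eP => //; apply/ll0.
apply: locally_height_embeds.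
  by move=> v u w uv /(_ 1%N); rewrite mul1r => vw N; apply: lt_trans (uv N) vw.
move=> t St; have [k Ft] := skS_below_kF n0 St.
have [_ [g Hg] _] := fragment_boundsP n k; have [g' gg'] := tower_nomax g.
have Ha : height (@arch_ll K) g (kF n.+1 k).
  by apply: height_arch Hg => u /kF_gt0.
exists g'; apply: below_sub (below_height gg' Ha) => s [Ss /(_ 1%N)].
by rewrite mul1r => /ltW st; apply: dn st.
Qed.

End Counting.

(** * Asymptotic expansions of logarithms *)

Section Gap.
Variables (R : realType) (K : exp_field) (cst : {rmorphism R -> K}).
Implicit Types (a b d e f g h t u v w y z : K) (q r s : R).
Local Notation X := (kX K).
Local Notation exp := (@kexp K).
Local Notation ln := (@kln K).
Local Notation bigO := (@bigO K).
Local Notation skA := (@skA K).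
Local Notation kE := (@kE K).

Hypothesis cst_le : {mono cst : x y / x <= y}.
Hypothesis cst_exp : forall r, exp (cst r) = cst (expR r).

(** Stands for the values at [1/X] of functions analytic at [0+]. [An_div] splits off the constant
    term of the expansion in [1/X], and [An_nz] the leading term. *)
Variable An : set K.
Hypothesis An_cst : forall r, An (cst r).
Hypothesis An_XV : An X^-1.
Hypothesis An_add : forall a b, An a -> An b -> An (a + b).
Hypothesis An_mul : forall a b, An a -> An b -> An (a * b).
Hypothesis An_exp : forall a, An a -> An (exp a).
Hypothesis An_ln : forall a, An a -> 1 <= a -> An (ln a).
Hypothesis An_fin : forall a, An a -> bigO 1 a.
Hypothesis An_div : forall a, An a -> exists r a', An a' /\ a = cst r + X^-1 * a'.
Hypothesis An_nz : forall a, An a -> a = 0 \/ exists (k : nat) r a',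
  [/\ r != 0, An a' & a = X ^- k * (cst r + X^-1 * a')].

Definition taylor (phi : K -> K) := forall N : nat, exists (c : nat -> R) (C : nat),
  forall e, `|e| <= 2^-1 ->
    `|phi e - \sum_(i < N) cst (c i) * e ^+ i| <= C%:R * `|e| ^+ N.
Hypothesis taylor_exp : taylor exp.
Hypothesis taylor_ln : taylor (fun e => ln (1 + e)).

Let X_gt0 : 0 < X. Proof. exact: kX_gt0. Qed.
Let X_ge0 : 0 <= X. Proof. exact/ltW/kX_gt0. Qed.
Let X_neq0 : X != 0. Proof. exact: lt0r_neq0. Qed.
Let X_ge1 : 1 <= X. Proof. exact: kX_ge1. Qed.
Let lnX_gt0 : 0 < ln X. Proof. exact: klnX_gt0. Qed.
Let exp_gt0 a : 0 < exp a. Proof. exact: kexp_gt0. Qed.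
Let exp_ge0 a : 0 <= exp a. Proof. exact/ltW/kexp_gt0. Qed.
Hint Resolve X_gt0 X_ge0 X_neq0 X_ge1 lnX_gt0 exp_gt0 exp_ge0 : core.

Lemma cst_lt : {mono cst : x y / x < y}.
Proof. by move=> x y; rewrite !ltNge cst_le. Qed.

Lemma cst_norm r : cst `|r| = `|cst r|.
Proof.
have [r0|r0] := ger0P r; first by rewrite ger0_norm// -(rmorph0 cst) cst_le.
by rewrite rmorphN ltr0_norm// -(rmorph0 cst) cst_lt.
Qed.

Lemma cst_ln (r : R) : 0 < r -> ln (cst r) = cst (exp.ln r).
Proof. by move=> r0; rewrite -[RHS]kexpK cst_exp lnK. Qed.

Lemma cst_bound (r : R) : exists N : nat, `|cst r| <= N%:R.
Proof.
have [N rN] : exists N : nat, `|r| <= N%:R.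
  by exists (Num.bound `|r|); apply: ltW; apply: archi_boundP.
exists N; move: rN; rewrite !ler_norml -!cst_le rmorphN !rmorph_nat //.
Qed.

Lemma cst_lower (r : R) : 0 < r -> exists N : nat, 1 <= N%:R * cst r.
Proof.
move=> r0; have [N rN] : exists N : nat, r^-1 <= N%:R.
  by exists (Num.bound r^-1); apply: ltW; apply: archi_boundP; rewrite ?invr_ge0 ltW.
exists N; rewrite -(rmorph_nat cst) -rmorphM -(rmorph1 cst) cst_le.
by rewrite -ler_pdivrMr// div1r.
Qed.

Lemma cstX_lnX (r : R) (N : nat) : 0 < r -> N%:R * ln X <= cst r * X.
Proof.
move=> /cst_lower[M h]; have := klnX_small K (M * N)%N; rewrite natrM => h2.
have M0 : 0 < M%:R :> K.
  by rewrite lt0r ler0n andbT; apply: contraTneq h => ->; rewrite mul0r ler10.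
rewrite -(ler_pM2l M0); apply: le_trans (_ : X <= _); first by rewrite mulrA.
by rewrite mulrA ler_peMl.
Qed.

Lemma expX_big (r : R) (N : nat) : 0 < r -> X ^+ N <= exp (cst r * X).
Proof.
by move=> r0; rewrite -[leLHS]klnK ?exprn_gt0// kexp_le kln_exprn// cstX_lnX.
Qed.

Lemma X_le_expX : X <= exp X.
Proof. by apply: le_trans (kexp_ge _); rewrite lerDr. Qed.

Lemma nat_le_expX (N : nat) : N%:R <= exp X.
Proof. exact: le_trans (kX_big K N) X_le_expX. Qed.

(** ** Laurent elements *)

Definition La w := exists (k : nat) a, An a /\ w = X ^+ k * a.

Lemma An_XVn k : An (X ^- k).
Proof.
rewrite -exprVn; elim: k => [|k IH]; last by rewrite exprS; apply: An_mul.
by rewrite expr0 -(rmorph1 cst).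
Qed.

Lemma La_An a : An a -> La a.
Proof. by move=> Aa; exists 0%N, a; rewrite mul1r. Qed.

Lemma La_cst (r : R) : La (cst r). Proof. exact: La_An. Qed.

Lemma La_X : La X.
Proof. by exists 1%N, 1; rewrite expr1 mulr1 -(rmorph1 cst). Qed.

Lemma La_mul w w' : La w -> La w' -> La (w * w').
Proof.
move=> [k [a [Aa ->]]] [k' [a' [Aa' ->]]]; exists (k + k')%N, (a * a').
by split; [exact: An_mul|rewrite exprD; ring].
Qed.

Lemma La_add w w' : La w -> La w' -> La (w + w').
Proof.
move=> [k [a [Aa ->]]] [k' [a' [Aa' ->]]].
exists (k + k')%N, (X ^- k' * a + X ^- k * a'); split.
  by apply: An_add; apply: An_mul => //; apply: An_XVn.
by rewrite exprD; field; rewrite !expf_neq0.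
Qed.

Lemma La_exprz (n : int) : La (X ^ n).
Proof.
case: n => n; last by apply: La_An; rewrite NegzE -exprnN; apply: An_XVn.
by rewrite -exprnP; elim: n => [|n IH]; [rewrite expr0 -(rmorph1 cst); exact: La_cst|rewrite exprS; apply: La_mul => //; exact: La_X].
Qed.

Lemma inf_small a (N : nat) : An a -> N%:R * `|X^-1 * a| <= 1.
Proof.
move=> /An_fin[M]; rewrite mulr1 => aM.
rewrite normrM gtr0_norm ?invr_gt0// mulrCA mulrC ler_pdivrMr// mul1r.
apply: (le_trans _ (kX_big K (N * M)%N)).
by rewrite natrM; apply: ler_wpM2l.
Qed.

Lemma La_lead w : La w -> w = 0 \/ exists (e : int) (C : nat),
  X ^ e <= C%:R * `|w| /\ `|w| <= C%:R * X ^ e.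
Proof.
move=> [k [a [/An_nz[->|[l [r [a' [r0 Aa' ->]]]]] ->]]]; first by left; rewrite mulr0.
right; have rn0 : 0 < `|r| by rewrite normr_gt0.
have [N1 lo] := cst_lower rn0; have [N2 hi] := cst_bound r.
rewrite cst_norm in lo.
pose y := cst r + X^-1 * a'.
have wE : X ^+ k * (X ^- l * y) = X ^ (k%:Z - l%:Z) * y.
  by rewrite mulrA expfzDr// -exprnP -exprnN.
have Xe : 0 < X ^ (k%:Z - l%:Z) by apply: exprz_gt0.
have h1 := @inf_small a' (2 * N1) Aa'; have h2 := @inf_small a' 1 Aa'.
rewrite natrM in h1.
have y1 : 1 <= (2 * N1)%:R * `|y|.
  rewrite natrM; have : `|cst r| - `|X^-1 * a'| <= `|y|.
    exact: lerB_normD.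
  have := ler0n K N1; nra.
have y2 : `|y| <= (N2 + 1)%:R.
  by apply: le_trans (ler_normD _ _) _; rewrite natrD; lra.
exists (k%:Z - l%:Z), (2 * N1 + (N2 + 1))%N.
rewrite -/y wE normrM (gtr0_norm Xe) natrD; split.
  rewrite mulrCA -[leLHS]mulr1 ler_pM2l// mulrDl; apply: le_trans y1 _.
  by rewrite lerDl mulr_ge0.
rewrite mulrC ler_pM2r//; apply: le_trans y2 _.
by rewrite lerDr.
Qed.

Lemma Xz_le (e e' : int) : e <= e' -> X ^ e <= X ^ e'.
Proof. by move=> ee'; apply: ler_weXz2l. Qed.

Lemma XzS (e e' : int) : e < e' -> X ^ e * X <= X ^ e'.
Proof. by move=> ee'; rewrite -{2}(expr1z X) -expfzDr//; apply: Xz_le; rewrite lezD1. Qed.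

Lemma La_upper w : La w -> exists M : nat, `|w| <= X ^+ M.
Proof.
move=> [k [a [/An_fin[N aN] ->]]]; exists k.+1.
rewrite normrM normrX (gtr0_norm X_gt0) exprSr ler_pM2l ?exprn_gt0//.
by apply: le_trans (kX_big K N); rewrite -[leRHS]mulr1.
Qed.

(* [ln X] is not a quotient of Laurent elements, so no cancellation occurs. *)
Lemma La_lnX_lower z w : La z -> La w -> z != 0 -> exists (e : int) (C : nat),
  X ^ e <= C%:R * `|z * ln X + w| /\ (`|z| <= C%:R * X ^ e) /\
  (X ^ e * ln X <= C%:R * `|z * ln X + w| \/ `|z| * X <= C%:R * X ^ e).
Proof.
move=> /La_lead[->|[e [C [zlo zhi]]]] Lw; first by rewrite eqxx.
move=> _; set b := _ + w.
have C0 : 0 < C%:R :> K.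
  rewrite lt0r ler0n andbT; apply: contraTneq zlo => ->; rewrite mul0r.
  by rewrite -ltNge exprz_gt0.
have Xe : 0 < X ^ e by apply: exprz_gt0.
have absz : `|z * ln X| = `|z| * ln X by rewrite normrM (gtr0_norm lnX_gt0).
have bb1 : `|z| * ln X <= `|b| + `|w|.
  by have := ler_normB b w; rewrite (_ : b - w = z * ln X) ?absz// /b addrK.
have bb2 : `|w| <= `|b| + `|z| * ln X.
  have := ler_normB b (z * ln X); rewrite absz (_ : b - z * ln X = w)//.
  by rewrite /b addrAC subrr add0r.
have ln1 := klnX_gt K 1.
have zl : X ^ e * ln X <= C%:R * (`|z| * ln X).
  by rewrite mulrA ler_pM2r.
case: (La_lead Lw) => [w0|[e' [C' [wlo whi]]]].
  have bE : `|b| = `|z| * ln X by rewrite /b w0 addr0.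
  exists e, C; rewrite bE; split; last by split=> //; left.
  by apply: le_trans zl; rewrite ler_peMr ?ltW.
have C'0 : 0 < C'%:R :> K.
  rewrite lt0r ler0n andbT; apply: contraTneq wlo => ->; rewrite mul0r.
  by rewrite -ltNge exprz_gt0.
have Xe' : 0 < X ^ e' by apply: exprz_gt0.
(* If the order of [w] does not exceed that of [z], the infinite factor [ln X] makes [z ln X]
   dominate. Otherwise [w] exceeds [z] by a factor [X], which beats [ln X]. *)
have [e'e|ee'] := leP e' e.
  have lnb := klnX_gt K (2 * C * C' + 1)%N; rewrite !natrD !natrM in lnb.
  have wX : `|w| <= C'%:R * X ^ e.
    by apply: le_trans whi _; rewrite ler_pM2l//; apply: Xz_le.
  have key : X ^ e * ln X <= (2 * C)%:R * `|b|.
    rewrite natrM.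
    have : X ^ e * ln X <= C%:R * `|b| + C%:R * (C'%:R * X ^ e) by nra.
    have : 2 * C%:R * C'%:R * X ^ e <= ln X * X ^ e by rewrite ler_pM2r//; lra.
    nra.
  exists e, (2 * C)%N; split; first by apply: le_trans key; rewrite ler_peMr ?ltW.
  split; last by left.
  by apply: le_trans zhi _; rewrite ler_pM2r// ler_nat leq_pmull.
have lnb := klnX_small K (2 * C * C' + 1)%N; rewrite !natrD !natrM in lnb.
have XX := XzS ee'.
have zX : `|z| * X <= C%:R * X ^ e'.
  apply: le_trans (_ : C%:R * X ^ e * X <= _); first by rewrite ler_pM2r.
  by rewrite -mulrA ler_pM2l.
have zlX : 2 * C'%:R * (`|z| * ln X) <= X ^ e'.
  rewrite -(ler_pM2r X_gt0) -(ler_pM2l C0).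
  have : C%:R * (2 * C'%:R * (`|z| * ln X) * X) <= C%:R * (2 * C'%:R * (C%:R * X ^ e') * ln X).
    rewrite ler_pM2l// [leLHS](_ : _ = 2 * C'%:R * ln X * (`|z| * X)); last by ring.
    rewrite [leRHS](_ : _ = 2 * C'%:R * ln X * (C%:R * X ^ e')); last by ring.
    by rewrite ler_pM2l// !mulr_gt0.
  move=> h; apply: le_trans h _.
  rewrite [leLHS](_ : _ = C%:R * X ^ e' * (2 * C%:R * C'%:R * ln X)); last by ring.
  rewrite [leRHS](_ : _ = C%:R * X ^ e' * X); last by ring.
  rewrite ler_pM2l ?mulr_gt0//; lra.
have key : X ^ e' <= (2 * C')%:R * `|b| by rewrite natrM; nra.
exists e', (2 * C' + C)%N; rewrite natrD !mulrDl; split.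
  by apply: le_trans key _; rewrite lerDl mulr_ge0.
have h3 : 0 <= (2 * C')%:R * X ^ e' by rewrite mulr_ge0// ltW.
have zz : `|z| <= `|z| * X by rewrite ler_peMr.
by split; [lra|right; lra].
Qed.

Lemma bigO_X_lnX z w : La z -> La w -> bigO X (z * ln X + w) -> bigO 1 z.
Proof.
move=> Lz Lw [N bN]; have [->|z0] := eqVneq z 0; first exact: bigO0.
have [e [C [lo [hi alt]]]] := La_lnX_lower Lz Lw z0.
have e_le (e1 : int) : 0 < e1 -> X <= X ^ e1.
  by move=> e10; rewrite -{1}(expr1z X); apply: Xz_le; rewrite -gtz0_ge1.
case: alt => [h|h].
  have [e0|e0] := leP e 0.
    exists C; apply: le_trans hi _; rewrite ler_wpM2l//.
    by rewrite -(expr0z X); apply: Xz_le.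
  exfalso; have := klnX_gt K (C * N)%N; rewrite natrM ltNge => /negP; apply.
  rewrite -(ler_pM2l X_gt0); apply: (@le_trans _ _ (X ^ e * ln X)).
    by rewrite ler_pM2r// e_le.
  apply: le_trans h _; rewrite [leRHS](_ : _ = C%:R * (N%:R * X)); last by ring.
  by rewrite ler_wpM2l.
have [e1|e1] := leP e 1.
  exists C; rewrite mulr1 -(ler_pM2r X_gt0); apply: le_trans h _.
  by rewrite ler_wpM2l// -{2}(expr1z X); apply: Xz_le.
exfalso; have := kX_gt K (C * N)%N; rewrite natrM ltNge => /negP; apply.
rewrite -(ler_pM2r X_gt0); apply: (@le_trans _ _ (X ^ e)).
  by rewrite -{1}(expr1z X); apply: XzS.
by apply: le_trans lo _; rewrite -mulrA ler_wpM2l.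
Qed.

Lemma La_bigO_X w : La w -> bigO X w -> exists r s a,
  An a /\ w = cst r * X + cst s + X^-1 * a.
Proof.
move=> [k [a [Aa ->]]]; elim: k a Aa => [|k IH] a Aa wO.
  have [s [a' [Aa' ->]]] := An_div Aa; exists 0, s, a'.
  by rewrite rmorph0 mul0r add0r mul1r.
have [r [a' [Aa' aE]]] := An_div Aa.
case: k IH wO => [|k] IH wO.
  have [s [a2 [Aa2 a'E]]] := An_div Aa'; exists r, s, a2; split=> //.
  by rewrite aE a'E expr1; field.
have [r0|r0] := eqVneq r 0.
  have E : X ^+ k.+2 * a = X ^+ k.+1 * a'.
    by rewrite aE r0 rmorph0 add0r exprSr -mulrA mulVKf.
  by rewrite E in wO *; exact: IH.
exfalso; have [N wN] := wO; have rn0 : 0 < `|r| by rewrite normr_gt0.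
have [M lo] := cst_lower rn0.
rewrite cst_norm in lo.
have h1 := @inf_small a' (2 * M) Aa'; rewrite natrM in h1.
have M0 := ler0n K M.
have : `|cst r| - `|X^-1 * a'| <= `|a| by rewrite aE; exact: lerB_normD.
move=> h2; have h3 : 1 <= 2 * M%:R * `|a| by nra.
move: wN; rewrite normrM normrX (gtr0_norm X_gt0) !exprS.
have XM := kX_gt K (2 * M * N)%N; rewrite !natrM in XM.
have Xk : 1 <= X ^+ k by apply: exprn_ege1.
have a0 := normr_ge0 a; have N0 := ler0n K N.
rewrite [leLHS](_ : _ = X * (X ^+ k * (X * `|a|))); last by ring.
rewrite [leRHS]mulrC ler_pM2l// => h4.
have h5 : X * `|a| <= N%:R by apply: le_trans h4; rewrite ler_peMl// mulr_ge0.
have h6 : X * (2 * M%:R * `|a|) <= 2 * M%:R * N%:R.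
  rewrite [leLHS](_ : _ = 2 * M%:R * (X * `|a|)); last by ring.
  by rewrite ler_wpM2l// mulr_ge0.
have : X <= X * (2 * M%:R * `|a|) by rewrite ler_peMr.
lra.
Qed.

(** ** Sums of exponentials with Laurent coefficients *)

Definition Rt q := exp (cst q * X).

Lemma Rt_gt0 q : 0 < Rt q. Proof. exact: kexp_gt0. Qed.
Hint Resolve Rt_gt0 : core.

Lemma RtD q q' : Rt (q + q') = Rt q * Rt q'.
Proof. by rewrite /Rt rmorphD mulrDl kexpD. Qed.

Lemma Rt0 : Rt 0 = 1.
Proof. by rewrite /Rt rmorph0 mul0r kexp0. Qed.

(** Polynomials in [X] with integer coefficients, in Horner form. By [Zp_cases] a bounded one is an
    integer [n], and then [exp (n ln X) = X^n] is again a Laurent element. *)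
Inductive Zp : set K :=
| Zp0 : Zp 0
| ZpS z (n : int) : Zp z -> Zp (X * z + n%:~R).

Lemma Zp_int (n : int) : Zp n%:~R.
Proof. by rewrite -[_%:~R]add0r -(mulr0 X); apply/ZpS/Zp0. Qed.

Lemma Zp_add z z' : Zp z -> Zp z' -> Zp (z + z').
Proof.
move=> Zz; elim: Zz z' => [|{}z n Zz IH] z' Zz'; first by rewrite add0r.
case: Zz' => [|{}z' n' Zz']; first by rewrite addr0; apply: ZpS.
by rewrite addrACA -mulrDr -intrD; apply/ZpS/IH.
Qed.

Lemma Zp_opp z : Zp z -> Zp (- z).
Proof.
elim=> [|{}z n Zz IH]; first by rewrite oppr0; apply: Zp0.
by rewrite opprD -mulrN -intrN; apply: ZpS.
Qed.

Lemma Zp_mulX k z : Zp z -> Zp (X ^+ k * z).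
Proof.
move=> Zz; elim: k => [|k IH]; first by rewrite mul1r.
by rewrite exprS -mulrA -[_ * _]addr0; apply: (@ZpS _ 0).
Qed.

Lemma Zp_La z : Zp z -> La z.
Proof.
elim=> [|{}z n _ IH]; first by rewrite -(rmorph0 cst); apply: La_cst.
apply: La_add; first by apply: La_mul IH; apply: La_X.
by rewrite -(rmorph_int cst); apply: La_cst.
Qed.

Lemma Zp_cases z : Zp z -> (exists n : int, z = n%:~R) \/ X <= 2 * `|z|.
Proof.
elim=> [|{}z n _ [[m ->]|IH]]; first by left; exists 0.
  have [->|m0] := eqVneq m 0; first by left; exists n; rewrite mulr0 add0r.
  right; have h1 : `|X * m%:~R| - `|n%:~R| <= `|X * m%:~R + n%:~R| :> K.
    exact: lerB_normD.
  have h2 : X <= `|X * m%:~R|.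
    rewrite normrM (gtr0_norm X_gt0) ler_peMr// -intr_norm.
    by rewrite (_ : 1 = 1%:~R)// ler_int -gtz0_ge1 normr_gt0.
  have h3 := kX_big K (2 * `|n|)%N; rewrite natrM in h3.
  have h4 : `|n%:~R| = `|n|%N%:R :> K by rewrite -intr_norm -abszE.
  lra.
right; have h1 : `|X * z| - `|n%:~R| <= `|X * z + n%:~R| by exact: lerB_normD.
have h2 : X * 2 <= `|X * z|.
  rewrite normrM (gtr0_norm X_gt0) ler_pM2l//.
  by have := kX_big K 4; lra.
have h3 := kX_big K `|n|%N.
have h4 : `|n%:~R| = `|n|%N%:R :> K by rewrite -intr_norm -abszE.
apply: le_trans (_ : `|X * z + n%:~R| <= _); last by rewrite ler_peMl// ler1n.
apply: le_trans h1; rewrite h4 lerBrDr; apply: le_trans h2.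
by rewrite mulr_natr mulr2n lerD2l.
Qed.

Definition vals (l : seq (R * K)) : K := \sum_(i <- l) Rt i.1 * i.2.

Definition coef (l : seq (R * K)) q : K := \sum_(i <- l | i.1 == q) i.2.

Lemma vals_coef (s : seq R) (l : seq (R * K)) : uniq s ->
  {subset [seq i.1 | i <- l] <= s} -> vals l = \sum_(q <- s) Rt q * coef l q.
Proof.
move=> us; elim: l => [|i l IH] ls.
  by rewrite /vals big_nil big1// => q _; rewrite /coef big_nil mulr0.
have is_ : i.1 \in s by apply: ls; rewrite mem_head.
rewrite /vals big_cons -/(vals l) IH; last first.
  by move=> q ql; apply: ls; rewrite in_cons ql orbT.
rewrite (bigD1_seq i.1)//= [in RHS](bigD1_seq i.1)//= addrA; congr (_ + _).
  by rewrite -mulrDr; congr (_ * _); rewrite /coef big_cons eqxx.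
apply: eq_bigr => q qi; congr (_ * _).
by rewrite /coef big_cons eq_sym (negbTE qi).
Qed.

Lemma coef_ind (Q : set K) (l : seq (R * K)) q : Q 0 ->
  (forall a b, Q a -> Q b -> Q (a + b)) -> (forall i, i \in l -> Q i.2) ->
  Q (coef l q).
Proof.
move=> Q0 QD Ql; rewrite /coef; elim: l Ql => [|i l IH] Ql; first by rewrite big_nil.
have {}IH : Q (\sum_(j <- l | j.1 == q) j.2).
  by apply: IH => j jl; apply: Ql; rewrite in_cons jl orbT.
by rewrite big_cons; case: ifP => // _; apply: QD => //; apply: Ql; rewrite mem_head.
Qed.

Definition T0 v := exists l : seq (R * K), (forall i, i \in l -> La i.2) /\ v = vals l.

(** The coefficients of [ln X] in expansions. Rates are nonnegative because they are sums of
    logarithms of integers [c >= 1]; without decaying terms, [u] reduces exactly to an integer in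
    [normal_form]. *)
Definition U0 u := exists l : seq (R * K),
  (forall i, i \in l -> Zp i.2 /\ 0 <= i.1) /\ u = vals l.

Lemma vals_cat l l' : vals (l ++ l') = vals l + vals l'.
Proof. by rewrite /vals big_cat. Qed.

Lemma vals_map l q w (F : K -> K) : (forall v, F v = w * v) ->
  vals [seq (q + i.1, F i.2) | i <- l] = Rt q * w * vals l.
Proof.
move=> FE; rewrite /vals big_map mulr_sumr; apply: eq_bigr => i _ /=.
by rewrite RtD FE; ring.
Qed.

Lemma T0_add v v' : T0 v -> T0 v' -> T0 (v + v').
Proof.
move=> [l [lP ->]] [l' [lP' ->]]; exists (l ++ l'); rewrite vals_cat; split=> // i.
by rewrite mem_cat => /orP[/lP|/lP'].
Qed.

Lemma T0_0 : T0 0.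
Proof. by exists [::]; rewrite /vals big_nil. Qed.

Lemma T0_scale q w v : La w -> T0 v -> T0 (Rt q * w * v).
Proof.
move=> Lw [l [lP ->]]; exists [seq (q + i.1, w * i.2) | i <- l].
by split; [move=> _ /mapP[i /lP Li ->] /=; apply: La_mul|rewrite (vals_map _ _ (w := w))].
Qed.

Lemma T0_Rt q w : La w -> T0 (Rt q * w).
Proof.
move=> Lw; exists [:: (q, w)]; split; first by move=> i; rewrite inE => /eqP ->.
by rewrite /vals big_seq1.
Qed.

Lemma T0_La w : La w -> T0 w.
Proof. by move=> /(T0_Rt 0); rewrite Rt0 mul1r. Qed.

Lemma T0_mul v v' : T0 v -> T0 v' -> T0 (v * v').
Proof.
move=> [l [lP ->]] Tv'; elim: l lP => [|i l IH] lP.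
  by rewrite /vals big_nil mul0r; apply: T0_0.
rewrite /vals big_cons mulrDl; apply: T0_add.
  by apply: T0_scale Tv'; apply: lP; rewrite mem_head.
by apply: IH => j jl; apply: lP; rewrite in_cons jl orbT.
Qed.

Lemma U0_add u u' : U0 u -> U0 u' -> U0 (u + u').
Proof.
move=> [l [lP ->]] [l' [lP' ->]]; exists (l ++ l'); rewrite vals_cat; split=> // i.
by rewrite mem_cat => /orP[/lP|/lP'].
Qed.

Lemma U0_opp u : U0 u -> U0 (- u).
Proof.
move=> [l [lP ->]]; exists [seq (0 + i.1, - i.2) | i <- l]; split.
  by move=> _ /mapP[i /lP[Zi i0] ->] /=; rewrite add0r; split=> //; apply: Zp_opp.
by rewrite (vals_map _ _ (w := -1)) ?Rt0 ?mul1r ?mulN1r// => v; rewrite mulN1r.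
Qed.

Lemma kE_Rt c j : (0 < c)%N -> kE c j = Rt (exp.ln c%:R) * X ^+ j.
Proof.
by move=> c0; rewrite /kE /Rt -cst_ln ?ltr0n// rmorph_nat mulrC [X * _]mulrC mulrC.
Qed.

Lemma U0_scale c j u : (0 < c)%N -> U0 u -> U0 (kE c j * u).
Proof.
move=> c0 [l [lP ->]]; exists [seq (exp.ln c%:R + i.1, X ^+ j * i.2) | i <- l].
split; last by rewrite (vals_map _ _ (w := X ^+ j)) ?kE_Rt.
move=> _ /mapP[i /lP[Zi i0] ->] /=; split; first exact: Zp_mulX.
by rewrite addr_ge0// ln_ge0// ler1n.
Qed.

Lemma U0_int (n : int) : U0 n%:~R.
Proof.
exists [:: (0, n%:~R)]; split; last by rewrite /vals big_seq1 Rt0 mul1r.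
by move=> i; rewrite inE => /eqP -> /=; split=> //; apply: Zp_int.
Qed.

Definition expbd v := exists M : nat, `|v| <= exp (M%:R * X).

Lemma expX_nat_le (M M' : nat) : (M <= M')%N -> exp (M%:R * X) <= exp (M'%:R * X).
Proof. by move=> MM'; rewrite kexp_le ler_pM2r// ler_nat. Qed.

Lemma expXS (M : nat) : exp (M.+1%:R * X) = exp (M%:R * X) * exp X.
Proof. by rewrite -kexpD -natr1 mulrDl mul1r. Qed.

Lemma two_expX (M : nat) : 2 * exp (M%:R * X) <= exp (M.+1%:R * X).
Proof.
rewrite expXS mulrC ler_pM2l//; exact: nat_le_expX.
Qed.

Lemma expbd_add v v' : expbd v -> expbd v' -> expbd (v + v').
Proof.
move=> [M h] [M' h']; exists (M + M').+1.
apply: le_trans (two_expX _); apply: le_trans (ler_normD _ _) _.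
have := expX_nat_le (leq_addr M' M); have := expX_nat_le (leq_addl M M').
by lra.
Qed.

Lemma expbd_term q w : La w -> expbd (Rt q * w).
Proof.
move=> /La_upper[M wM]; have [N qN] := cst_bound q; exists (N + M)%N.
rewrite normrM (gtr0_norm (Rt_gt0 q)) natrD mulrDl kexpD.
apply: ler_pM => //; first exact: ltW.
  by rewrite /Rt kexp_le ler_pM2r//; apply: le_trans (ler_norm _) qN.
apply: le_trans wM _; rewrite kexp_nat; apply: lerXn2r; rewrite ?nnegrE//.
exact: X_le_expX.
Qed.

Lemma T0_expbd v : T0 v -> expbd v.
Proof.
move=> [l [lP ->]]; elim: l lP => [|i l IH] lP.
  by exists 0%N; rewrite /vals big_nil normr0.
rewrite /vals big_cons; apply: expbd_add.
  by apply: expbd_term; apply: lP; rewrite mem_head.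
by apply: IH => j jl; apply: lP; rewrite in_cons jl orbT.
Qed.

(** Expansions to any exponential accuracy. The finite sums [T0] alone would not do, because [exp e]
    and [ln (1 + e)] have infinite expansions. *)
Definition D0 v := forall N : nat, exists2 t, T0 t & `|v - t| <= exp (- (N%:R * X)).

Lemma expX_neg_le1 (N : nat) : exp (- (N%:R * X)) <= 1.
Proof. by rewrite -[leRHS](kexp0 K) kexp_le oppr_le0 mulr_ge0. Qed.

Lemma two_expX_neg (N : nat) : 2 * exp (- (N.+1%:R * X)) <= exp (- (N%:R * X)).
Proof.
rewrite !kexpN -(@ler_pM2l _ (exp (N.+1%:R * X)))// mulrCA divff ?lt0r_neq0// mulr1.
rewrite expXS mulrAC divff ?lt0r_neq0// mul1r.
exact: (nat_le_expX 2).
Qed.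

Lemma D0_T0 v : T0 v -> D0 v.
Proof. by move=> Tv N; exists v => //; rewrite subrr normr0. Qed.

Lemma D0_add v v' : D0 v -> D0 v' -> D0 (v + v').
Proof.
move=> Dv Dv' N; have [t Tt tv] := Dv N.+1; have [t' Tt' tv'] := Dv' N.+1.
exists (t + t'); first exact: T0_add.
apply: le_trans (two_expX_neg N); rewrite opprD addrACA.
by apply: le_trans (ler_normD _ _) _; rewrite mulr_natl mulr2n; lra.
Qed.

Lemma D0_expbd v : D0 v -> expbd v.
Proof.
move=> /(_ 0%N)[t Tt h]; rewrite -(subrK t v); apply: expbd_add; last exact: T0_expbd.
by exists 0%N; apply: le_trans h _; rewrite !mul0r oppr0.
Qed.

Lemma D0_mul v v' : D0 v -> D0 v' -> D0 (v * v').
Proof.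
move=> Dv Dv'; have [M vM] := D0_expbd Dv; have [M' vM'] := D0_expbd Dv'.
move=> N; have [t Tt tv] := Dv (N + M + M').+2; have [t' Tt' tv'] := Dv' (N + M + M').+2.
exists (t * t'); first exact: T0_mul.
have t'M : `|t'| <= exp (M'.+1%:R * X).
  apply: le_trans (two_expX M'); rewrite [leRHS]mulr_natl mulr2n.
  have -> : t' = v' - (v' - t') by ring.
  apply: le_trans (ler_normB _ _) _; apply: lerD => //.
  apply: le_trans tv' _; apply: le_trans (expX_neg_le1 _) _.
  by rewrite -[leLHS](kexp0 K) kexp_le mulr_ge0.
have -> : v * v' - t * t' = v * (v' - t') + (v - t) * t' by ring.
apply: le_trans (two_expX_neg N); apply: le_trans (ler_normD _ _) _.
have E (m : nat) (x y : K) : (m <= M + M' + 1)%N -> `|x| <= exp (m%:R * X) ->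
    `|y| <= exp (- ((N + M + M').+2%:R * X)) -> `|x * y| <= exp (- (N.+1%:R * X)).
  move=> mM xm ym; rewrite normrM; apply: le_trans (ler_pM _ _ xm ym) _ => //.
  rewrite -kexpD kexp_le.
  have : (m + N.+1)%:R * X <= (N + M + M').+2%:R * X.
    by rewrite ler_pM2r// ler_nat; move: mM; clear; lia.
  by rewrite natrD mulrDl; lra.
have h1 : `|v * (v' - t')| <= exp (- (N.+1%:R * X)) by apply: (E M) => //; clear; lia.
have h2 : `|(v - t) * t'| <= exp (- (N.+1%:R * X)).
  by rewrite mulrC; apply: (E M'.+1) => //; clear; lia.
by lra.
Qed.

Lemma D0_cst r : D0 (cst r). Proof. exact/D0_T0/T0_La/La_cst. Qed.

Lemma D0_opp v : D0 v -> D0 (- v).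
Proof.
move=> Dv; rewrite -mulN1r -(rmorph1 cst) -rmorphN; apply: D0_mul Dv; exact: D0_cst.
Qed.

(** Exponential decay at some positive rate, not mere infinitesimality: enough factors [e] then
    reach any accuracy [exp (-N X)], as [D0_taylor] needs. *)
Definition expsmall e := exists m : nat, `|e| <= exp (- (X / m.+1%:R)).

Lemma expsmall_mono (m m' : nat) : (m <= m')%N ->
  exp (- (X / m.+1%:R)) <= exp (- (X / m'.+1%:R)).
Proof.
by move=> mm'; rewrite kexp_le lerN2 ler_pM2l// lef_pV2 ?posrE ?ltr0n// ler_nat.
Qed.

Lemma two_expsmall (n m : nat) : n%:R * exp (- (X / m.+1%:R)) <= exp (- (X / m.+2%:R)).
Proof.
rewrite -(@ler_pM2r _ (exp (X / m.+1%:R)))// -mulrA -!kexpD addNr kexp0 mulr1.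
apply: le_trans (_ : 1 + (- (X / m.+2%:R) + X / m.+1%:R) <= _); last exact: kexp_ge.
have a0 : 0 < m.+1%:R :> K by rewrite ltr0n.
have b0 : 0 < m.+2%:R :> K by rewrite ltr0n.
have := kX_big K (n * (m.+1 * m.+2))%N; rewrite !natrM => h.
have : n%:R <= X / m.+1%:R - X / m.+2%:R.
  have -> : X / m.+1%:R - X / m.+2%:R = X / (m.+1%:R * m.+2%:R).
    by rewrite -[m.+2%:R]natr1; field; rewrite ?natr1 !lt0r_neq0.
  by rewrite ler_pdivlMr ?mulr_gt0.
by move: (X / m.+1%:R) (X / m.+2%:R) => x y; lra.
Qed.

Lemma expsmall_add e e' : expsmall e -> expsmall e' -> expsmall (e + e').
Proof.
move=> [m h] [m' h']; exists (m + m').+1.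
apply: le_trans (two_expsmall 2 _); apply: le_trans (ler_normD _ _) _.
have := expsmall_mono (leq_addr m' m); have := expsmall_mono (leq_addl m m').
by lra.
Qed.

Lemma expsmall0 : expsmall 0.
Proof. by exists 0%N; rewrite normr0. Qed.

Lemma expsmall_mul a e : bigO 1 a -> expsmall e -> expsmall (a * e).
Proof.
move=> [N aN] [m em]; exists m.+1; apply: le_trans (two_expsmall N m).
by rewrite normrM; apply: ler_pM => //; rewrite -[leRHS]mulr1.
Qed.

Lemma expsmall_term q w : q < 0 -> La w -> expsmall (Rt q * w).
Proof.
move=> q0 /La_upper[M wM].
have q2 : 0 < - (q / 2) by lra.
have [N Nq] := cst_lower q2; have := expX_big M q2 => XM.
case: N Nq => [|N] Nq; first by move: Nq; rewrite mul0r ler10.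
exists N; rewrite normrM (gtr0_norm (Rt_gt0 q)).
apply: le_trans (_ : Rt q * Rt (- (q / 2)) <= _).
  by rewrite ler_pM2l//; apply: le_trans wM XM.
rewrite -RtD (_ : q + _ = q / 2); last by lra.
rewrite /Rt kexp_le mulrC -mulrN ler_pM2l// lerNr -rmorphN -[leLHS]div1r.
by rewrite ler_pdivrMr ?ltr0n// mulrC.
Qed.

Lemma expsmall_fin e (n : nat) : expsmall e -> n%:R * `|e| <= 1.
Proof.
move=> [m em]; apply: le_trans (ler_wpM2l (ler0n _ n) em) _.
apply: le_trans (two_expsmall n m) _.
by rewrite -[leRHS](kexp0 K) kexp_le oppr_le0 divr_ge0.
Qed.

Lemma D0_taylor phi e : taylor phi -> D0 e -> expsmall e -> D0 (phi e).
Proof.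
move=> Tphi De se N; have [m em] := se.
(* Since [|e| <= exp (-X/(m+1))], this degree gives an error [C exp (-(N+2) X)]. One unit in the
   exponent absorbs [C], the other the addition of two errors. *)
have [c [C cP]] := Tphi (m.+1 * N.+2)%N.
have e2 : `|e| <= 2^-1 by have := expsmall_fin 2 se; lra.
have Dp n : D0 (\sum_(i < n) cst (c i) * e ^+ i).
  elim: n => [|n IH]; first by rewrite big_ord0; apply/D0_T0/T0_0.
  rewrite big_ord_recr; apply: D0_add => //; apply: D0_mul; first exact: D0_cst.
  elim: (n : nat) => [|k IHk]; first by rewrite expr0 -(rmorph1 cst); apply: D0_cst.
  by rewrite exprS; apply: D0_mul.
have [t Tt ht] := Dp (m.+1 * N.+2)%N N.+1; exists t => //.
apply: le_trans (two_expX_neg N).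
rewrite -(subrK (\sum_(i < m.+1 * N.+2) cst (c i) * e ^+ i) (phi e)) -addrA.
apply: le_trans (ler_normD _ _) _; rewrite [leRHS]mulr_natl mulr2n; apply: lerD => //.
apply: le_trans (cP _ e2) _.
apply: le_trans (_ : C%:R * exp (- (N.+2%:R * X)) <= _).
  apply: ler_wpM2l => //.
  apply: le_trans (lerXn2r _ _ _ em) _; rewrite ?nnegrE// -kexp_nat kexp_le.
  rewrite mulrN lerN2 natrM mulrAC mulrCA divff ?pnatr_eq0// mulr1.
  by rewrite mulrC.
rewrite !kexpN [in leLHS]expXS invfM mulrCA -[leRHS]mulr1 ler_pM2l ?invr_gt0//.
by rewrite ler_pdivrMr// mul1r nat_le_expX.
Qed.

Lemma seq_max (P : pred R) (s : seq R) : has P s ->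
  exists q0, [/\ q0 \in s, P q0 & forall q, q \in s -> P q -> q <= q0].
Proof.
elim: s => // x s IH; have [/IH[q0 [q0s Pq0 q0max]] _|/hasPn nP] := boolP (has P s).
  have [Px|nPx] := boolP (P x); last first.
    exists q0; split=> //; first by rewrite in_cons q0s orbT.
    move=> q; rewrite in_cons => /orP[/eqP->|]; last exact: q0max.
    by rewrite (negbTE nPx).
  have [xq|/ltW qx] := leP x q0.
    exists q0; split=> //; first by rewrite in_cons q0s orbT.
    by move=> q; rewrite in_cons => /orP[/eqP->//|]; exact: q0max.
  exists x; rewrite mem_head; split=> // q; rewrite in_cons => /orP[/eqP->//|qs Pq].
  exact: le_trans (q0max _ qs Pq) qx.
move=> /= /orP[Px|/hasP[q qs Pq]]; last by have := nP _ qs; rewrite Pq.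
exists x; rewrite mem_head; split=> // q; rewrite in_cons => /orP[/eqP->//|/nP].
by move=> /negbTE ->.
Qed.

(** The largest positive rate [q0] with nonzero coefficient would dominate all other terms and any
    multiple of [X]: coefficients are bounded above, and if nonzero below, by powers of [X], and
    exponentials beat these. *)
Lemma rate_lead (s : seq R) (b : R -> K) : uniq s ->
  (forall q, exists M : nat, `|b q| <= X ^+ M) ->
  (forall q, b q = 0 \/ exists M : nat, 1 <= X ^+ M * `|b q|) ->
  bigO X (\sum_(q <- s) Rt q * b q) ->
  forall q, q \in s -> 0 < q -> b q = 0.
Proof.
move=> us bup blo [N vN] q1 q1s q10; apply/eqP; apply/negP => /negP bq1.
have [|q0 [q0s /andP[q00 bq0] q0max]] :=
  @seq_max (fun q => (0 < q) && (b q != 0)) s.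
  by apply/hasP; exists q1 => //; rewrite q10.
have [/eqP|[M bM]] := blo q0; first by rewrite (negbTE bq0).
pose negl (x : K) := forall M : nat, X ^+ M * `|x| <= Rt q0.
have nadd x y : negl x -> negl y -> negl (x + y).
  move=> nx ny i; have := nx i.+1; have := ny i.+1; rewrite exprS -!mulrA.
  have X2 := kX_big K 2; have Xi : 0 < X ^+ i by apply: exprn_gt0.
  have hx : 0 <= X ^+ i * `|x| by rewrite mulr_ge0// ltW.
  have hy : 0 <= X ^+ i * `|y| by rewrite mulr_ge0// ltW.
  move=> h1 h2; apply: le_trans (ler_wpM2l (ltW Xi) (ler_normD x y)) _.
  rewrite mulrDr; nra.
have nS : negl (\sum_(q <- s | q != q0) Rt q * b q).
  rewrite big_seq_cond; elim/big_ind: _ => // [i|q /andP[qs qq0]].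
    by rewrite normr0 mulr0 ltW.
  have [bq|bq] := eqVneq (b q) 0; first by move=> i; rewrite bq mulr0 normr0 mulr0 ltW.
  have qlt : q < q0.
    have [q_le0|q_gt0] := leP q 0; first exact: le_lt_trans q00.
    by rewrite lt_neqAle qq0 q0max// q_gt0.
  move=> i; have [j bj] := bup q.
  rewrite normrM (gtr0_norm (Rt_gt0 q)) mulrCA.
  rewrite -[q0 in leRHS](subrK q) addrC RtD ler_pM2l//.
  apply: le_trans (_ : X ^+ i * X ^+ j <= _).
    by rewrite ler_pM2l ?exprn_gt0.
  by rewrite -exprD; apply: expX_big; rewrite subr_gt0.
move: vN; rewrite (bigD1_seq q0)//=; set S := \sum_(_ <- _ | _) _ in nS * => vN.
have h1 : Rt q0 * `|b q0| <= N%:R * X + `|S|.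
  rewrite -(gtr0_norm (Rt_gt0 q0)) -normrM.
  have := ler_normB (Rt q0 * b q0 + S) S; rewrite addrK; lra.
have XM : 0 < X ^+ M by apply: exprn_gt0.
have h2 := nS M.+1; have h3 : X ^+ M.+3 <= Rt q0 by apply: expX_big.
have h4 : Rt q0 <= X ^+ M * (N%:R * X) + X ^+ M * `|S|.
  rewrite -mulrDr; apply: le_trans (_ : X ^+ M * (Rt q0 * `|b q0|) <= _); last first.
    by rewrite ler_pM2l.
  by rewrite mulrCA ler_peMr// ltW.
rewrite exprS -mulrA in h2; have X2 := kX_big K 2; have XN := kX_big K (2 * N + 1)%N.
rewrite natrD natrM in XN.
have h5 : 2 * (X ^+ M * `|S|) <= Rt q0.
  apply: le_trans h2; rewrite ler_wpM2r// mulr_ge0// ltW//.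
have h6 : X ^+ M * X * X * X <= Rt q0 by rewrite -!exprSr.
have h7 : 2 * (X ^+ M * (N%:R * X)) < X ^+ M * X * X * X.
  rewrite [ltLHS](_ : _ = X ^+ M * X * (2 * N%:R)); last by ring.
  rewrite -[ltRHS]mulrA ltr_pM2l ?mulr_gt0//.
  apply: lt_le_trans (_ : X <= _); first by lra.
  by rewrite ler_peMl.
move: h4 h5 h6 h7; move: (X ^+ M * (N%:R * X)) (X ^+ M * `|S|) (X ^+ M * X * X * X).
by move: (Rt q0) => A B Y Z; lra.
Qed.

Lemma La_lower w : La w -> w = 0 \/ exists M : nat, 1 <= X ^+ M * `|w|.
Proof.
move=> /La_lead[|[e [C [h _]]]]; [by left|right].
exists (`|e|.+1)%N; rewrite exprSr -mulrA.
apply: le_trans (_ : X ^+ `|e|%N * (C%:R * `|w|) <= _); last first.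
  by rewrite ler_pM2l ?exprn_gt0// ler_wpM2r// kX_big.
apply: le_trans (_ : X ^+ `|e|%N * X ^ e <= _); last by rewrite ler_pM2l ?exprn_gt0.
by rewrite exprnP -expfzDr// -(expr0z X); apply: Xz_le; clear; lia.
Qed.

Lemma bigO_X_expsmall e : expsmall e -> bigO X e.
Proof.
by move=> /(expsmall_fin 1) h; exists 1%N; have := X_ge1; lra.
Qed.

Lemma normal_form u D : U0 u -> D0 D -> bigO X (u * ln X + D) ->
  exists (n : int) r s a e, [/\ An a, D0 e, expsmall e, u = n%:~R &
    D = cst r * X + cst s + X^-1 * a + e].
Proof.
move=> [lu [luP uE]] DD vO; have [t [lt [ltP tE]] Dt] := DD 1%N.
have sDt : expsmall (D - t) by exists 0%N; apply: le_trans Dt _; rewrite mul1r divr1.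
pose s := undup (0 :: [seq i.1 | i <- lu ++ lt]).
have us : uniq s by apply: undup_uniq.
have s0 : 0 \in s by rewrite mem_undup mem_head.
have usub : {subset [seq i.1 | i <- lu] <= s}.
  by move=> q ql; rewrite mem_undup in_cons map_cat mem_cat ql orbT.
have tsub : {subset [seq i.1 | i <- lt] <= s}.
  by move=> q ql; rewrite mem_undup in_cons map_cat mem_cat ql !orbT.
have La0 : La 0 by rewrite -(rmorph0 cst); apply: La_cst.
pose z q := coef lu q; pose w q := coef lt q.
have Zz q : Zp (z q).
  by apply: coef_ind; [exact: Zp0|exact: Zp_add|move=> i /luP[]].
have Lz q := Zp_La (Zz q).
have Lw q : La (w q) by apply: coef_ind => //; exact: La_add.
have zneg q : q < 0 -> z q = 0.
  move=> q0; rewrite /z /coef big1_seq// => i /andP[/eqP iq /luP[_]].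
  by rewrite iq leNgt q0.
pose b q := z q * ln X + w q.
have LlnX : exists M : nat, `|ln X| <= X ^+ M.
  by exists 1%N; rewrite gtr0_norm// expr1 -[leLHS]mul1r; apply: (klnX_small K 1).
have bup q : exists M : nat, `|b q| <= X ^+ M.
  have [M1 h1] := La_upper (Lz q); have [M2 h2] := La_upper (Lw q).
  have [M3 h3] := LlnX; exists (M1 + M3 + M2).+1.
  apply: le_trans (ler_normD _ _) _; rewrite normrM.
  have p1 : `|z q| * `|ln X| <= X ^+ (M1 + M3) by rewrite exprD; apply: ler_pM.
  have p2 : X ^+ (M1 + M3) <= X ^+ (M1 + M3 + M2) by apply: ler_weXn2l => //; clear; lia.
  have p3 : X ^+ M2 <= X ^+ (M1 + M3 + M2) by apply: ler_weXn2l => //; clear; lia.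
  have X2 := kX_big K 2; rewrite exprS.
  have p4 : 0 < X ^+ (M1 + M3 + M2) by apply: exprn_gt0.
  nra.
have blo q : b q = 0 \/ exists M : nat, 1 <= X ^+ M * `|b q|.
  have [z0|z0] := eqVneq (z q) 0.
    by rewrite /b z0 mul0r add0r; apply: La_lower.
  right; have [e [C [h _]]] := La_lnX_lower (Lz q) (Lw q) z0.
  exists (`|e|.+1)%N; rewrite exprSr -mulrA.
  apply: le_trans (_ : X ^+ `|e|%N * (C%:R * `|b q|) <= _); last first.
    by rewrite ler_pM2l ?exprn_gt0// ler_wpM2r// kX_big.
  apply: le_trans (_ : X ^+ `|e|%N * X ^ e <= _); last by rewrite ler_pM2l ?exprn_gt0.
  by rewrite exprnP -expfzDr// -(expr0z X); apply: Xz_le; clear; lia.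
have vE : u * ln X + t = \sum_(q <- s) Rt q * b q.
  rewrite uE tE !(vals_coef us)// mulr_suml -big_split; apply: eq_bigr => q _ /=.
  by rewrite /b mulrDr mulrA.
have vO' : bigO X (\sum_(q <- s) Rt q * b q).
  rewrite -vE (_ : _ + t = (u * ln X + D) - (D - t)); last by ring.
  by apply: bigOB => //; apply: bigO_X_expsmall.
have bpos := rate_lead us bup blo vO'.
have zw q : q \in s -> 0 < q -> z q = 0 /\ w q = 0.
  move=> qs q0; have bq := bpos _ qs q0.
  have [z0|z0] := eqVneq (z q) 0; first by move: bq; rewrite /b z0 mul0r add0r.
  have [e [C [h _]]] := La_lnX_lower (Lz q) (Lw q) z0.
  by move: h; rewrite -/(b q) bq normr0 mulr0 leNgt exprz_gt0.
have uz : u = z 0.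
  rewrite uE (vals_coef us)// (bigD1_seq 0)//= Rt0 mul1r big1_seq ?addr0// => q.
  move=> /andP[q0 qs]; have [qn|qp|/eqP] := ltgtP q 0; last by rewrite (negbTE q0).
    by rewrite -/(z q) zneg// mulr0.
  by rewrite -/(z q) (proj1 (zw _ qs qp)) mulr0.
have tw : expsmall (t - w 0).
  rewrite tE (vals_coef us)// (bigD1_seq 0)//= Rt0 mul1r -/(w 0) addrAC subrr add0r.
  rewrite big_seq_cond; elim/big_ind: _ => [||q /andP[qs q0]].
  - exact: expsmall0.
  - exact: expsmall_add.
  - have [qn|qp|/eqP] := ltgtP q 0; last by rewrite (negbTE q0).
      exact: expsmall_term.
    by rewrite -/(w q) (proj2 (zw _ qs qp)) mulr0; apply: expsmall0.
have b0O : bigO X (b 0).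
  rewrite (_ : b 0 = (u * ln X + D) - (D - t) - (t - w 0)); last by rewrite /b uz; ring.
  by do 2?[apply: bigOB => //; last exact: bigO_X_expsmall].
have z1 := bigO_X_lnX (Lz 0) (Lw 0) b0O.
have [n nE] : exists n : int, z 0 = n%:~R.
  have [//|XZ] := Zp_cases (Zz 0); exfalso.
  have [N zN] := z1; have := kX_gt K (2 * N)%N; rewrite natrM; rewrite mulr1 in zN; lra.
have w0O : bigO X (w 0).
  rewrite (_ : w 0 = b 0 - z 0 * ln X); last by rewrite /b; ring.
  apply: bigOB => //; have [N zN] := z1; exists N.
  rewrite normrM; apply: ler_pM => //; first by rewrite -[leRHS]mulr1.
  by rewrite gtr0_norm// -[leLHS]mul1r; apply: (klnX_small K 1).
have [r [s1 [a [Aa wE]]]] := La_bigO_X (Lw 0) w0O.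
exists n, r, s1, a, (D - w 0); split=> //.
- by apply: D0_add => //; apply/D0_opp/D0_T0/T0_La.
- rewrite (_ : D - w 0 = (D - t) + (t - w 0)); last by ring.
  exact: expsmall_add.
- by rewrite uz.
- by rewrite -wE; ring.
Qed.

(** The terms dominate each other in this order: [r X], then [n ln X], then a bounded rest. *)
Lemma normal_sign (n : int) r s a e : An a -> expsmall e ->
  let v := n%:~R * ln X + (cst r * X + cst s + X^-1 * a + e) in
  [/\ 0 < r -> ln X <= v, r < 0 -> v < 0 & r = 0 ->
    [/\ 0 < n -> exists C : nat, ln X - C%:R <= v,
        n <= 0 -> exists C : nat, v <= C%:R & v <= 0 -> n <= 0]].
Proof.
move=> Aa se v.
have [N1 sN] := cst_bound s; have h1 := inf_small 1 Aa; have h2 := expsmall_fin 1 se.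
rewrite !mul1r in h1 h2.
pose rest := cst s + X^-1 * a + e.
have restN : `|rest| <= N1%:R + 2.
  apply: le_trans (ler_normD _ _) _; apply: le_trans (lerD (ler_normD _ _) (lexx _)) _.
  by lra.
have vE : v = n%:~R * ln X + cst r * X + rest by rewrite /v /rest; ring.
have nl : `|n%:~R * ln X| = `|n|%N%:R * ln X :> K.
  by rewrite normrM (gtr0_norm lnX_gt0) -intr_norm -abszE.
have lnb := klnX_gt K (N1 + 2)%N; rewrite natrD in lnb.
move: restN nl; rewrite !ler_norml => /andP[r1 r2] nl.
have nl1 : - (`|n|%N%:R * ln X) <= n%:~R * ln X by rewrite -nl lerNnormlW.
have nl2 : n%:~R * ln X <= `|n|%N%:R * ln X by rewrite -nl ler_norm.
split=> [r0|r0|r0].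
- have := cstX_lnX (`|n|%N + 2) r0; rewrite natrD mulrDl; rewrite vE.
  by move: (`|n|%N%:R * ln X) nl1 nl2 => y; lra.
- have r0' : 0 < - r by lra.
  have := cstX_lnX (`|n|%N + 2) r0'; rewrite natrD mulrDl rmorphN mulNr; rewrite vE.
  by move: (`|n|%N%:R * ln X) nl1 nl2 => y; lra.
have {}vE : v = n%:~R * ln X + rest by rewrite vE r0 rmorph0 mul0r addr0.
have npos : 0 < n -> ln X <= n%:~R * ln X.
  move=> n0; apply: ler_peMl; first exact: ltW.
  by rewrite (_ : 1 = 1%:~R)// ler_int -gtz0_ge1.
split=> [n0|n0|v0].
- exists (N1 + 2)%N; rewrite natrD vE; have := npos n0; lra.
- exists (N1 + 2)%N; rewrite natrD vE.
  have : n%:~R * ln X <= 0 by rewrite pmulr_lle0// (_ : 0 = 0%:~R)// ler_int.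
  lra.
- rewrite leNgt; apply/negP => /npos; rewrite vE in v0; lra.
Qed.

(** If [v] is below all [-N X], the value is negligible. Otherwise [v] has a normal form. For
    [r < 0] the element [exp v] is exponentially small and Taylor's formula applies; for [r = 0] it
    is [w0 exp e], with [w0] in [An] because [n <= 0]. *)
Lemma D0_ln1pexp u D : U0 u -> D0 D -> u * ln X + D <= 0 ->
  D0 (ln (1 + exp (u * ln X + D))).
Proof.
move=> Uu DD; set v := _ + D => v0.
have ev0 := exp_gt0 v.
have lnv : 0 <= ln (1 + exp v) <= exp v.
  rewrite kln_ge0; last by lra.
  by have := @kln_leB1 K (1 + exp v) ltac:(lra); lra.
have [[N vN]|nv] := pselect (exists N : nat, - (N%:R * X) <= v); last first.
  move=> N; exists 0; first exact: T0_0.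
  rewrite subr0 ger0_norm; last by case/andP: lnv.
  apply: le_trans (proj2 (andP lnv)) _; rewrite kexp_le leNgt; apply/negP => h.
  by apply: nv; exists N; apply: ltW.
have vO : bigO X v by exists N; rewrite ler0_norm//; lra.
have [n [r [s [a [e [Aa De se uE DE]]]]]] := normal_form Uu DD vO.
have vE : v = n%:~R * ln X + (cst r * X + cst s + X^-1 * a + e).
  by rewrite /v uE DE.
have [rpos _ r0P] := normal_sign n r s Aa se.
have lnz : exp (n%:~R * ln X) = X ^ n.
  case: (n) => m; first by rewrite -exprnP kexp_nat klnK.
  by rewrite NegzE intrN mulNr kexpN kexp_nat klnK// -exprnN.
have Dexp : D0 (exp e) by apply: D0_taylor.
have evE : exp v = Rt r * (X ^ n * exp (cst s + X^-1 * a)) * exp e.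
  rewrite vE -lnz /Rt -!kexpD; congr (exp _); ring.
have Ae : An (exp (cst s + X^-1 * a)).
  by apply/An_exp/An_add => //; apply: An_mul.
have Lc : La (X ^ n * exp (cst s + X^-1 * a)).
  by apply: La_mul; [exact: La_exprz|exact: La_An].
have e1 := expsmall_fin 2 se.
have near : `|exp e - 1| <= 2 * `|e|.
  have h1 := kexp_ge e; have h2 := kexp_ge (- e).
  have h3 : exp e * exp (- e) = 1 by rewrite -kexpD subrr kexp0.
  have h0 := exp_gt0 e; move: e1; rewrite ler_norml.
  by have [t0|t0] := ger0P e => e1; apply/andP; split; nra.
have [rlt|rgt|r0] := ltgtP r 0.
- apply: (@D0_taylor (fun e => ln (1 + e)) (exp v)) => //; rewrite evE.
    by apply: D0_mul => //; apply: D0_T0; apply: T0_Rt.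
  rewrite mulrC; apply: expsmall_mul; last exact: expsmall_term.
  exists 2%N; rewrite mulr1 gtr0_norm//.
  by move: near; rewrite ler_norml => /andP[_]; lra.
- by have := rpos rgt; rewrite -vE; have := lnX_gt0; lra.
have n0 : n <= 0 by have [_ _] := r0P r0; rewrite -vE; apply.
rewrite r0 Rt0 mul1r in evE.
set w0 := X ^ n * _ in evE Lc.
have Aw : An w0.
  apply: An_mul => //; case: n n0 {vE rpos r0P lnz evE Lc w0 uE} => [[|m]|m] // _.
    by rewrite expr0z -(rmorph1 cst).
  by rewrite NegzE -exprnN; apply: An_XVn.
have w0_gt0 : 0 < w0 by rewrite mulr_gt0// exprz_gt0.
pose i0 := (1 + w0)^-1.
have w1 : 0 < 1 + w0 by lra.
have A1w : An (1 + w0) by apply: An_add => //; rewrite -(rmorph1 cst).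
have Al : An (ln (1 + w0)) by apply: An_ln => //; lra.
have Ai : An i0.
  rewrite /i0 -(klnK w1) -kexpN; apply: An_exp; rewrite -mulN1r.
  by apply: An_mul => //; rewrite -(rmorph1 cst) -rmorphN.
(* Chosen so that [1 + w0 exp e = (1 + w0) (1 + d)]: the first factor has its logarithm in [An], the
   second is a case of Taylor's formula. *)
pose d := w0 * i0 * (exp e - 1).
have wi : 0 < w0 * i0 <= 1.
  rewrite mulr_gt0 ?invr_gt0//= ler_pdivrMr// mul1r; lra.
have sd : expsmall d.
  rewrite /d; apply: expsmall_mul; first by apply: An_fin; apply: An_mul.
  have [m em] := expsmall_mul (a := 2) (ltac:(by exists 2%N; rewrite normr_nat mulr1)) se.
  by exists m; apply: le_trans near _; apply: le_trans em; rewrite normrM normr_nat.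
have Dd : D0 d.
  apply: D0_mul; first by apply/D0_T0/T0_La/La_An/An_mul.
  by apply: D0_add => //; apply: D0_opp; rewrite -(rmorph1 cst); apply: D0_cst.
have d1 : 0 < 1 + d.
  have := expsmall_fin 2 sd; have [? ?|? ?] := ger0P d; lra.
have -> : ln (1 + exp v) = ln (1 + w0) + ln (1 + d).
  rewrite -klnM//; congr ln; rewrite evE /d /i0; field; exact: lt0r_neq0.
apply: D0_add; first by apply/D0_T0/T0_La/La_An.
exact: (@D0_taylor (fun e => ln (1 + e)) d).
Qed.

(** For a sum with [f <= g], [ln (f + g) = ln g + ln (1 + f/g)], and [D0_ln1pexp] covers the last
    term, so the coefficient of [ln X] is that of [g]. Powers multiply it by [c^X X^j], which
    preserves integrality. *)
Lemma skA_expansion h : skA h -> exists u D, [/\ U0 u, D0 D & ln h = u * ln X + D].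
Proof.
have D00 : D0 0 by apply/D0_T0/T0_0.
elim=> [||f g Af [u [D [Uu DD fE]]] Ag [u' [D' [Uu' DD' gE]]]|
          f g Af [u [D [Uu DD fE]]] Ag [u' [D' [Uu' DD' gE]]]|
          f c j c0 Af [u [D [Uu DD fE]]]].
- exists 0, 0; split=> //; first exact: (U0_int 0).
  by rewrite kln1 mul0r addr0.
- by exists 1, 0; split=> //; [exact: (U0_int 1)|rewrite mul1r addr0].
- wlog fg : f g u u' D D' Af Ag Uu Uu' DD DD' fE gE / f <= g.
    move=> H; have [fg|/ltW gf] := leP f g; first exact: (H f g u u' D D').
    by rewrite addrC; apply: (H g f u' u D' D).
  have f0 := skA_gt0 Af; have g0 := skA_gt0 Ag.
  have Uuu : U0 (u - u') by apply: U0_add => //; apply: U0_opp.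
  have DDD : D0 (D - D') by apply: D0_add => //; apply: D0_opp.
  have vE : (u - u') * ln X + (D - D') = ln f - ln g by rewrite fE gE; ring.
  exists u', (D' + ln (1 + exp ((u - u') * ln X + (D - D')))); split=> //.
    apply: D0_add => //; apply: D0_ln1pexp => //.
    by rewrite vE subr_le0 kln_le.
  rewrite addrA -gE vE -kln_div// klnK ?divr_gt0// -klnM//.
    by congr ln; field; exact: lt0r_neq0.
  by have := divr_gt0 f0 g0; lra.
- exists (u + u'), (D + D'); split; [exact: U0_add|exact: D0_add|].
  by rewrite klnM ?skA_gt0// fE gE; ring.
- exists (kE c j * u), (kE c j * D); split; first exact: U0_scale.
    apply: D0_mul => //; rewrite kE_Rt//; apply/D0_T0/T0_Rt.
    by rewrite exprnP; apply: La_exprz.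
  by rewrite kexpK fE; ring.
Qed.

(** In the normal form of [ln (f/g)] with [r = 0] the coefficient [n] is an integer. If [n <= 0] the
    quotient is bounded; if [n >= 1] it is at least [X] up to a bounded factor; nothing lies in
    between. *)
Theorem skA_gap f g : skA f -> skA g -> bigO g f \/ bigO f (g * X).
Proof.
move=> Af Ag; have f0 := skA_gt0 Af; have g0 := skA_gt0 Ag.
have [u [D [Uu DD fE]]] := skA_expansion Af.
have [u' [D' [Uu' DD' gE]]] := skA_expansion Ag.
have Uuu : U0 (u - u') by apply: U0_add => //; apply: U0_opp.
have DDD : D0 (D - D') by apply: D0_add => //; apply: D0_opp.
have vE : ln f - ln g = (u - u') * ln X + (D - D') by rewrite fE gE; ring.
have fin (C : nat) : ln f - ln g <= C%:R -> bigO g f.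
  move=> h; exists (4 ^ C)%N; rewrite gtr0_norm//.
  apply: le_trans (_ : exp C%:R * g <= _); last by rewrite ler_pM2r//; apply: kexp_nat_le.
  by rewrite -{1}(klnK f0) -{1}(klnK g0) -kexpD kexp_le; lra.
have big (C : nat) : ln X - C%:R <= ln f - ln g -> bigO f (g * X).
  move=> h; exists (4 ^ C)%N; rewrite gtr0_norm ?mulr_gt0//.
  apply: le_trans (_ : exp C%:R * f <= _); last by rewrite ler_pM2r//; apply: kexp_nat_le.
  rewrite -{1}(klnK f0) -{1}(klnK g0) -{1}(klnK X_gt0) -!kexpD kexp_le; lra.
have [v0|v0] := leP (ln f - ln g) 0; first by left; apply: (fin 0%N).
have [vX|Xv] := leP (ln f - ln g) X; last first.
  right; apply: (big 0%N); have := klnX_small K 1; lra.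
have vO : bigO X (ln f - ln g) by exists 1%N; rewrite mul1r gtr0_norm.
rewrite vE in vO; have [n [r [s [a [e [Aa De se uE DE]]]]]] := normal_form Uuu DDD vO.
have vE2 : ln f - ln g = n%:~R * ln X + (cst r * X + cst s + X^-1 * a + e).
  by rewrite vE uE DE.
have [rpos rneg r0P] := normal_sign n r s Aa se.
have [rlt|rgt|r0] := ltgtP r 0.
- by have := rneg rlt; rewrite -vE2; lra.
- by right; apply: (big 0%N); have := rpos rgt; rewrite -vE2; lra.
have [npos nneg _] := r0P r0; have [n0|n0] := ltP 0 n.
  by right; have [C h] := npos n0; apply: (big C); rewrite vE2.
by left; have [C h] := nneg n0; apply: (fin C); rewrite vE2.
Qed.

End Gap.

Import numFieldNormedType.Exports.

(** * Real analytic functions *)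

Section Derivatives.
Variable R : realType.
Implicit Types (f g : R -> R) (a b x y l m s t B C D M eta : R).

Definition der f x l := is_derive x 1 f l.

Lemma der_uniq f x l m : der f x l -> der f x m -> l = m.
Proof. by move=> [_ <-] [_ <-]. Qed.

Lemma derE f x l m : l = m -> der f x l -> der f x m. Proof. by move=> ->. Qed.

Lemma der_cst c x : der (fun=> c) x 0. Proof. exact: is_derive_cst. Qed.

Lemma der_id x : der (fun y => y) x 1. Proof. exact: is_derive_id. Qed.

Lemma derD f g x l m : der f x l -> der g x m -> der (fun y => f y + g y) x (l + m).
Proof. exact: is_deriveD. Qed.

Lemma derN f x l : der f x l -> der (fun y => - f y) x (- l).
Proof. exact: is_deriveN. Qed.

Lemma derB f g x l m : der f x l -> der g x m -> der (fun y => f y - g y) x (l - m).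
Proof. by move=> fl gm; apply: derD fl _; apply: derN. Qed.

Lemma derM f g x l m : der f x l -> der g x m ->
  der (fun y => f y * g y) x (l * g x + f x * m).
Proof.
move=> fl gm; apply: (derE _ (is_deriveM fl gm)).
by rewrite addrC; congr (_ + _); rewrite /GRing.scale /= mulrC.
Qed.

Lemma derZ c f x l : der f x l -> der (fun y => c * f y) x (c * l).
Proof.
by move=> fl; apply: derE (derM (der_cst c x) fl); rewrite mul0r add0r.
Qed.

Lemma der_comp f g x l m : der f (g x) l -> der g x m ->
  der (fun y => f (g y)) x (l * m).
Proof. exact: is_derive1_comp. Qed.

Lemma der_exp f x l : der f x l -> der (fun y => expR (f y)) x (l * expR (f x)).
Proof.
by move=> fl; apply: derE (der_comp (is_derive_expR (f x)) fl); rewrite mulrC.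
Qed.

Lemma der_ln f x l : 0 < f x -> der f x l -> der (fun y => ln (f y)) x (l / f x).
Proof.
move=> f0 fl; apply: derE (der_comp (is_derive1_ln f0) fl); rewrite mulrC //.
Qed.

Lemma der_inv f x l : f x != 0 -> der f x l ->
  der (fun y => (f y)^-1) x (- l * (f x)^-1 * (f x)^-1).
Proof.
move=> f0 fl; apply: derE (is_deriveV f0 fl).
by rewrite /GRing.scale /= expr2 invfM; ring.
Qed.

Lemma der_exprn f x l n : der f x l ->
  der (fun y => f y ^+ n.+1) x (n.+1%:R * l * f x ^+ n).
Proof.
move=> fl; elim: n => [|n IH]; first by rewrite expr0 mulr1 mul1r.
have := derM fl IH; rewrite -/(der _ _ _) => h.
have -> : (fun y => f y ^+ n.+2) = (fun y => f y * f y ^+ n.+1).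
  by apply/funext => y; rewrite exprS.
by apply: derE h; rewrite -[n.+2%:R]natr1 !exprS; ring.
Qed.

Lemma der_near f g x l : (\near x, f x = g x) -> der f x l -> der g x l.
Proof. exact: near_eq_is_derive. Qed.

Lemma der_ext a b f g x l : a < x < b -> (forall y, a < y < b -> f y = g y) ->
  der f x l -> der g x l.
Proof.
move=> xab fg; apply: der_near; near=> y; apply: fg.
have : y \in `]a, b[ by near: y; apply: near_in_itvoo; rewrite in_itv.
by rewrite in_itv.
Unshelve. all: by end_near. Qed.

Lemma der_mvt f (f' : R -> R) x y : x < y ->
  (forall z, x <= z <= y -> der f z (f' z)) ->
  exists2 c, x < c < y & f y - f x = f' c * (y - x).
Proof.
move=> xy fd; have [||c] := @MVT R f f' x y xy.
- by move=> z; rewrite in_itv /= => /andP[/ltW xz /ltW zy]; apply: fd; rewrite xz.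
- by apply: derivable_within_continuous => z; rewrite in_itv /= => /fd[].
- by rewrite in_itv /= => cI E; exists c.
Qed.

Lemma der_ge0 f (f' : R -> R) x y : x <= y ->
  (forall z, x <= z <= y -> der f z (f' z)) -> (forall z, x < z < y -> 0 <= f' z) ->
  f x <= f y.
Proof.
rewrite le_eqVlt => /orP[/eqP->//|xy fd f0]; have [c cI E] := der_mvt xy fd.
by rewrite -subr_ge0 E mulr_ge0 ?f0// subr_ge0 ltW.
Qed.

(** ** Sequences of derivatives *)

Definition dseq a b (F : nat -> R -> R) :=
  forall k x, a < x < b -> der (F k) x (F k.+1 x).

Definition shift (T : Type) (F : nat -> T) k := F k.+1.

Lemma dseq_shift a b F : dseq a b F -> dseq a b (shift F).
Proof. by move=> dF k x xab; apply: dF. Qed.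

Fixpoint leib (u v : nat -> R) k : R :=
  if k is k'.+1 then leib (shift u) v k' + leib u (shift v) k' else u 0%N * v 0%N.

Lemma leibE u v k : leib u v k = \sum_(i < k.+1) 'C(k, i)%:R * u i * v (k - i)%N.
Proof.
elim: k u v => [|k IH] u v; first by rewrite big_ord1 /= mul1r.
rewrite /= !IH [in RHS]big_ord_recl /= subn0 bin0 mul1r.
rewrite [X in _ + X = _]big_ord_recl /= subn0 bin0 mul1r addrCA; congr (_ + _).
rewrite [in RHS](eq_bigr (fun i : 'I_k.+1 =>
   'C(k, i)%:R * u i.+1 * v (k - i)%N + 'C(k, i.+1)%:R * u i.+1 * v (k - i)%N)).
  rewrite big_split /=; congr (_ + _).
  rewrite [in RHS]big_ord_recr /= bin_small// mul0r mul0r addr0.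
  apply: eq_bigr => i _; rewrite /bump leq0n add1n /shift; congr (_ * v _).
  by rewrite subnSK.
move=> i _; rewrite /bump leq0n add1n binS natrD subSS; ring.
Qed.

Definition leibF (F G : nat -> R -> R) k x := leib (F^~ x) (G^~ x) k.

Lemma dseq_leib a b F G : dseq a b F -> dseq a b G -> dseq a b (leibF F G).
Proof.
move=> dF dG k x xab; rewrite /leibF /=; elim: k F G dF dG => [|k IH] F G dF dG /=.
  exact: derM (dF _ _ xab) (dG _ _ xab).
by apply: derD; [apply: (IH (shift F) G)|apply: (IH F (shift G))] => //; apply: dseq_shift.
Qed.

Lemma dseq_uniq a b F G : dseq a b F -> dseq a b G ->
  (forall x, a < x < b -> F 0%N x = G 0%N x) ->
  forall k x, a < x < b -> F k x = G k x.
Proof.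
move=> dF dG FG; elim=> [//|k IH] x xab; apply: der_uniq (dF _ _ xab) _.
by apply: (der_ext xab _ (dG _ _ xab)) => y yab; rewrite IH.
Qed.

Definition seq0 (c : R) k (x : R) := if k is 0 then c else 0.

Lemma dseq_seq0 a b c : dseq a b (seq0 c).
Proof. by case=> [|k] x _; apply: der_cst. Qed.

(** The derivatives of [y] are [C k] times [y], with [C (k+1) = (C k)' + A (C k)]. Each [C k] is
    carried with all its own derivatives, so that the next one can be formed. *)
Lemma dseq_linear a b A (y : R -> R) : dseq a b A ->
  (forall x, a < x < b -> der y x (A 0%N x * y x)) ->
  exists2 G, dseq a b G & G 0%N = y.
Proof.
move=> dA dy.
pose C := fix C k := if k is k'.+1 then
  fun j x => C k' j.+1 x + leibF (C k') A j x else seq0 1.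
have dC k : dseq a b (C k).
  elim: k => [|k IH]; first exact: dseq_seq0.
  move=> j x xab; apply: derD; first exact: (IH j.+1).
  exact: (dseq_leib IH dA).
exists (fun k x => C k 0%N x * y x); last by apply/funext => x; rewrite /= mul1r.
move=> k x xab; apply: derE (derM (dC k 0%N x xab) (dy x xab)).
by rewrite /= /leibF /=; ring.
Qed.

(** The derivatives of [1/F] are [C k / F^(k+1)], with [C (k+1) = (C k)' F - (k+1) (C k) F']. *)
Lemma dseq_inv a b F : dseq a b F -> (forall x, a < x < b -> F 0%N x != 0) ->
  exists2 G, dseq a b G & G 0%N = (fun x => (F 0%N x)^-1).
Proof.
move=> dF F0.
pose C := fix C k := if k is k'.+1 then
  fun j x => leibF (shift (C k')) F j x - k'.+1%:R * leibF (C k') (shift F) j x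
  else seq0 1.
have dC k : dseq a b (C k).
  elim: k => [|k IH]; first exact: dseq_seq0.
  move=> j x xab; apply: derB; first exact: (dseq_leib (dseq_shift IH) dF).
  by apply: derZ; apply: (dseq_leib IH (dseq_shift dF)).
exists (fun k x => C k 0%N x * (F 0%N x)^-1 ^+ k.+1); last first.
  by apply/funext => x; rewrite /= mul1r expr1.
move=> k x xab; have Fx := F0 _ xab.
have dz := der_exprn k (der_inv Fx (dF _ _ xab)).
apply: derE (derM (dC k 0%N x xab) dz).
rewrite /= /leibF /shift /= !exprS; set z := (F 0%N x)^-1.
have Fz : F 0%N x * z = 1 by rewrite divff.
rewrite [X in X + _ = _](_ : _ = C k 1%N x * (F 0%N x * z) * (z * z ^+ k)).
  by ring.
by rewrite Fz mulr1.
Qed.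

(** ** Bounds on derivatives *)

Definition dbound a b (C M : R) (F : nat -> R -> R) := dseq a b F /\
  forall k x, a < x < b -> `|F k x| <= C * M ^+ k * k`!%:R.

Lemma succ_le_exp2 k : k.+1%:R <= 2 ^+ k :> R.
Proof. by rewrite -natrX ler_nat; apply: ltn_expl. Qed.

Lemma dbound_le a b C M C' M' F : 0 <= C -> 0 <= M -> C <= C' -> M <= M' ->
  dbound a b C M F -> dbound a b C' M' F.
Proof.
move=> C0 M0 CC' MM' [dF bF]; split=> // k x xab; apply: le_trans (bF _ _ xab) _.
apply: ler_pM => //; first by rewrite mulr_ge0// exprn_ge0.
apply: ler_pM => //; first exact: exprn_ge0.
by apply: lerXn2r => //; rewrite nnegrE// (le_trans M0).
Qed.

Lemma bin_fact_prod k (i : 'I_k.+1) :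
  'C(k, i)%:R * i`!%:R * (k - i)`!%:R = k`!%:R :> R.
Proof. by rewrite -!natrM -mulnA bin_fact// -ltnS. Qed.

Lemma leib_bound C D M u v k : 0 <= C -> 0 <= D -> 0 <= M ->
  (forall i, (i <= k)%N -> `|u i| <= C * M ^+ i * i`!%:R) ->
  (forall i, (i <= k)%N -> `|v i| <= D * M ^+ i * i`!%:R) ->
  `|leib u v k| <= C * D * M ^+ k * k.+1`!%:R.
Proof.
move=> C0 D0 M0 uB vB; rewrite leibE; apply: le_trans (ler_norm_sum _ _ _) _.
apply: le_trans (_ : \sum_(i < k.+1) C * D * M ^+ k * k`!%:R <= _); last first.
  by rewrite sumr_const card_ord -[leLHS]mulr_natr -mulrA -natrM mulnC -factS.
apply: ler_sum => i _; have ik : (i <= k)%N by rewrite -ltnS.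
have ME : M ^+ k = M ^+ i * M ^+ (k - i) by rewrite -exprD subnKC.
rewrite !normrM normr_nat -(bin_fact_prod i) ME.
have h1 := uB i ik; have h2 := vB (k - i)%N (leq_subr _ _).
apply: le_trans (ler_pM _ _ (ler_wpM2l (ler0n _ _) h1) h2) _ => //.
by rewrite le_eqVlt; apply/orP; left; apply/eqP; ring.
Qed.

(** Real analyticity through Cauchy estimates [C M^k k!], uniform on the open interval; no power
    series are involved. Uniformity up to the endpoint makes [ana 0 d] describe germs analytic at
    [0+]. *)
Definition ana a b f := exists F C M, [/\ 0 <= C, 1 <= M, dbound a b C M F &
  forall x, a < x < b -> F 0%N x = f x].

Lemma ana_sub a b a' b' f : a <= a' -> b' <= b -> ana a b f -> ana a' b' f.
Proof.
move=> aa' bb' [F [C [M [C0 M1 [dF bF] F0]]]].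
have sub x : a' < x < b' -> a < x < b.
  by move=> /andP[ax xb]; rewrite (le_lt_trans aa' ax) (lt_le_trans xb bb').
exists F, C, M; split=> //; last by move=> x /sub/F0.
by split=> [k x /sub|k x /sub]; [exact: dF|exact: bF].
Qed.

Lemma ana_ext a b f g : (forall x, a < x < b -> f x = g x) -> ana a b f -> ana a b g.
Proof.
move=> fg [F [C [M [C0 M1 bF F0]]]]; exists F, C, M; split=> // x xab.
by rewrite F0// fg.
Qed.

Lemma ana_cst a b c : ana a b (fun=> c).
Proof.
exists (seq0 c), `|c|, 1; split=> //; split; first exact: dseq_seq0.
move=> [|k] x _ /=; first by rewrite fact0 !mulr1.
by rewrite normr0 !mulr_ge0// exprn_ge0.
Qed.

Lemma ana_id a b : ana a b (fun x => x).
Proof.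
pose F k (x : R) : R := if k is k'.+1 then seq0 1 k' x else x.
exists F, (`|a| + `|b| + 1), 1; split=> //.
split=> [[|[|k]] x _|k x /andP[ax xb]]; [exact: der_id|exact: der_cst|exact: der_cst|].
rewrite expr1n mulr1; apply: le_trans (_ : `|a| + `|b| + 1 <= _); last first.
  by rewrite ler_peMr ?addr_ge0// ler1n fact_gt0.
have := ler_norm a; have := lerNnormlW (lexx `|a|); have := ler_norm b; have := lerNnormlW (lexx `|b|).
case: k => [|[|k]] /= ? ? ? ?; rewrite ?normr0 ?normr1 ?ler_norml; try (apply/andP; split); lra.
Qed.

Lemma ana_common a b f g : ana a b f -> ana a b g -> exists F G C D M,
  [/\ [/\ 0 <= C, 0 <= D & 1 <= M], dbound a b C M F, dbound a b D M G,
    forall x, a < x < b -> F 0%N x = f x & forall x, a < x < b -> G 0%N x = g x].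
Proof.
move=> [F [C [M [C0 M1 bF F0]]]] [G [D [N [D0 N1 bG G0]]]].
exists F, G, C, D, (M + N); split=> //; first by split=> //; lra.
  by apply: dbound_le bF => //; lra.
by apply: dbound_le bG => //; lra.
Qed.

Lemma ana_add a b f g : ana a b f -> ana a b g -> ana a b (fun x => f x + g x).
Proof.
move=> af ag; have [F [G [C [D [M [[C0 D0 M1] [dF bF] [dG bG] F0 G0]]]]]] :=
  ana_common af ag.
exists (fun k x => F k x + G k x), (C + D), M; split=> //; first exact: addr_ge0.
  split=> k x xab; first exact: derD (dF _ _ xab) (dG _ _ xab).
  by rewrite !mulrDl; apply: le_trans (ler_normD _ _) _; apply: lerD; [exact: bF|exact: bG].
by move=> x xab; rewrite F0// G0.
Qed.

Lemma ana_mul a b f g : ana a b f -> ana a b g -> ana a b (fun x => f x * g x).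
Proof.
move=> af ag; have [F [G [C [D [M [[C0 D0 M1] [dF bF] [dG bG] F0 G0]]]]]] :=
  ana_common af ag.
have M0 : 0 <= M by lra.
(* The Leibniz sum yields [(k+1)!] instead of [k!]; doubling [M] absorbs the factor [k+1 <= 2^k]. *)
exists (leibF F G), (C * D), (2 * M); split=> //; [exact: mulr_ge0|lra| |].
  split=> [|k x xab]; first exact: dseq_leib.
  apply: le_trans (leib_bound C0 D0 M0 (fun i _ => bF i x xab) (fun i _ => bG i x xab)) _.
  rewrite factS natrM exprMn -!mulrA; do 2![apply: ler_wpM2l => //].
  rewrite mulrCA; apply: ler_wpM2r; last exact: succ_le_exp2.
  by rewrite mulr_ge0// exprn_ge0.
by move=> x xab; rewrite /leibF /= F0// G0.
Qed.

Lemma ana_opp a b f : ana a b f -> ana a b (fun x => - f x).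
Proof.
move=> /(ana_mul (ana_cst a b (-1))); apply: ana_ext => x _; exact: mulN1r.
Qed.

Lemma ana_exp a b f : ana a b f -> ana a b (fun x => expR (f x)).
Proof.
move=> [F [C [M [C0 M1 [dF bF] F0]]]]; have M0 : 0 <= M by lra.
have [|G dG G0] := @dseq_linear a b (shift F) (fun x => expR (F 0%N x)) (dseq_shift dF).
  by move=> x xab; apply: der_exp; apply: dF.
have GE k x : a < x < b -> G k.+1 x = leibF (shift F) G k x.
  apply: (dseq_uniq (dseq_shift dG) (dseq_leib (dseq_shift dF) dG)) => y yab.
  apply: der_uniq (dG 0%N y yab) _; rewrite /leibF /= G0.
  by apply: der_exp; apply: dF.
(* The part [2 M] absorbs the factor [i+1] that comes from differentiating [F] once; the part [C M]
   closes the induction on [G' = F' G]. *)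
pose L := 2 * M + C * M.
have CM : 0 <= C * M by rewrite mulr_ge0.
have L0 : 0 <= L by rewrite /L; lra.
exists G, (expR C), L; split; [exact: expR_ge0|rewrite /L; lra| |].
  split=> // k x xab; elim/ltn_ind: k => -[_|k IH].
    rewrite G0 expr0 fact0 !mulr1 ger0_norm ?expR_ge0// ler_expR.
    by have := bF 0%N x xab; rewrite expr0 fact0 !mulr1; apply: le_trans; exact: ler_norm.
  rewrite GE//; apply: le_trans (leib_bound (C := C * M) CM (expR_ge0 C) L0 _ _) _.
  - move=> i _; apply: le_trans (bF i.+1 x xab) _.
    rewrite exprS factS natrM -!mulrA; do 2![apply: ler_wpM2l => //].
    rewrite mulrCA mulrA; apply: ler_wpM2r => //.
    apply: le_trans (_ : 2 ^+ i * M ^+ i <= _).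
      by apply: ler_wpM2r; rewrite ?exprn_ge0// succ_le_exp2.
    by rewrite -exprMn; apply: lerXn2r; rewrite ?nnegrE ?mulr_ge0// /L; lra.
  - by move=> i ik; apply: IH.
  - apply: ler_wpM2r => //; rewrite [C * M * _]mulrC -mulrA; apply: ler_wpM2l.
      exact: expR_ge0.
    by rewrite exprS; apply: ler_wpM2r; rewrite ?exprn_ge0// /L; lra.
by move=> x xab; rewrite G0 F0.
Qed.

Lemma geo2 n : \sum_(i < n) 2^-1 ^+ i <= 2 :> R.
Proof.
have -> : \sum_(i < n) 2^-1 ^+ i = 2 - 2 * 2^-1 ^+ n :> R.
  elim: n => [|n IH]; first by rewrite big_ord0 expr0; lra.
  by rewrite big_ord_recr /= IH exprS; lra.
by have : 0 <= 2^-1 ^+ n :> R by [exact: exprn_ge0]; lra.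
Qed.

(** Leibniz's rule for [F Z = 1] expresses each derivative of [Z] by lower ones. For the new
    constant [L], [M/L <= 1/2] bounds the terms by a geometric series of sum at most 2, and the part
    [2 C M / eta] closes the induction. *)
Lemma dbound_inv a b C M eta F : 0 <= C -> 1 <= M -> 0 < eta -> dbound a b C M F ->
  (forall x, a < x < b -> eta <= F 0%N x) ->
  exists2 Z, dbound a b eta^-1 (2 * M + 2 * C * M / eta) Z &
    Z 0%N = (fun x => (F 0%N x)^-1).
Proof.
move=> C0 M1 eta0 [dF bF] Feta; have M0 : 0 <= M by lra.
have F_gt0 x : a < x < b -> 0 < F 0%N x by move=> /Feta; apply: lt_le_trans.
have [|Z dZ Z0] := dseq_inv dF; first by move=> x /F_gt0/lt0r_neq0.
exists Z => //; split=> // k x xab; set L := 2 * M + _.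
have CMe : 0 <= 2 * C * M / eta by rewrite divr_ge0 ?mulr_ge0// ltW.
have L2M : 2 * M <= L by rewrite /L; lra.
have L0 : 0 <= L by lra.
have e0 : 0 <= eta^-1 by rewrite invr_ge0 ltW.
elim/ltn_ind: k => -[_|k IH].
  rewrite Z0 expr0 fact0 !mulr1 ger0_norm ?invr_ge0 ?(ltW (F_gt0 _ xab))//.
  by rewrite lef_pV2 ?posrE ?F_gt0// Feta.
have leib0 : leibF F Z k.+1 x = 0.
  rewrite (dseq_uniq (dseq_leib dF dZ) (@dseq_seq0 a b 1) _ k.+1 xab)// => y yab.
  by rewrite /leibF /= Z0 divff// lt0r_neq0 ?F_gt0.
move: leib0; rewrite /leibF leibE big_ord_recl bin0 mul1r subn0 => /eqP.
rewrite addr_eq0 => /eqP FZ.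
rewrite -(ler_pM2l (F_gt0 _ xab)) -{1}(gtr0_norm (F_gt0 _ xab)) -normrM FZ normrN.
apply: le_trans (ler_norm_sum _ _ _) _.
apply: le_trans (_ : \sum_(i < k.+1)
   (C * M * eta^-1 * L ^+ k * k.+1`!%:R) * 2^-1 ^+ i <= _).
  apply: ler_sum => i _; rewrite /= /bump leq0n add1n subSS.
  have ik : (i <= k)%N by rewrite -ltnS.
  have i1 : (i.+1 < k.+2)%N by [].
  have := bin_fact_prod (Ordinal i1); rewrite /= subSS => <-.
  rewrite !normrM normr_nat.
  have h1 := bF i.+1 x xab; have h2 := IH (k - i)%N (leq_ltn_trans (leq_subr _ _) (ltnSn k)).
  apply: le_trans (ler_pM _ _ (ler_wpM2l (ler0n _ _) h1) h2) _; rewrite ?mulr_ge0//.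
  have -> : L ^+ k = L ^+ i * L ^+ (k - i) by rewrite -exprD subnKC.
  have ML : M ^+ i <= L ^+ i * 2^-1 ^+ i.
    rewrite -exprMn; apply: lerXn2r; rewrite ?nnegrE ?mulr_ge0//; lra.
  rewrite exprS; set B := 'C(_, _)%:R; set f1 := i.+1`!%:R; set f2 := (k - i)`!%:R.
  rewrite [leLHS](_ : _ = (B * f1 * f2 * C * M * eta^-1 * L ^+ (k - i)) * M ^+ i); last by ring.
  rewrite [leRHS](_ : _ = (B * f1 * f2 * C * M * eta^-1 * L ^+ (k - i)) *
    (L ^+ i * 2^-1 ^+ i)); last by ring.
  by apply: ler_wpM2l => //; rewrite !mulr_ge0// exprn_ge0.
rewrite -mulr_sumr.
apply: le_trans (_ : C * M * eta^-1 * L ^+ k * k.+1`!%:R * 2 <= _).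
  by apply: ler_wpM2l (geo2 _); rewrite !mulr_ge0// exprn_ge0.
apply: le_trans (_ : eta * (eta^-1 * L ^+ k.+1 * k.+1`!%:R) <= _); last first.
  by apply: ler_wpM2r (Feta _ xab); rewrite !mulr_ge0// exprn_ge0.
rewrite [leLHS](_ : _ = (L ^+ k * k.+1`!%:R) * (2 * C * M / eta)); last by ring.
rewrite [leRHS](_ : _ = (L ^+ k * k.+1`!%:R) * L); last first.
  by rewrite exprS; field; exact: lt0r_neq0.
by apply: ler_wpM2l; rewrite ?mulr_ge0 ?exprn_ge0// /L; lra.
Qed.

Lemma ana_ln a b f eta : 0 < eta -> (forall x, a < x < b -> eta <= f x) ->
  ana a b f -> ana a b (fun x => ln (f x)).
Proof.
move=> eta0 feta [F [C [M [C0 M1 bF F0]]]]; have M0 : 0 <= M by lra.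
have Feta x : a < x < b -> eta <= F 0%N x by move=> xab; rewrite F0// feta.
have F_gt0 x : a < x < b -> 0 < F 0%N x by move=> /Feta; apply: lt_le_trans.
have [Z [dZ bZ] Z0] := dbound_inv C0 M1 eta0 bF Feta.
case: bF => dF bF; move: bZ; set L := 2 * M + _ => bZ.
have e0 : 0 <= eta^-1 by rewrite invr_ge0 ltW.
have CMe : 0 <= 2 * C * M / eta by rewrite !mulr_ge0.
have L0 : 0 <= L by rewrite /L; lra.
have L1 : 1 <= L by rewrite /L; lra.
have CM : 0 <= C * M by rewrite mulr_ge0.
pose Y k x := if k is k'.+1 then leibF (shift F) Z k' x else ln (F 0%N x).
pose D := `|ln eta| + `|ln C|.
exists Y, (D + C * M * eta^-1), L; split=> //.
- by rewrite !addr_ge0// mulr_ge0.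
- split=> [[|k] x xab|[|k] x xab].
  + apply: derE (der_ln (F_gt0 _ xab) (dF _ _ xab)).
    by rewrite /Y /leibF /= Z0.
  + exact: (dseq_leib (dseq_shift dF) dZ).
  + rewrite /Y expr0 fact0 !mulr1; have Fe := Feta _ xab; have Fp := F_gt0 _ xab.
    have FC : F 0%N x <= C.
      by have := bF 0%N x xab; rewrite expr0 fact0 !mulr1; apply: le_trans; exact: ler_norm.
    have l1 : ln eta <= ln (F 0%N x) by rewrite ler_ln.
    have l2 : ln (F 0%N x) <= ln C by rewrite ler_ln ?posrE//; exact: lt_le_trans FC.
    have := ler_norm (ln C); have := lerNnormlW (lexx `|ln eta|).
    have : 0 <= C * M * eta^-1 by rewrite mulr_ge0.
    have := normr_ge0 (ln C); have := normr_ge0 (ln eta).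
    by rewrite /D ler_norml; move=> *; apply/andP; split; lra.
  + rewrite /Y; apply: le_trans (leib_bound (C := C * M) (D := eta^-1) CM e0 L0 _ _) _.
    * move=> i _; apply: le_trans (bF i.+1 x xab) _.
      rewrite exprS factS natrM -!mulrA; do 2![apply: ler_wpM2l => //].
      rewrite mulrCA mulrA; apply: ler_wpM2r => //.
      apply: le_trans (_ : 2 ^+ i * M ^+ i <= _).
        by apply: ler_wpM2r; rewrite ?exprn_ge0// succ_le_exp2.
      by rewrite -exprMn; apply: lerXn2r; rewrite ?nnegrE ?mulr_ge0// /L; lra.
    * by move=> i _; apply: bZ.
    * apply: ler_wpM2r => //; apply: ler_pM; rewrite ?mulr_ge0 ?exprn_ge0//.
        by rewrite lerDr /D addr_ge0.
      by rewrite exprS ler_peMl// exprn_ge0.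
- by move=> x xab; rewrite /Y F0.
Qed.

(** ** Taylor expansions and the identity theorem *)

Definition tpoly (c : nat -> R) s n x := \sum_(k < n) c k / k`!%:R * (x - s) ^+ k.

Lemma der_tpoly c s n x : der (tpoly c s n.+1) x (tpoly (shift c) s n x).
Proof.
elim: n => [|n IH].
  have -> : tpoly c s 1 = (fun=> c 0%N / 0`!%:R * 1).
    by apply/funext => y; rewrite /tpoly big_ord1 expr0.
  by rewrite /tpoly big_ord0; apply: der_cst.
have -> : tpoly c s n.+2 =
    (fun y => tpoly c s n.+1 y + c n.+1 / n.+1`!%:R * (y - s) ^+ n.+1).
  by apply/funext => y; rewrite /tpoly big_ord_recr.
rewrite /tpoly big_ord_recr -/(tpoly _ _ _ _) /=; apply: derD => //.
have h := der_exprn n (derB (der_id x) (der_cst s x)).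
apply: derE (derZ (c n.+1 / n.+1`!%:R) h).
have f0 : n`!%:R != 0 :> R by rewrite pnatr_eq0 -lt0n fact_gt0.
have n0 : n.+1%:R != 0 :> R by rewrite pnatr_eq0.
rewrite /shift factS natrM subr0 mulr1; move: f0 n0; move: n`!%:R n.+1%:R => u v u0 v0.
by field; rewrite u0.
Qed.

(** The Taylor error of order [n+1] has as derivative the error of [F'] of order [n]. Adding it to,
    or subtracting it from, [c |x - s|^(n+1)] gives monotone functions on each side of [s]. *)
Lemma taylor_bound a b F B n s t : dseq a b F -> 0 <= B ->
  (forall x, a < x < b -> `|F n x| <= B) -> a < s < b -> a < t < b ->
  `|F 0%N t - tpoly (F^~ s) s n t| <= B / n`!%:R * `|t - s| ^+ n.
Proof.
move=> + B0; elim: n F t => [|n IH] F t dF bF sab tab.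
  by rewrite /tpoly big_ord0 subr0 fact0 divr1 expr0 mulr1 bF.
pose G x := F 0%N x - tpoly (F^~ s) s n.+1 x.
have dG x : a < x < b -> der G x (F 1%N x - tpoly ((shift F)^~ s) s n x).
  by move=> xab; apply: derB; [exact: dF|exact: der_tpoly].
have bG x : a < x < b -> `|F 1%N x - tpoly ((shift F)^~ s) s n x| <=
    B / n`!%:R * `|x - s| ^+ n.
  by move=> xab; apply: (IH (shift F)) => //; exact: dseq_shift.
have Gs : G s = 0.
  rewrite /G /tpoly big_ord_recl expr0 fact0 divr1 mulr1 big1 ?addr0 ?subrr// => i _.
  by rewrite expr0n mulr0.
have f0 : 0 < n`!%:R :> R by rewrite ltr0n fact_gt0.
have n0 : 0 < n.+1%:R :> R by [].
rewrite -/(G t); case/andP: (sab) => as_ sb; case/andP: (tab) => at_ tb.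
pose c := B / n.+1`!%:R.
have cE : n.+1%:R * c = B / n`!%:R.
  rewrite /c factS natrM; move: f0 n0; move: n`!%:R n.+1%:R => u v u0 v0.
  by field; rewrite !lt0r_neq0.
have [st|ts] := leP s t.
  have inab z : s <= z <= t -> a < z < b by lra.
  have dH z : der (fun x => c * (x - s) ^+ n.+1) z (B / n`!%:R * (z - s) ^+ n).
    apply: derE (derZ c (der_exprn n (derB (der_id z) (der_cst s z)))).
    by rewrite subr0 mulr1 mulrA [c * _]mulrC cE.
  have bz z : s < z < t -> - (B / n`!%:R * (z - s) ^+ n) <=
      F 1%N z - tpoly ((shift F)^~ s) s n z <= B / n`!%:R * (z - s) ^+ n.
    move=> zst; have := @bG z ltac:(apply: inab; lra).
    by rewrite ler_norml (@ger0_norm _ (z - s)); last by lra.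
  have h1 := @der_ge0 _ _ s t st (fun z zI => derB (dH z) (dG z (inab z zI))).
  have h2 := @der_ge0 _ _ s t st (fun z zI => derD (dH z) (dG z (inab z zI))).
  have {}h1 := h1 (fun z zI => ltac:(have := bz z zI; lra)).
  have {}h2 := h2 (fun z zI => ltac:(have := bz z zI; lra)).
  move: h1 h2; rewrite Gs subrr expr0n mulr0 (@ger0_norm _ (t - s)); last by lra.
  by rewrite /= -/c ler_norml => h1 h2; apply/andP; split; lra.
have st := ltW ts.
have inab z : t <= z <= s -> a < z < b by lra.
have dH z : der (fun x => c * (s - x) ^+ n.+1) z (- (B / n`!%:R * (s - z) ^+ n)).
  apply: derE (derZ c (der_exprn n (derB (der_cst s z) (der_id z)))).
  by rewrite sub0r mulrN1 mulNr mulrN mulrA [c * _]mulrC cE.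
have bz z : t < z < s -> - (B / n`!%:R * (s - z) ^+ n) <=
    F 1%N z - tpoly ((shift F)^~ s) s n z <= B / n`!%:R * (s - z) ^+ n.
  move=> zst; have := @bG z ltac:(apply: inab; lra).
  by rewrite ler_norml (@ler0_norm _ (z - s)) ?opprB//; last by lra.
have h1 := @der_ge0 _ _ t s st (fun z zI => derN (derB (dH z) (dG z (inab z zI)))).
have h2 := @der_ge0 _ _ t s st (fun z zI => derN (derD (dH z) (dG z (inab z zI)))).
have {}h1 := h1 (fun z zI => ltac:(have := bz z zI; lra)).
have {}h2 := h2 (fun z zI => ltac:(have := bz z zI; lra)).
move: h1 h2; rewrite Gs subrr expr0n mulr0 (@ler0_norm _ (t - s)); last by lra.
by rewrite /= -/c (opprB t s) ler_norml => h1 h2; apply/andP; split; lra.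
Qed.

Lemma taylor_dbound a b C M F n s t : 0 <= C -> 0 <= M -> dbound a b C M F ->
  a < s < b -> a < t < b ->
  `|F 0%N t - tpoly (F^~ s) s n t| <= C * (M * `|t - s|) ^+ n.
Proof.
move=> C0 M0 [dF bF] sab tab.
have B0 : 0 <= C * M ^+ n * n`!%:R by rewrite !mulr_ge0// exprn_ge0.
apply: le_trans (taylor_bound dF B0 (fun x => bF n x) sab tab) _.
by rewrite mulfK ?pnatr_eq0 -?lt0n ?fact_gt0// exprMn mulrA.
Qed.

Lemma small_powers (x C : R) : 0 <= C -> (forall n, x <= C * 2^-1 ^+ n) -> x <= 0.
Proof.
move=> C0 h; rewrite leNgt; apply/negP => x0.
have [N CN] : exists N : nat, C / x < N%:R.
  by exists (Num.bound (C / x)); apply: archi_boundP; rewrite divr_ge0// ltW.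
have := h N; apply/negP; rewrite -ltNge.
have h2 : (N%:R : R) <= 2 ^+ N by rewrite -natrX ler_nat ltnW// ltn_expl.
rewrite exprVn ltr_pdivrMr ?exprn_gt0// mulrC -ltr_pdivrMr//.
exact: lt_le_trans h2.
Qed.

(** [s] is the infimum of the points beyond which [f] vanishes. All derivatives are zero at [s'],
    just right of [s], and the Cauchy estimates carry the vanishing to the left of [s], against its
    choice. *)
Lemma ana_identity f : (forall c, 0 < c -> exists a b, a < c < b /\ ana a b f) ->
  (exists m, forall x, m < x -> f x = 0) -> forall x, 0 < x -> f x = 0.
Proof.
move=> af [m fm] x0 x00; apply: contrapT => fx0.
pose S := [set y | 0 < y /\ forall x, y < x -> f x = 0].
have Slb : lbound S x0.
  by move=> y [y0 fy]; rewrite leNgt; apply/negP => /fy.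
have Sinf : has_inf S.
  split; last by exists x0.
  exists (Num.max m 1); split; first by rewrite lt_max ltr01 orbT.
  by move=> x; rewrite gt_max => /andP[/fm].
pose s := inf S.
have x0s : x0 <= s by apply: lb_le_inf => //; case: Sinf.
have s0 : 0 < s by apply: lt_le_trans x0s.
have fs x : s < x -> f x = 0.
  rewrite -subr_gt0 => /inf_adherent/(_ Sinf)[y [y0 Fy]].
  by rewrite -/s addrC subrK; apply: Fy.
have [a [b [/andP[as_ sb] [F [C [M [C0 M1 bF F0]]]]]]] := af _ s0.
have M0 : 0 < M by lra.
(* Points within [1/(4 M)] to the left of [s] are within [1/(2 M)] of [s + d], so each Taylor order
   gains a factor 1/2. The division by 2 keeps [s + d] strictly inside the interval. *)
pose d := Num.min (b - s) (4 * M)^-1 / 2.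
have d0 : 0 < d by rewrite divr_gt0// lt_min subr_gt0 sb invr_gt0 mulr_gt0.
have d1 : d < b - s.
  have : Num.min (b - s) (4 * M)^-1 <= b - s by rewrite ge_min lexx.
  by move: d0; rewrite /d; lra.
have d2 : d <= (4 * M)^-1.
  have : Num.min (b - s) (4 * M)^-1 <= (4 * M)^-1 by rewrite ge_min lexx orbT.
  by move: d0; rewrite /d; lra.
pose s' := s + d.
have s'ab : a < s' < b by rewrite /s'; apply/andP; split; lra.
have Fs' k : F k s' = 0.
  have dsb : dseq s b F by move=> j x /andP[sx xb]; apply: (proj1 bF); rewrite xb andbT; lra.
  rewrite (dseq_uniq dsb (@dseq_seq0 s b 0) _ k (x := s')); first by case: k.
    by move=> x /andP[sx xb]; rewrite F0 ?fs//; apply/andP; split; lra.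
  by rewrite /s'; apply/andP; split; lra.
have M4 : M * (4 * M)^-1 = 4^-1 by field; exact: lt0r_neq0.
have fz t : a < t -> s - (4 * M)^-1 < t -> t <= s -> f t = 0.
  move=> at_ st ts; have tab : a < t < b by apply/andP; split; lra.
  apply/eqP; rewrite -normr_le0; apply: (@small_powers _ C) => // n.
  have := taylor_dbound n C0 (ltW M0) bF s'ab tab.
  have -> : tpoly (F^~ s') s' n t = 0.
    by rewrite /tpoly big1// => i _; rewrite Fs' mul0r mul0r.
  rewrite subr0 F0// => h; apply: le_trans h _; apply: ler_wpM2l => //.
  apply: lerXn2r; rewrite ?nnegrE ?mulr_ge0 ?(ltW M0)//.
  have : `|t - s'| <= 2 * (4 * M)^-1 by rewrite /s' ler_norml; apply/andP; split; lra.
  by move=> /(ler_wpM2l (ltW M0)); rewrite mulrCA M4; lra.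
pose y := Num.max (Num.max a (s - (4 * M)^-1)) (s / 2).
have ys : y < s.
  have : 0 < (4 * M)^-1 by rewrite invr_gt0 mulr_gt0.
  by rewrite /y !gt_max as_ => ?; apply/andP; split; [apply/andP; split=> //; lra|lra].
have : s <= y.
  apply: ge_inf; first by exists x0.
  split; first by rewrite lt_max; apply/orP; right; lra.
  move=> x; rewrite !gt_max => /andP[/andP[ax sx] _].
  by have [xs|/fs//] := leP x s; apply: fz.
by rewrite leNgt ys.
Qed.

End Derivatives.

(** ** Analytic germs at [0+] *)

Section Germs.
Variable R : realType.
Implicit Types (f g : R -> R) (a b x y l m s t B C D M d eta : R).

Lemma der_cont f x l e : der f x l -> 0 < e ->
  exists2 d, 0 < d & forall y, `|y - x| < d -> `|f y - f x| < e.
Proof.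
move=> [df _] e0; have cf : {for x, continuous f}.
  by apply: differentiable_continuous; exact/derivable1_diffP.
have /cvgrPdist_lt/(_ e e0) := cf; rewrite -nbhs_nearE => -[d /= d0 dP].
exists d => // y yx; rewrite distrC; apply: dP; by rewrite /= distrC.
Qed.

(** [F 0] is Lipschitz with constant [C M], so it has a limit at [0+], obtained here directly as the
    supremum of [F 0 t - C M t]. *)
Lemma dbound_limit d C M F : 0 < d -> 0 <= C -> 0 <= M -> dbound 0 d C M F ->
  exists r, forall t, 0 < t < d -> `|F 0%N t - r| <= C * M * t.
Proof.
move=> d0 C0 M0 bF; have CM : 0 <= C * M by rewrite mulr_ge0.
have lip s t : 0 < s < d -> 0 < t < d -> F 0%N t - C * M * t <= F 0%N s + C * M * s.
  move=> sd td; have := taylor_dbound 1 C0 M0 bF sd td.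
  rewrite /tpoly big_ord1 fact0 divr1 expr0 mulr1 expr1 mulrA => h.
  have ts : `|t - s| <= t + s by rewrite ler_norml; apply/andP; split; lra.
  have := ler_wpM2l CM ts; rewrite mulrDr => h2.
  by have := ler_norm (F 0%N t - F 0%N s); lra.
pose S := [set F 0%N t - C * M * t | t in [set t | 0 < t < d]].
have d2 : 0 < d / 2 < d by lra.
have S0 : S !=set0 by exists (F 0%N (d / 2) - C * M * (d / 2)), (d / 2).
exists (sup S) => t td.
have h1 : sup S <= F 0%N t + C * M * t.
  by apply: ge_sup => // _ [s sd <-]; apply: lip.
have h2 : F 0%N t - C * M * t <= sup S.
  apply: ub_le_sup; last by exists t.
  by exists (F 0%N t + C * M * t) => _ [s sd <-]; apply: lip.
by rewrite ler_norml; apply/andP; split; lra.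
Qed.

(* The [k]-th derivative of [(F 0 - r) / t] is, up to the factor [k! / t^(k+1)],
   the error at [0] of the Taylor polynomial of [F 0] at [t]. *)
Lemma dbound_div d C M F : 0 < d -> 0 <= C -> 0 <= M -> dbound 0 d C M F ->
  exists r H, dbound 0 d (C * M) M H /\ forall t, 0 < t < d -> F 0%N t = r + t * H 0%N t.
Proof.
move=> d0 C0 M0 bF; have [r rP] := dbound_limit d0 C0 M0 bF.
have [dF _] := bF.
pose S k t := tpoly (F^~ t) t k.+1 0.
(* Taylor's bound between [t] and a point [u], in the limit where [u] tends to 0. *)
have Sb k t : 0 < t < d -> `|S k t - r| <= C * (M * t) ^+ k.+1.
  move=> td; apply/ler_addgt0Pr => e e0.
  have e2 : 0 < e / 2 by lra.
  have [q q0 qP] := der_cont (der_tpoly (F^~ t) t k 0) e2.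
  have [q' q'0 q'P] : exists2 q', 0 < q' & C * M * q' <= e / 2.
    have CM1 : 0 < C * M + 1 by have := mulr_ge0 C0 M0; lra.
    exists (e / 2 / (C * M + 1)); first by rewrite divr_gt0.
    rewrite mulrCA ler_piMr ?(ltW e2)// ler_pdivrMr//; lra.
  pose u := Num.min (Num.min q q') t / 2.
  have m0 : 0 < Num.min (Num.min q q') t by rewrite !lt_min q0 q'0; lra.
  have u0 : 0 < u by rewrite /u; lra.
  have um : u <= Num.min (Num.min q q') t by rewrite /u; lra.
  have ut : u <= t by apply: le_trans um _; rewrite ge_min lexx orbT.
  have uq' : u <= q' by apply: le_trans um _; rewrite !ge_min lexx orbT.
  have uq : u < q.
    have : Num.min (Num.min q q') t <= q by rewrite !ge_min lexx.
    by rewrite /u; lra.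
  have ud : 0 < u < d by lra.
  have h1 := rP _ ud.
  have h2 : C * M * u <= e / 2.
    by apply: le_trans q'P; apply: ler_wpM2l; rewrite ?mulr_ge0.
  have h3 : `|tpoly (F^~ t) t k.+1 u - S k t| < e / 2.
    by apply: qP; rewrite subr0 gtr0_norm.
  have h4 := taylor_dbound k.+1 C0 M0 bF td ud.
  have h5 : C * (M * `|u - t|) ^+ k.+1 <= C * (M * t) ^+ k.+1.
    apply: ler_wpM2l => //; apply: lerXn2r; rewrite ?nnegrE ?mulr_ge0//; first by lra.
    by apply: ler_wpM2l => //; rewrite ler_norml; apply/andP; split; lra.
  move: h1 h3 h4; set A := C * (M * t) ^+ _ in h5 *; rewrite !ler_norml ltr_norml.
  move=> /andP[? ?] /andP[? ?] /andP[? ?]; apply/andP; split; lra.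
have Sder k t : 0 < t < d -> der (S k) t (F k.+1 t * (- t) ^+ k / k`!%:R).
  move=> td; elim: k => [|k IH].
    have -> : S 0%N = F 0%N.
      by apply/funext => u; rewrite /S /tpoly big_ord1 expr0 fact0 divr1 mulr1.
    by apply: derE (dF 0%N t td); rewrite expr0 fact0 mulr1 divr1.
  have -> : S k.+1 = (fun u => S k u + F k.+1 u * ((k.+1`!%:R)^-1 * (- u) ^+ k.+1)).
    by apply/funext => u; rewrite /S /tpoly big_ord_recr /= sub0r mulrA.
  have h := derZ (k.+1`!%:R)^-1 (der_exprn k (derN (der_id t))).
  apply: derE (derD IH (derM (dF _ _ td) h)).
  have f0 : k`!%:R != 0 :> R by rewrite pnatr_eq0 -lt0n fact_gt0.
  have n0 : k.+1%:R != 0 :> R by rewrite pnatr_eq0.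
  rewrite factS natrM exprS; move: f0 n0; move: (k`!%:R) (k.+1%:R) => p q p0 q0.
  by field; rewrite p0.
pose H k t := (-1) ^+ k * k`!%:R * (t^-1 ^+ k.+1 * (S k t - r)).
exists r, H; split; last first.
  move=> t td; rewrite /H /S /tpoly big_ord1 !expr0 fact0 divr1 !mulr1 expr1 mul1r.
  by field; rewrite lt0r_neq0//; lra.
split=> k t td; have t0 : 0 < t by lra.
  have t0' := lt0r_neq0 t0.
  have h := derM (der_exprn k (@der_inv _ (fun u => u) t 1 t0' (der_id t))) (derB (Sder k t td) (der_cst r t)).
  apply: derE (derZ ((-1) ^+ k * k`!%:R) h).
  have f0 : k`!%:R != 0 :> R by rewrite pnatr_eq0 -lt0n fact_gt0.
  have n0 : k.+1%:R != 0 :> R by rewrite pnatr_eq0.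
  have SE : S k.+1 t = S k t + F k.+1 t / k.+1`!%:R * (- t) ^+ k.+1.
    by rewrite /S {1}/tpoly big_ord_recr /=; congr (_ + _); rewrite sub0r.
  rewrite /H SE factS natrM !exprS [(- t) ^+ k]exprNn.
  have tk : t^-1 ^+ k * t ^+ k = 1 by rewrite -exprMn mulVf ?expr1n.
  have m1 : (-1) ^+ k * (-1) ^+ k = 1 :> R by rewrite -exprMn mulrNN mulr1 expr1n.
  move: f0 n0 m1 tk; move: (k`!%:R) (k.+1%:R) ((-1) ^+ k) (t^-1 ^+ k) (t ^+ k) (S k t) (F k.+1 t).
  move=> p q e i j S0 F0 p0 q0 ee ij.
  have -> : i = j^-1.
    have j0 : j != 0 by apply/eqP => j0; move: ij; rewrite j0 mulr0 => /eqP; rewrite eq_sym oner_eq0.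
    by rewrite -[i]mulr1 -(divff j0) mulrA ij mul1r.
  have j0 : j != 0 by apply/eqP => j0; move: ij; rewrite j0 mulr0 => /eqP; rewrite eq_sym oner_eq0.
  by field; rewrite ?p0 ?q0 ?t0' ?j0.
rewrite /H !normrM normrX normrN1 expr1n mul1r normr_nat normrX normfV (gtr0_norm t0).
rewrite mulrC; apply: ler_wpM2r => //.
apply: le_trans (ler_wpM2l _ (Sb k t td)) _; first by rewrite exprn_ge0// invr_ge0 ltW.
rewrite mulrCA -exprMn mulrCA mulVf ?lt0r_neq0// mulr1 exprS; lra.
Qed.

Lemma ana_div0 d g : 0 < d -> ana 0 d g ->
  exists r h, ana 0 d h /\ forall t, 0 < t < d -> g t = r + t * h t.
Proof.
move=> d0 [F [C [M [C0 M1 bF F0]]]]; have M0 : 0 <= M by lra.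
have [r [H [bH HE]]] := dbound_div d0 C0 M0 bF.
exists r, (H 0%N); split; last by move=> t td; rewrite -F0// HE.
by exists H, (C * M), M; split=> //; rewrite mulr_ge0.
Qed.

(** Division by [t] is repeated while the constant term vanishes. As [dbound_div] keeps [M], the
    bounds share one [M] for all [k], and a function of infinite order vanishes for
    [t < 1/(2 M)]. *)
Lemma dbound_order d k C M F : 0 < d -> 0 <= C -> 1 <= M -> dbound 0 d C M F ->
  (exists j r h, [/\ r != 0, ana 0 d h &
     forall t, 0 < t < d -> F 0%N t = t ^+ j * (r + t * h t)]) \/
  (forall t, 0 < t < d -> `|F 0%N t| <= C * (M * t) ^+ k).
Proof.
move=> d0 + M1; have M0 : 0 <= M by lra.
elim: k C F => [|k IH] C F C0 bF.
  by right=> t td; have := (proj2 bF) 0%N t td; rewrite !expr0 fact0 !mulr1.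
have [r [H [bH HE]]] := dbound_div d0 C0 M0 bF.
have CM : 0 <= C * M by rewrite mulr_ge0.
have [r0|r0] := eqVneq r 0; last first.
  left; exists 0%N, r, (H 0%N); split=> // [|t td]; last by rewrite expr0 mul1r HE.
  by exists H, (C * M), M.
have [[j [s [h [s0 ah hE]]]]|Hk] := IH _ _ CM bH; [left|right].
  exists j.+1, s, h; split=> // t td.
  by rewrite HE// r0 add0r hE// exprS mulrA.
move=> t td; rewrite HE// r0 add0r normrM gtr0_norm; last by lra.
apply: le_trans (ler_wpM2l _ (Hk t td)) _; first by lra.
by rewrite exprS; lra.
Qed.

Lemma ana_order0 d g : 0 < d -> ana 0 d g ->
  (exists2 e, 0 < e & forall t, 0 < t < e -> g t = 0) \/
  exists j r h, [/\ r != 0, ana 0 d h &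
     forall t, 0 < t < d -> g t = t ^+ j * (r + t * h t)].
Proof.
move=> d0 [F [C [M [C0 M1 bF F0]]]]; have M0 : 0 < M by lra.
have [h|nh] := pselect (exists j r h, [/\ r != 0, ana 0 d h &
     forall t, 0 < t < d -> g t = t ^+ j * (r + t * h t)]); [by right|left].
have FC k t : 0 < t < d -> `|g t| <= C * (M * t) ^+ k.
  have [[j [r [h [r0 ah hE]]]]|//] := dbound_order k d0 C0 M1 bF.
    by case: nh; exists j, r, h; split=> // s sd; rewrite -F0// hE.
  by move=> FC td; rewrite -F0// FC.
have M2 : 0 < (2 * M)^-1 by rewrite invr_gt0; lra.
exists (Num.min d (2 * M)^-1); first by rewrite lt_min d0.
move=> t /andP[t0]; rewrite lt_min => /andP[td tM].
apply/eqP; rewrite -normr_le0; apply: (@small_powers _ _ C) => // k.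
apply: le_trans (FC k t _) _; first by rewrite t0.
apply: ler_wpM2l => //; apply: lerXn2r; rewrite ?nnegrE ?mulr_ge0 ?ltW//; try lra.
rewrite (_ : 2^-1 = M * (2 * M)^-1); last by field; exact: lt0r_neq0.
by rewrite ltr_pM2l.
Qed.

Lemma ana_bounded a b g : ana a b g ->
  exists N : nat, forall t, a < t < b -> `|g t| <= N%:R.
Proof.
move=> [F [C [M [C0 M1 [_ bF] F0]]]]; exists (Num.bound C) => t td.
rewrite -F0//; apply: le_trans (bF 0%N t td) _; rewrite expr0 fact0 !mulr1.
by apply: ltW; apply: archi_boundP.
Qed.

(** Points with [g >= 1] are required only arbitrarily close to 0, which is all that an inequality
    along the ultrafilter provides. The limit at [0+] turns this into [g >= 1/2] on an interval. *)
Lemma ana_ln0 d g : 0 < d -> ana 0 d g ->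
  (forall e, 0 < e -> exists2 t, 0 < t < e & 1 <= g t) ->
  exists2 e, 0 < e & ana 0 e (fun t => ln (g t)).
Proof.
move=> d0 ag g1; have [r [h [ah gE]]] := ana_div0 d0 ag.
have [N hN] := ana_bounded ah.
pose e := Num.min d (8 * N.+1%:R)^-1.
have N0 : 0 < N.+1%:R :> R by [].
have q0 : 0 < (8 * N.+1%:R)^-1 :> R by rewrite invr_gt0; lra.
have e0 : 0 < e by rewrite lt_min d0.
have ed : e <= d by rewrite ge_min lexx.
have th t : 0 < t < e -> `|t * h t| <= 8^-1.
  move=> te; rewrite normrM gtr0_norm; last by lra.
  rewrite (_ : 8^-1 = (8 * N.+1%:R)^-1 * N.+1%:R :> R); last first.
    by field; exact: lt0r_neq0.
  apply: ler_pM => //; first by lra.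
    have e8 : e <= (8 * N.+1%:R)^-1 by rewrite ge_min lexx orbT.
    by case/andP: te => _ /ltW te; exact: le_trans te e8.
  by apply: le_trans (hN t _) _; [lra|rewrite ler_nat].
exists e => //; apply: (@ana_ln _ _ _ _ 2^-1) => //; last exact: ana_sub ag.
have [s se gs] := g1 _ e0.
move=> t te; rewrite gE; last by lra.
have := th _ te; have := th _ se; move: gs; rewrite gE; last by lra.
rewrite !ler_norml => ? /andP[? ?] /andP[? ?]; lra.
Qed.

Lemma ana_taylor0 f n : ana (- (3 / 4)) (3 / 4) f ->
  exists (c : nat -> R) (C : nat), forall t, `|t| <= 2^-1 ->
    `|f t - \sum_(i < n) c i * t ^+ i| <= C%:R * `|t| ^+ n.
Proof.
move=> [F [C [M [C0 M1 bF F0]]]]; have M0 : 0 <= M by lra.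
exists (fun i => F i 0 / i`!%:R), (Num.bound (C * M ^+ n)) => t.
rewrite ler_norml => tb.
have t34 : - (3 / 4) < t < 3 / 4 by lra.
have z34 : - (3 / 4) < (0 : R) < 3 / 4 by lra.
have := taylor_dbound n C0 M0 bF z34 t34.
rewrite subr0 F0// /tpoly (eq_bigr (fun i : 'I_n => F i 0 / i`!%:R * t ^+ i)); last first.
  by move=> i _; rewrite subr0.
move=> h; apply: le_trans h _; rewrite exprMn mulrA; apply: ler_wpM2r; first exact: exprn_ge0.
by apply: ltW; apply: archi_boundP; rewrite mulr_ge0// exprn_ge0.
Qed.

Lemma expR_taylor0 n : exists (c : nat -> R) (C : nat), forall t, `|t| <= 2^-1 ->
    `|expR t - \sum_(i < n) c i * t ^+ i| <= C%:R * `|t| ^+ n.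
Proof. exact: (ana_taylor0 n (ana_exp (ana_id _ _))). Qed.

Lemma ln1_taylor0 n : exists (c : nat -> R) (C : nat), forall t, `|t| <= 2^-1 ->
    `|ln (1 + t) - \sum_(i < n) c i * t ^+ i| <= C%:R * `|t| ^+ n.
Proof.
apply: (@ana_taylor0 (fun t => ln (1 + t)) n); apply: (@ana_ln _ _ _ _ (4^-1)).
- by [].
- by move=> x xb; lra.
- by apply: ana_add; [exact: ana_cst|exact: ana_id].
Qed.

End Germs.

(** * Hardy fields *)

Section Hardy.
Variable R : realType.
Implicit Types (f g h p q y : R -> R) (K : set (R -> R)).

Definition ev (P : R -> Prop) := exists m : R, forall x, m < x -> P x.

Lemma evS (P Q : R -> Prop) : (forall x, P x -> Q x) -> ev P -> ev Q.
Proof. by move=> PQ [m mP]; exists m => x /mP/PQ. Qed.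

Lemma ev_and (P Q : R -> Prop) : ev P -> ev Q -> ev (fun x => P x /\ Q x).
Proof.
move=> [m mP] [k kQ]; exists (Num.max m k) => x; rewrite gt_max => /andP[mx kx].
by split; [exact: mP|exact: kQ].
Qed.

Lemma evS2 (P Q S : R -> Prop) : (forall x, P x -> Q x -> S x) -> ev P -> ev Q -> ev S.
Proof. by move=> H eP eQ; apply: evS (ev_and eP eQ) => x []; exact: H. Qed.

Lemma evS3 (P Q S T : R -> Prop) : (forall x, P x -> Q x -> S x -> T x) ->
  ev P -> ev Q -> ev S -> ev T.
Proof. by move=> H eP eQ; apply: evS2 (ev_and eP eQ) => x []; exact: H. Qed.

Lemma evS4 (P Q S T U : R -> Prop) : (forall x, P x -> Q x -> S x -> T x -> U x) ->
  ev P -> ev Q -> ev S -> ev T -> ev U.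
Proof. by move=> H eP eQ; apply: evS3 (ev_and eP eQ) => x []; exact: H. Qed.

Lemma evT (P : R -> Prop) : (forall x, P x) -> ev P.
Proof. by move=> H; exists 0. Qed.

Lemma ev_near (P : R -> Prop) : ev P -> ev (fun x => \forall z \near x, P z).
Proof.
move=> [m mP]; exists m => x mx; near=> z; apply: mP.
by near: z; exact: lt_nbhsr.
Unshelve. all: by end_near. Qed.

Definition evder f f' := ev (fun x => der f x (f' x)).

Lemma evder_ext f g f' : ev (fun x => g x = f x) -> evder f f' -> evder g f'.
Proof.
move=> /ev_near; apply: evS2 => x gf; apply: der_near.
by apply: filterS gf => z ->.
Qed.

Definition evsign f := ev (fun x => f x = 0) \/ ev (fun x => 0 < f x) \/ ev (fun x => f x < 0).

Lemma evsign_ext f g : ev (fun x => g x = f x) -> evsign f -> evsign g.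
Proof.
move=> gf [|[|]] fs; [left|right; left|right; right];
  by apply: evS2 gf fs => x ->.
Qed.

Lemma evsignM f g : evsign f -> evsign g -> evsign (fun x => f x * g x).
Proof.
move=> [fs|[fs|fs]]; first by move=> _; left; apply: evS fs => x ->; rewrite mul0r.
  move=> [gs|[gs|gs]]; [left|right; left|right; right]; apply: evS2 fs gs => x f0 g0.
  - by rewrite g0 mulr0.
  - by rewrite mulr_gt0.
  - by rewrite pmulr_rlt0.
move=> [gs|[gs|gs]]; [left|right; right|right; left]; apply: evS2 fs gs => x f0 g0.
- by rewrite g0 mulr0.
- by rewrite nmulr_rlt0.
- by rewrite nmulr_rgt0.
Qed.

Lemma evsignN f : evsign f -> evsign (fun x => - f x).
Proof.
move=> [|[|]] fs; [left|right; right|right; left]; apply: evS fs => x.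
- by move=> ->; rewrite oppr0.
- by rewrite oppr_lt0.
- by rewrite oppr_gt0.
Qed.

Lemma evsignV f : evsign f -> evsign (fun x => (f x)^-1).
Proof.
move=> [|[|]] fs; [left|right; left|right; right]; apply: evS fs => x.
- by move=> ->; rewrite invr0.
- by rewrite invr_gt0.
- by rewrite invr_lt0.
Qed.

Lemma evsign_gt0 f : ev (fun x => 0 < f x) -> evsign f.
Proof. by right; left. Qed.

Lemma evsign_neq0 f : evsign f -> ev (fun x => f x = 0) \/ ev (fun x => f x != 0).
Proof.
by move=> [|[|]] fs; [left|right|right] => //; apply: evS fs => x; [exact: lt0r_neq0|exact: ltr0_neq0].
Qed.

Lemma evsign_incr f f' : evder f f' -> ev (fun x => 0 <= f' x) -> evsign f.
Proof.
move=> df f'0; have [m mP] := ev_and df f'0.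
have mono x (y : R) : m < x -> x <= y -> f x <= f y.
  move=> mx xy; apply: (@der_ge0 _ f f' x y xy) => z.
    by move=> /andP[xz _]; have [] := mP z (lt_le_trans mx xz).
  by move=> /andP[xz _]; have [] := mP z (lt_trans mx xz).
have [[x0 [mx0 fx0]]|N] := pselect (exists x, m < x /\ 0 < f x).
  right; left; exists x0 => x /ltW x0x; apply: lt_le_trans (mono _ _ mx0 x0x) => //.
have [[x0 [mx0 fx0]]|N'] := pselect (exists x, m < x /\ 0 <= f x).
  left; exists x0 => x x0x; apply: le_anti; apply/andP; split.
    by rewrite leNgt; apply/negP => fx; apply: N; exists x; rewrite (lt_trans mx0).
  exact: le_trans (mono _ _ mx0 (ltW x0x)).
by right; right; exists m => x mx; rewrite ltNge; apply/negP => fx; apply: N'; exists x.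
Qed.

Lemma evsign_der f f' : evder f f' -> evsign f' -> evsign f.
Proof.
move=> df [f0|[f0|f0]].
- by apply: (evsign_incr df); apply: evS f0 => x ->.
- by apply: (evsign_incr df); apply: evS f0 => x; exact: ltW.
- have -> : f = (fun x => - - f x) by apply/funext => x; rewrite opprK.
  apply: evsignN; apply: (@evsign_incr _ (fun x => - f' x)).
    by apply: evS df => x; exact: derN.
  by apply: evS f0 => x fx; rewrite oppr_ge0 ltW.
Qed.

(** A Hardy field given by representatives: [hf_ext] makes membership depend on the germ only. With
    the convention [0^-1 = 0], inverses need no side condition. *)
Record hardy K : Prop := Hardy {
  hf_ext : forall f g, ev (fun x => g x = f x) -> K f -> K g;
  hf_cst : forall c, K (fun=> c);
  hf_add : forall f g, K f -> K g -> K (fun x => f x + g x);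
  hf_mul : forall f g, K f -> K g -> K (fun x => f x * g x);
  hf_inv : forall f, K f -> K (fun x => (f x)^-1);
  hf_der : forall f, K f -> exists2 f', K f' & evder f f';
  hf_sign : forall f, K f -> evsign f }.

Lemma hf_opp K f : hardy K -> K f -> K (fun x => - f x).
Proof.
move=> hK Kf; apply: (hf_ext hK) (hf_mul hK (hf_cst hK (-1)) Kf).
by apply: evT => x; rewrite mulN1r.
Qed.

Lemma hardy_cst : hardy [set f | exists c, ev (fun x => f x = c)].
Proof.
split.
- by move=> f g gf [c fc]; exists c; apply: evS2 gf fc => x -> ->.
- by move=> c; exists c; exact: evT.
- by move=> f g [c fc] [d gd]; exists (c + d); apply: evS2 fc gd => x -> ->.
- by move=> f g [c fc] [d gd]; exists (c * d); apply: evS2 fc gd => x -> ->.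
- by move=> f [c fc]; exists c^-1; apply: evS fc => x ->.
- move=> f [c fc]; exists (fun=> 0); first by exists 0; exact: evT.
  by apply: evder_ext fc _; apply: evT => x; exact: der_cst.
- move=> f [c fc]; apply: evsign_ext fc _.
  have [c0|c0|c0] := ltgtP c 0; [right; right|right; left|left]; exact: evT.
Qed.

(** * Adjoining a solution of a linear differential equation of order one *)

Section Adjoin.
Variables (K : set (R -> R)) (hK : hardy K) (y a b : R -> R).
Hypotheses (Ka : K a) (Kb : K b) (dy : evder y (fun x => a x * y x + b x)).

Fixpoint padj n : set (R -> R) :=
  if n is n'.+1 then
    [set f | exists g p, [/\ padj n' g, K p & ev (fun x => f x = g x + p x * y x ^+ n)]]
  else K.

Lemma padj_ext n f g : ev (fun x => g x = f x) -> padj n f -> padj n g.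
Proof.
case: n => [|n] gf /=; first exact: (hf_ext hK gf).
by move=> [h [p [hh Kp fE]]]; exists h, p; split=> //; apply: evS2 gf fE => x -> ->.
Qed.

Lemma padjW n f : padj n f -> padj n.+1 f.
Proof.
move=> fn; exists f, (fun=> 0); split=> //; first exact: hf_cst.
by apply: evT => x; rewrite mul0r addr0.
Qed.

Lemma padj_leq n m f : (n <= m)%N -> padj n f -> padj m f.
Proof.
move=> /subnKC<-; elim: (m - n)%N => [|k IH]; first by rewrite addn0.
by rewrite addnS => /IH/padjW.
Qed.

Lemma padj_K n f : K f -> padj n f.
Proof. by move=> Kf; apply: (@padj_leq 0). Qed.

Lemma padj_add n f g : padj n f -> padj n g -> padj n (fun x => f x + g x).
Proof.
elim: n f g => [|n IH] f g; first exact: hf_add.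
move=> [h [p [hh Kp fE]]] [k [q [hk Kq gE]]].
exists (fun x => h x + k x), (fun x => p x + q x); split; [exact: IH|exact: hf_add|].
by apply: evS2 fE gE => x -> ->; ring.
Qed.

Lemma padj_mulK n f p : padj n f -> K p -> padj n (fun x => f x * p x).
Proof.
move=> + Kp; elim: n f => [|n IH] f /=; first by move=> Kf; exact: hf_mul.
move=> [h [q [hh Kq fE]]].
exists (fun x => h x * p x), (fun x => q x * p x); split; [exact: IH|exact: hf_mul|].
by apply: evS fE => x ->; ring.
Qed.

Lemma padj_muly n f : padj n f -> padj n.+1 (fun x => f x * y x).
Proof.
elim: n f => [|n IH] f; last first.
  move=> [h [q [/IH hh Kq fE]]].
  exists (fun x => h x * y x), q; split=> //.
  by apply: evS fE => x ->; rewrite !exprS; ring.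
move=> Kf; exists (fun=> 0), f; split=> //; first exact: hf_cst.
by apply: evT => x; rewrite add0r expr1.
Qed.

Lemma padj_mulyn n k f : padj n f -> padj (n + k) (fun x => f x * y x ^+ k).
Proof.
elim: k => [|k IH] fn.
  by rewrite addn0; apply: padj_ext fn; apply: evT => x; rewrite expr0 mulr1.
rewrite addnS; apply: padj_ext (padj_muly (IH fn)).
by apply: evT => x; rewrite exprSr mulrA.
Qed.

Lemma padj_yn n p : K p -> padj n (fun x => p x * y x ^+ n).
Proof. by move=> Kp; apply: (@padj_mulyn 0 n). Qed.

Lemma padj_mul n m f g : padj n f -> padj m g -> padj (n + m) (fun x => f x * g x).
Proof.
move=> fn; elim: m g => [|m IH] g; first by rewrite addn0; exact: padj_mulK.
move=> [h [q [hh Kq gE]]].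
apply: padj_ext (padj_add (padj_leq _ (IH _ hh)) (padj_mulyn m.+1 (padj_mulK fn Kq))).
  by apply: evS gE => x ->; ring.
by rewrite leq_add2l.
Qed.

Lemma der_yn n : evder (fun x => y x ^+ n)
  (fun x => n%:R * a x * y x ^+ n + n%:R * b x * y x ^+ n.-1).
Proof.
case: n => [|n].
  by apply: evT => x; rewrite !mul0r addr0; exact: der_cst.
apply: evS dy => x /(der_exprn n); apply: derE; rewrite exprS /=; ring.
Qed.

Lemma padj_der n f : padj n f -> exists2 f', padj n f' & evder f f'.
Proof.
elim: n f => [|n IH] f; first exact: hf_der.
move=> [g [p [/IH[g' g'n dg] Kp fE]]]; have [p' Kp' dp] := hf_der hK Kp.
have Kn := hf_cst hK n.+1%:R.
exists (fun x => (g' x + (p x * b x * n.+1%:R) * y x ^+ n) +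
                 (p' x + p x * a x * n.+1%:R) * y x ^+ n.+1).
  apply: padj_add.
    apply: padjW; apply: padj_add => //; apply: padj_yn.
    by do 2![apply: (hf_mul hK) => //].
  apply: padj_yn; apply: (hf_add hK) => //; do 2![apply: (hf_mul hK) => //].
apply: evder_ext fE _; apply: evS3 dg dp (der_yn n.+1) => x dgx dpx dyx.
by apply: derE (derD dgx (derM dpx dyx)) => /=; ring.
Qed.

(** The two extensions that occur: exponentials, where [y' = a y], and primitives, where
    [y' = b]. *)
Hypothesis expo_or_prim :
  (ev (fun x => b x = 0) /\ ev (fun x => 0 < y x)) \/ ev (fun x => a x = 0).

(* After division by the leading monomial (or its coefficient) the derivative has
   lower degree in [y], hence a sign, so the quotient is eventually monotone. *)
Lemma padj_sign n f : padj n f -> evsign f.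
Proof.
elim: n f => [|n IH] f; first exact: hf_sign.
move=> [g [p [gn Kp fE]]].
have [p0|p0] := evsign_neq0 (hf_sign hK Kp).
  apply: (@evsign_ext g); last exact: IH.
  by apply: evS2 fE p0 => x -> ->; rewrite mul0r addr0.
have Kp1 := hf_inv hK Kp.
pose h x := g x * (p x)^-1.
have hn : padj n h by exact: padj_mulK.
have [h' h'n dh] := padj_der hn.
case: expo_or_prim => [[b0 y0]|a0].
- pose w x := h x * (y x)^-1 ^+ n.+1 + 1.
  have sw : evsign w.
    apply: (@evsign_der _ (fun x => (h' x + h x * (- n.+1%:R * a x)) * (y x)^-1 ^+ n.+1)).
      apply: evS4 dh dy b0 y0 => x dhx dyx b0 y0.
      have := derD (derM dhx (der_exprn n (der_inv (lt0r_neq0 y0) dyx))) (der_cst 1 x).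
      apply: derE; rewrite b0 !exprS; have := lt0r_neq0 y0.
      by move: (y x) ((y x)^-1 ^+ n) => u v u0; field.
    apply: evsignM.
      apply: (@IH); apply: padj_add => //; apply: padj_mulK => //.
      by apply: (hf_mul hK) => //; exact: hf_cst.
    by apply: evsign_gt0; apply: evS y0 => x y0; rewrite exprn_gt0// invr_gt0.
  apply: (@evsign_ext (fun x => p x * y x ^+ n.+1 * w x)); last first.
    have sy : evsign (fun x => y x ^+ n.+1).
      by apply: evsign_gt0; apply: evS y0 => x y0; rewrite exprn_gt0.
    exact: evsignM (evsignM (hf_sign hK Kp) sy) sw.
  apply: evS3 fE p0 y0 => x -> p0 y0; rewrite /w /h exprVn.
  by have := lt0r_neq0 (exprn_gt0 n.+1 y0); move: (y x ^+ _) => u u0; field; rewrite u0.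
- pose w x := h x + y x ^+ n.+1.
  have sw : evsign w.
    apply: (@evsign_der _ (fun x => h' x + n.+1%:R * b x * y x ^+ n)).
      apply: evS3 dh (der_yn n.+1) a0 => x dhx dyx a0.
      by apply: derE (derD dhx dyx); rewrite a0 /=; ring.
    apply: (@IH); apply: padj_add => //; apply: padj_yn.
    by apply: (hf_mul hK) => //; exact: hf_cst.
  apply: (@evsign_ext (fun x => p x * w x)); last first.
    exact: evsignM (hf_sign hK Kp) sw.
  by apply: evS2 fE p0 => x -> p0; rewrite /w /h; field.
Qed.

Definition adj : set (R -> R) := [set f | exists n u v,
  [/\ padj n u, padj n v, ev (fun x => v x != 0) & ev (fun x => f x = u x / v x)]].

Lemma adj_K f : K f -> adj f.
Proof.
move=> Kf; exists 0%N, f, (fun=> 1); split=> //; first exact: hf_cst.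
  by apply: evT => x; rewrite oner_neq0.
by apply: evT => x; rewrite divr1.
Qed.

Lemma adj_y : adj y.
Proof.
exists 1%N, y, (fun=> 1); split=> //.
- apply: padj_ext (padj_yn 1 (hf_cst hK 1)); apply: evT => x.
  by rewrite mul1r expr1.
- exact: padj_K (hf_cst hK 1).
- by apply: evT => x; rewrite oner_neq0.
- by apply: evT => x; rewrite divr1.
Qed.

Lemma hardy_adj : hardy adj.
Proof.
split.
- move=> f g gf [n [u [v [un vn v0 fE]]]]; exists n, u, v; split=> //.
  by apply: evS2 gf fE => x ->.
- by move=> c; exact: adj_K (hf_cst hK c).
- move=> f g [n [u [v [un vn v0 fE]]]] [m [u' [v' [um vm v0' gE]]]].
  exists (n + m)%N, (fun x => u x * v' x + v x * u' x), (fun x => v x * v' x); split.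
  + by apply: padj_add; apply: padj_mul.
  + exact: padj_mul.
  + by apply: evS2 v0 v0' => x; exact: mulf_neq0.
  + by apply: evS4 v0 v0' fE gE => x v0 v0' -> ->; field; rewrite ?v0 ?v0'.
- move=> f g [n [u [v [un vn v0 fE]]]] [m [u' [v' [um vm v0' gE]]]].
  exists (n + m)%N, (fun x => u x * u' x), (fun x => v x * v' x); split.
  + exact: padj_mul.
  + exact: padj_mul.
  + by apply: evS2 v0 v0' => x; exact: mulf_neq0.
  + by apply: evS4 v0 v0' fE gE => x v0 v0' -> ->; field; rewrite ?v0 ?v0'.
- move=> f [n [u [v [un vn v0 fE]]]]; have [u0|u0] := evsign_neq0 (padj_sign un).
    exists 0%N, (fun=> 0), (fun=> 1); split; [exact: hf_cst|exact: hf_cst| |].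
      by apply: evT => x; rewrite oner_neq0.
    by apply: evS2 fE u0 => x -> ->; rewrite !mul0r invr0.
  exists n, v, u; split=> //; apply: evS fE => x ->.
  by rewrite invfM invrK mulrC.
- move=> f [n [u [v [un vn v0 fE]]]].
  have [u' u'n du] := padj_der un; have [v' v'n dv] := padj_der vn.
  exists (fun x => (u' x * v x + u x * (v' x * (-1))) / (v x * v x)).
    exists (n + n)%N, (fun x => u' x * v x + u x * (v' x * (-1))), (fun x => v x * v x).
    split.
    + apply: padj_add; apply: padj_mul => //; apply: padj_mulK => //; exact: hf_cst.
    + exact: padj_mul.
    + by apply: evS v0 => x v0; exact: mulf_neq0.
    + exact: evT.
  apply: evder_ext fE _; apply: evS3 du dv v0 => x dux dvx v0.
  by apply: derE (derM dux (der_inv v0 dvx)); field.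
- move=> f [n [u [v [un vn v0 fE]]]]; apply: evsign_ext fE _.
  by apply: evsignM; [exact: padj_sign un|apply: evsignV; exact: padj_sign vn].
Qed.

End Adjoin.

Lemma hardy_adj_prim K y b : hardy K -> K b -> evder y b ->
  exists K', [/\ hardy K', K `<=` K' & K' y].
Proof.
move=> hK Kb dy.
have K0 := hf_cst hK 0.
have dy' : evder y (fun x => 0 * y x + b x).
  by apply: evS dy => x; apply: derE; rewrite mul0r add0r.
exists (adj K y); split; [apply: hardy_adj K0 Kb dy' _|by move=> f; exact: adj_K|exact: adj_y] => //.
by right; exact: evT.
Qed.

Lemma hardy_adj_exp K g : hardy K -> K g ->
  exists K', [/\ hardy K', K `<=` K' & K' (fun x => expR (g x))].
Proof.
move=> hK Kg; have [g' Kg' dg] := hf_der hK Kg.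
have K0 := hf_cst hK 0.
have dy' : evder (fun x => expR (g x)) (fun x => g' x * expR (g x) + 0).
  by apply: evS dg => x /der_exp; apply: derE; rewrite addr0.
exists (adj K (fun x => expR (g x))).
split; [apply: hardy_adj Kg' K0 dy' _|by move=> f; exact: adj_K|exact: adj_y] => //.
by left; split; apply: evT => // x; exact: expR_gt0.
Qed.

Lemma hardy_adj_ln K g : hardy K -> K g -> ev (fun x => 0 < g x) ->
  exists K', [/\ hardy K', K `<=` K' & K' (fun x => ln (g x))].
Proof.
move=> hK Kg g0; have [g' Kg' dg] := hf_der hK Kg.
apply: (hardy_adj_prim hK (hf_mul hK Kg' (hf_inv hK Kg))).
by apply: evS2 g0 dg => x; exact: der_ln.
Qed.

End Hardy.

(** * The ultrapower of the real field at infinity *)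

Section Ultrapower.
Variables (R : realType) (U : set_system R) (UU : UltraFilter U).
Implicit Types f g h : R -> R.

(* The dummy argument makes the type determine the proof used by the instances. *)
Definition ult_sort (_ : UltraFilter U) : Type :=
  {A : set (R -> R) | exists f, A = [set g | U [set x | g x = f x]]}.
Local Notation K := (ult_sort UU).
Implicit Types a b c : K.

HB.instance Definition _ := gen_eqMixin K.
HB.instance Definition _ := gen_choiceMixin K.

Definition upi f : K := exist _ _ (ex_intro _ f erefl).

Definition urep a : R -> R := proj1_sig (cid (proj2_sig a)).

Lemma US (P Q : R -> Prop) : (forall x, P x -> Q x) ->
  U [set x | P x] -> U [set x | Q x].
Proof. by move=> PQ; apply: filterS. Qed.

Lemma US2 (P Q S : R -> Prop) : (forall x, P x -> Q x -> S x) ->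
  U [set x | P x] -> U [set x | Q x] -> U [set x | S x].
Proof. by move=> PQ; apply: filterS2. Qed.

Lemma UT (P : R -> Prop) : (forall x, P x) -> U [set x | P x].
Proof. by move=> PT; apply: (@filterS _ U _ setT) (filterT) => x _; exact: PT. Qed.

Lemma UVN (P : R -> Prop) : U [set x | P x] \/ U [set x | ~ P x].
Proof. exact: in_ultra_setVsetC. Qed.

Lemma UN (P : R -> Prop) : U [set x | P x] -> ~ U [set x | ~ P x].
Proof.
move=> h h'; have : U ([set x | P x] `&` [set x | ~ P x]) by exact: filterI.
by move=> /filter_ex[x []].
Qed.

Lemma U_ex (P Q : R -> Prop) : U [set x | P x] -> U [set x | Q x] ->
  exists x, P x /\ Q x.
Proof.
move=> h h'; have : U ([set x | P x] `&` [set x | Q x]) by exact: filterI.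
by move=> /filter_ex.
Qed.

Lemma urepK a : upi (urep a) = a.
Proof.
rewrite /urep; case: a => A PA; case: (cid _) => f /= fA.
by apply: eq_exist => /=; rewrite fA.
Qed.

Lemma upi_eq f g : upi f = upi g <-> U [set x | f x = g x].
Proof.
split=> [/(congr1 sval)/= fg|fg].
  have : [set h | U [set x | h x = f x]] f by apply: UT.
  by rewrite fg.
apply: eq_exist; apply/seteqP; split=> h /= hf; apply: US2 hf fg => x -> //.
Qed.

Lemma upiP a : exists f, a = upi f. Proof. by exists (urep a); rewrite urepK. Qed.

Lemma urep_pi f : U [set x | urep (upi f) x = f x].
Proof. by apply/upi_eq; rewrite urepK. Qed.

Definition ulift1 (o : R -> R) a := upi (fun x => o (urep a x)).
Definition ulift2 (o : R -> R -> R) a b := upi (fun x => o (urep a x) (urep b x)).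

Lemma ulift1E o f : ulift1 o (upi f) = upi (fun x => o (f x)).
Proof. by apply/upi_eq; apply: US (urep_pi f) => x ->. Qed.

Lemma ulift2E o f g : ulift2 o (upi f) (upi g) = upi (fun x => o (f x) (g x)).
Proof. by apply/upi_eq; apply: US2 (urep_pi f) (urep_pi g) => x -> ->. Qed.

Definition uadd := ulift2 +%R.
Definition umul := ulift2 *%R.
Definition uopp := ulift1 -%R.
Definition uinv := ulift1 GRing.inv.

Ltac ulift := repeat (let a := fresh "a" in let f := fresh "f" in
    intro a; have [f ->] := upiP a);
  rewrite /uadd /umul /uopp /uinv ?(ulift2E, ulift1E); apply/upi_eq; apply: UT => x.

Fact uaddA : associative uadd. Proof. by ulift; rewrite addrA. Qed.
Fact uaddC : commutative uadd. Proof. by ulift; rewrite addrC. Qed.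
Fact uadd0 : left_id (upi (fun=> 0)) uadd. Proof. by ulift; rewrite add0r. Qed.
Fact uaddN : left_inverse (upi (fun=> 0)) uopp uadd.
Proof. by ulift; rewrite addNr. Qed.
HB.instance Definition _ := GRing.isZmodule.Build K uaddA uaddC uadd0 uaddN.

Fact umulA : associative umul. Proof. by ulift; rewrite mulrA. Qed.
Fact umulC : commutative umul. Proof. by ulift; rewrite mulrC. Qed.
Fact umul1 : left_id (upi (fun=> 1)) umul. Proof. by ulift; rewrite mul1r. Qed.
Fact umulD : left_distributive umul uadd. Proof. by ulift; rewrite mulrDl. Qed.
Fact uone_neq0 : upi (fun=> 1) != 0.
Proof.
apply/eqP => /upi_eq/filter_ex[x /= /eqP]; by rewrite oner_eq0.
Qed.
HB.instance Definition _ :=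
  GRing.Zmodule_isComNzRing.Build K umulA umulC umul1 umulD uone_neq0.

Fact umulV a : a != 0 -> umul (uinv a) a = 1.
Proof.
have [f ->] := upiP a => /eqP f0; rewrite /umul /uinv ulift1E ulift2E.
apply/upi_eq; have [h|] := UVN (fun x => f x = 0); first by case: f0; apply/upi_eq.
by apply: US => x /eqP fx; rewrite mulVf.
Qed.
Fact uinv0 : uinv 0 = 0.
Proof. by rewrite /uinv [LHS]ulift1E; apply/upi_eq; apply: UT => x; rewrite invr0. Qed.
HB.instance Definition _ := GRing.ComNzRing_isField.Build K umulV uinv0.

Definition ule : rel K := fun a b => `[< U [set x | urep a x <= urep b x] >].
Definition ult : rel K := fun a b => (b != a) && ule a b.

Lemma uleE f g : ule (upi f) (upi g) <-> U [set x | f x <= g x].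
Proof.
rewrite /ule; split=> [/asboolP|] h; last apply/asboolP.
all: apply: US2 h (filterI (urep_pi f) (urep_pi g)) => x /=.
  by move=> h [<- <-].
by move=> h [-> ->].
Qed.

Lemma upiD f g : upi f + upi g = upi (fun x => f x + g x). Proof. exact: ulift2E. Qed.
Lemma upiM f g : upi f * upi g = upi (fun x => f x * g x). Proof. exact: ulift2E. Qed.
Lemma upiN f : - upi f = upi (fun x => - f x). Proof. exact: ulift1E. Qed.
Lemma upiV f : (upi f)^-1 = upi (fun x => (f x)^-1). Proof. exact: ulift1E. Qed.

Fact ule0_add a b : ule 0 a -> ule 0 b -> ule 0 (a + b).
Proof.
have [f ->] := upiP a; have [g ->] := upiP b => /uleE f0 /uleE g0; rewrite upiD.
by apply/uleE; apply: US2 f0 g0 => x; exact: addr_ge0.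
Qed.
Fact ule0_mul a b : ule 0 a -> ule 0 b -> ule 0 (a * b).
Proof.
have [f ->] := upiP a; have [g ->] := upiP b => /uleE f0 /uleE g0; rewrite upiM.
by apply/uleE; apply: US2 f0 g0 => x; exact: mulr_ge0.
Qed.
Fact ule0_anti a : ule 0 a -> ule a 0 -> a = 0.
Proof.
have [f ->] := upiP a => /uleE f0 /uleE g0; apply/upi_eq.
by apply: US2 f0 g0 => x h1 h2; apply: le_anti; rewrite h2.
Qed.
Fact usub_ge0 a b : ule 0 (b - a) = ule a b.
Proof.
have [f ->] := upiP a; have [g ->] := upiP b; rewrite upiN upiD.
by apply/idP/idP => /uleE h; apply/uleE; apply: US h => x; rewrite subr_ge0.
Qed.
Fact ule0_total a : ule 0 a || ule a 0.
Proof.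
have [f ->] := upiP a; apply/orP; have [h|h] := UVN (fun x => 0 <= f x); [left|right].
  exact/uleE.
by apply/uleE; apply: US h => x /negP; rewrite -ltNge => /ltW.
Qed.
Fact unormN a : ulift1 Num.norm (- a) = ulift1 Num.norm a.
Proof. by have [f ->] := upiP a; rewrite upiN !ulift1E; apply/upi_eq; apply: UT => x; rewrite normrN. Qed.
Fact uge0_norm a : ule 0 a -> ulift1 Num.norm a = a.
Proof.
have [f ->] := upiP a => /uleE f0; rewrite !ulift1E; apply/upi_eq.
by apply: US f0 => x; exact: ger0_norm.
Qed.
HB.instance Definition _ := Num.IntegralDomain_isLeReal.Build K
  ule0_add ule0_mul ule0_anti usub_ge0 ule0_total unormN uge0_norm (fun _ _ => erefl (ult _ _)).

Lemma upi_le f g : upi f <= upi g <-> U [set x | f x <= g x]. Proof. exact: uleE. Qed.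

Lemma upi_lt f g : upi f < upi g <-> U [set x | f x < g x].
Proof.
rewrite ltNge; split=> [/negP h|h].
  have [h'|] := UVN (fun x => g x <= f x); first by case: h; apply/upi_le.
  by apply: US => x /negP; rewrite -ltNge.
by apply/negP => /upi_le h'; apply: (UN h); apply: US h' => x; rewrite leNgt => /negP.
Qed.

Lemma upi_norm f : `|upi f| = upi (fun x => `|f x|). Proof. exact: ulift1E. Qed.

Lemma upi_nat n : n%:R = upi (fun=> n%:R).
Proof. by elim: n => [//|n IH]; rewrite -natr1 IH -natr1 [LHS]upiD. Qed.

Lemma upiX f n : upi f ^+ n = upi (fun x => f x ^+ n).
Proof.
by elim: n => [//|n IH]; rewrite exprS IH upiM; congr upi; apply/funext => x; rewrite exprS.
Qed.

Lemma upi_sum n (F : nat -> R -> R) :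
  \sum_(i < n) upi (F i) = upi (fun x => \sum_(i < n) F i x).
Proof.
elim: n => [|n IH].
  by rewrite big_ord0; congr upi; apply/funext => x; rewrite big_ord0.
by rewrite big_ord_recr /= IH upiD; congr upi; apply/funext => x; rewrite big_ord_recr.
Qed.

Hypothesis U_ev : forall P, ev P -> U [set x | P x].

Definition uexp := ulift1 (@expR R).
Definition uln := ulift1 (@ln R).

Fact uexp_gt0 a : 0 < uexp a.
Proof.
have [f ->] := upiP a; rewrite /uexp ulift1E; apply/upi_lt.
by apply: UT => x; exact: expR_gt0.
Qed.
Fact uexpD a b : uexp (a + b) = uexp a * uexp b.
Proof.
have [f ->] := upiP a; have [g ->] := upiP b; rewrite upiD /uexp !ulift1E upiM.
by apply/upi_eq; apply: UT => x; rewrite expRD.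
Qed.
Fact uexp_ge a : 1 + a <= uexp a.
Proof.
have [f ->] := upiP a; rewrite /uexp ulift1E [_ + _]upiD; apply/upi_le.
by apply: UT => x; exact: expR_ge1Dx.
Qed.
Fact uexpK a : uln (uexp a) = a.
Proof.
have [f ->] := upiP a; rewrite /uexp /uln !ulift1E; apply/upi_eq.
by apply: UT => x; rewrite expRK.
Qed.
Fact ulnK a : 0 < a -> uexp (uln a) = a.
Proof.
have [f ->] := upiP a => /upi_lt f0; rewrite /uexp /uln !ulift1E; apply/upi_eq.
by apply: US f0 => x f0; rewrite lnK.
Qed.
Fact uX_gt n : n%:R < upi id.
Proof. by rewrite upi_nat; apply/upi_lt; apply: U_ev; exists n%:R. Qed.

Definition ult_field : exp_field := ExpField uexp_gt0 uexpD uexp_ge uexpK ulnK uX_gt.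

Lemma kexp_upi f : kexp (upi f : ult_field) = upi (fun x => expR (f x)).
Proof. exact: ulift1E. Qed.

Lemma kln_upi f : kln (upi f : ult_field) = upi (fun x => ln (f x)).
Proof. exact: ulift1E. Qed.

Definition ucst (r : R) : ult_field := upi (fun=> r).

Fact ucst_is_zmod_morphism : zmod_morphism ucst.
Proof. by move=> r s; rewrite /ucst upiN upiD. Qed.
Fact ucst_is_monoid_morphism : monoid_morphism ucst.
Proof. by split=> // r s; rewrite /ucst upiM. Qed.
HB.instance Definition _ := GRing.isZmodMorphism.Build R ult_field ucst ucst_is_zmod_morphism.
HB.instance Definition _ := GRing.isMonoidMorphism.Build R ult_field ucst ucst_is_monoid_morphism.

Lemma ucst_le : {mono ucst : x y / x <= y}.
Proof.
move=> r s; apply/idP/idP => [/upi_le/filter_ex[]//|rs].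
by apply/upi_le; apply: UT.
Qed.

Lemma ucst_exp r : kexp (ucst r) = ucst (expR r).
Proof. exact: kexp_upi. Qed.

Definition ugerm : set ult_field :=
  [set a | exists d g, [/\ 0 < d, ana 0 d g & a = upi (fun x => g x^-1)]].

Lemma ev_inv_small (d : R) : 0 < d -> ev (fun x => 0 < x^-1 < d).
Proof.
move=> d0; exists d^-1 => x dx; have x0 : 0 < x by apply: lt_trans dx; rewrite invr_gt0.
by rewrite invr_gt0 x0 /= -[ltRHS]invrK ltf_pV2 ?posrE ?invr_gt0.
Qed.

Lemma ugerm_common a b : ugerm a -> ugerm b -> exists d f g,
  [/\ 0 < d, ana 0 d f, ana 0 d g, a = upi (fun x => f x^-1) & b = upi (fun x => g x^-1)].
Proof.
move=> [d [f [d0 af ->]]] [e [g [e0 ag ->]]].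
exists (Num.min d e), f, g; split=> //; first by rewrite lt_min d0.
  by apply: ana_sub af => //; rewrite ge_min lexx.
by apply: ana_sub ag => //; rewrite ge_min lexx orbT.
Qed.

Lemma taylor_upi (phi : ult_field -> ult_field) (psi : R -> R) :
  (forall f, phi (upi f) = upi (fun x => psi (f x))) ->
  (forall n, exists (c : nat -> R) (C : nat), forall t, `|t| <= 2^-1 ->
    `|psi t - \sum_(i < n) c i * t ^+ i| <= C%:R * `|t| ^+ n) ->
  taylor (ucst : {rmorphism R -> ult_field}) phi.
Proof.
move=> phiE psiT n; have [c [C cC]] := psiT n; exists c, C => e.
have [f ->] := upiP e; rewrite upi_norm phiE upiX upi_nat upi_nat upiV => /upi_le fe.
rewrite (eq_bigr (fun i : 'I_n => upi (fun x => c i * f x ^+ i))); last first.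
  by move=> i _; rewrite upiX upiM.
rewrite (@upi_sum n (fun i x => c i * f x ^+ i)) upiN upiD upi_norm upiM.
by apply/upi_le; apply: US fe => x; exact: cC.
Qed.

Lemma ult_gap (p q : ult_field) : skA p -> skA q -> bigO q p \/ bigO p (q * kX ult_field).
Proof.
have XV : (kX ult_field)^-1 = upi (fun x => x^-1) by exact: upiV.
apply: (@skA_gap R ult_field (ucst : {rmorphism R -> ult_field}) ucst_le ucst_exp ugerm).
- by move=> r; exists 1, (fun=> r); split=> //; exact: ana_cst.
- by exists 1, id; split=> //; exact: ana_id.
- move=> a b ha hb; have [d [f [g [d0 af ag -> ->]]]] := ugerm_common ha hb.
  by exists d, (fun x => f x + g x); split=> //; [exact: ana_add|rewrite upiD].
- move=> a b ha hb; have [d [f [g [d0 af ag -> ->]]]] := ugerm_common ha hb.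
  by exists d, (fun x => f x * g x); split=> //; [exact: ana_mul|rewrite upiM].
- move=> a [d [f [d0 af ->]]].
  by exists d, (fun x => expR (f x)); split=> //; [exact: ana_exp|rewrite kexp_upi].
- move=> a [d [f [d0 af ->]]] /upi_le f1.
  have [|e e0 ae] := ana_ln0 d0 af.
    (* The inequality [1 <= f] is known only on a set of the ultrafilter; such a set meets every end
       segment. *)
    move=> e e0; have [x [fx xe]] := U_ex f1 (U_ev (ev_inv_small e0)).
    by exists x^-1.
  by exists e, (fun x => ln (f x)); split=> //; rewrite kln_upi.
- move=> a [d [f [d0 af ->]]]; have [N fN] := ana_bounded af.
  exists N; rewrite mulr1 upi_nat upi_norm; apply/upi_le.
  by apply: US (U_ev (ev_inv_small d0)) => x; exact: fN.
- move=> a [d [f [d0 af ->]]]; have [r [h [ah fE]]] := ana_div0 d0 af.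
  exists r, (upi (fun x => h x^-1)); split; first by exists d, h.
  rewrite XV upiM upiD; apply/upi_eq.
  by apply: US (U_ev (ev_inv_small d0)) => x; exact: fE.
- move=> a [d [f [d0 af ->]]]; have [[e e0 fe]|[k [r [h [r0 ah fE]]]]] := ana_order0 d0 af.
    left; apply/upi_eq; by apply: US (U_ev (ev_inv_small e0)) => x; exact: fe.
  right; exists k, r, (upi (fun x => h x^-1)); split=> //; first by exists d, h.
  rewrite -exprVn XV upiX (upiM (fun x => x^-1)) (upiD (fun=> r)) upiM; apply/upi_eq.
  by apply: US (U_ev (ev_inv_small d0)) => x; exact: fE.
- apply: (@taylor_upi _ (@expR R)); [exact: kexp_upi|exact: expR_taylor0].
- apply: (@taylor_upi _ (fun t => ln (1 + t))); last exact: ln1_taylor0.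
  by move=> f; rewrite [1 + _]upiD kln_upi.
Qed.

End Ultrapower.

(** * Skolem functions as real functions *)

Section SkolemFunctions.
Variable R : realType.
Implicit Types f g : pfun R.

(** The value 1 off the positive axis is an arbitrary positive default; it makes [ext f] positive
    everywhere, which spares side conditions for [ln]. *)
Definition ext f (x : R) : R :=
  if pselect (0 < x) is left h then (f (PosNum h))%:num else 1.

Lemma extE f (x : {posnum R}) : ext f x%:num = (f x)%:num.
Proof.
rewrite /ext; case: pselect => [h|]; last by case; exact: gt0.
by congr ((f _)%:num); apply: val_inj.
Qed.

Lemma posP (x : R) : 0 < x -> exists y : {posnum R}, x = y%:num.
Proof. by move=> x0; exists (PosNum x0). Qed.

Lemma ext_gt0 f x : 0 < ext f x.
Proof. by rewrite /ext; case: pselect. Qed.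
Hint Resolve ext_gt0 : core.

Lemma ext_one x : ext (fun=> 1%:pos) x = 1.
Proof. by rewrite /ext; case: pselect. Qed.

Lemma ext_id x : 0 < x -> ext (fun y => y) x = x.
Proof. by move=> /posP[y ->]; rewrite extE. Qed.

Lemma ext_add f g x : 0 < x ->
  ext (fun y => ((f y)%:num + (g y)%:num)%:pos) x = ext f x + ext g x.
Proof. by move=> /posP[y ->]; rewrite !extE. Qed.

Lemma ext_mul f g x : 0 < x ->
  ext (fun y => ((f y)%:num * (g y)%:num)%:pos) x = ext f x * ext g x.
Proof. by move=> /posP[y ->]; rewrite !extE. Qed.

Lemma ext_pow f g x : 0 < x ->
  ext (fun y => ((f y)%:num `^ (g y)%:num)%:pos) x = expR (ext g x * ln (ext f x)).
Proof.
move=> /posP[y ->]; rewrite !extE /= /powR ifF//.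
by apply/negbTE; rewrite lt0r_neq0.
Qed.

Lemma ev_gt0 : ev (fun x : R => 0 < x). Proof. by exists 0. Qed.

Lemma pfun_ltE f g : pfun_lt f g <-> ev (fun x => ext f x < ext g x).
Proof.
split=> [[M fg]|[M fg]].
  exists (Num.max M 0) => x; rewrite gt_max => /andP[Mx /posP[y xy]].
  by move: Mx; rewrite xy !extE; exact: fg.
by exists M => x /fg; rewrite !extE.
Qed.

Lemma ev_ltxx f : ~ ev (fun x => ext f x < ext f x).
Proof. by move=> [m /(_ (m + 1))]; rewrite ltxx ltrDl ltr01 => /(_ isT). Qed.

Lemma pfun_ltxx f : ~ pfun_lt f f. Proof. by move=> /pfun_ltE/ev_ltxx. Qed.

(** An arbitrary starting field [K] allows several functions to be put in one Hardy field. The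
    logarithm is carried along because [f^g = exp (g ln f)]. *)
Lemma skolem_hardy f : Skolem f -> forall K, hardy K ->
  exists K', [/\ hardy K', K `<=` K', K' (ext f) & K' (fun x => ln (ext f x))].
Proof.
have two f1 g1 :
  (forall K, hardy K ->
    exists K', [/\ hardy K', K `<=` K', K' (ext f1) & K' (fun x => ln (ext f1 x))]) ->
  (forall K, hardy K ->
    exists K', [/\ hardy K', K `<=` K', K' (ext g1) & K' (fun x => ln (ext g1 x))]) ->
  forall K, hardy K -> exists K', [/\ hardy K', K `<=` K',
    K' (ext f1) /\ K' (fun x => ln (ext f1 x)) &
    K' (ext g1) /\ K' (fun x => ln (ext g1 x))].
  move=> Hf Hg K hK; have [K1 [h1 K1K f1K l1K]] := Hf K hK.
  have [K2 [h2 K2K g2K l2K]] := Hg K1 h1.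
  exists K2; split=> //; first exact: subset_trans K2K.
  by split; apply: K2K.
elim=> {f} [||f g _ /two Hf _ /Hf{}Hf|f g _ /two Hf _ /Hf{}Hf|f g _ /two Hf _ /Hf{}Hf] K hK.
- exists K; split=> //.
    by apply: (hf_ext hK) (hf_cst hK 1); apply: evT => x; exact: ext_one.
  by apply: (hf_ext hK) (hf_cst hK 0); apply: evT => x; rewrite ext_one ln1.
- have dx : evder (fun x : R => x) (fun=> 1) by apply: evT => x; exact: der_id.
  have [K1 [h1 K1K x1]] := hardy_adj_prim hK (hf_cst hK 1) dx.
  have [K2 [h2 K2K l2]] := hardy_adj_ln h1 x1 ev_gt0.
  exists K2; split=> //; first exact: subset_trans K2K.
    by apply: (hf_ext h2) (K2K _ x1); apply: evS ev_gt0 => x; exact: ext_id.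
  by apply: (hf_ext h2) l2; apply: evS ev_gt0 => x x0; rewrite ext_id.
- have [K1 [h1 K1K [f1 _] [g1 _]]] := Hf K hK.
  have s1 := hf_add h1 f1 g1.
  have [|K2 [h2 K2K l2]] := hardy_adj_ln h1 s1; first by apply: evT => x; rewrite addr_gt0.
  exists K2; split=> //; first exact: subset_trans K2K.
    by apply: (hf_ext h2) (K2K _ s1); apply: evS ev_gt0 => x; exact: ext_add.
  by apply: (hf_ext h2) l2; apply: evS ev_gt0 => x x0; rewrite ext_add.
- have [K1 [h1 K1K [f1 lf1] [g1 lg1]]] := Hf K hK.
  exists K1; split=> //.
    by apply: (hf_ext h1) (hf_mul h1 f1 g1); apply: evS ev_gt0 => x; exact: ext_mul.
  apply: (hf_ext h1) (hf_add h1 lf1 lg1); apply: evS ev_gt0 => x x0.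
  by rewrite ext_mul// lnM ?posrE.
- have [K1 [h1 K1K [f1 lf1] [g1 lg1]]] := Hf K hK.
  have e1 := hf_mul h1 g1 lf1.
  have [K2 [h2 K2K l2]] := hardy_adj_exp h1 e1.
  exists K2; split=> //; first exact: subset_trans K2K.
    by apply: (hf_ext h2) l2; apply: evS ev_gt0 => x; exact: ext_pow.
  by apply: (hf_ext h2) (K2K _ e1); apply: evS ev_gt0 => x x0; rewrite ext_pow// expRK.
Qed.

Lemma skolem_sign f g (c : R) : Skolem f -> Skolem g ->
  evsign (fun x => ext f x - c * ext g x).
Proof.
move=> /skolem_hardy/(_ _ (hardy_cst R))[K1 [h1 _ f1 _]].
move=> /skolem_hardy/(_ _ h1)[K2 [h2 K12 g2 _]].
apply: (hf_sign h2); apply: (hf_add h2); first exact: K12.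
by apply: (hf_opp h2); apply: (hf_mul h2) => //; exact: hf_cst.
Qed.

(** The logarithm is carried along for powers; moreover its boundedness near [c] keeps [f], hence
    [f + g], away from 0, as [ana_ln] requires. *)
Lemma skolem_ana f : Skolem f -> forall c, 0 < c -> exists a b,
  [/\ 0 <= a, a < c < b, ana a b (ext f) & ana a b (fun x => ln (ext f x))].
Proof.
have two f1 g1 :
  (forall c, 0 < c -> exists a b,
    [/\ 0 <= a, a < c < b, ana a b (ext f1) & ana a b (fun x => ln (ext f1 x))]) ->
  (forall c, 0 < c -> exists a b,
    [/\ 0 <= a, a < c < b, ana a b (ext g1) & ana a b (fun x => ln (ext g1 x))]) ->
  forall c, 0 < c -> exists a b, [/\ 0 <= a, a < c < b,
    ana a b (ext f1) /\ ana a b (fun x => ln (ext f1 x)) &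
    ana a b (ext g1) /\ ana a b (fun x => ln (ext g1 x))].
  move=> Hf Hg c c0; have [a [b [a0 /andP[ac cb] fa la]]] := Hf c c0.
  have [a' [b' [a'0 /andP[a'c cb'] ga la']]] := Hg c c0.
  exists (Num.max a a'), (Num.min b b').
  have h1 : a <= Num.max a a' by rewrite le_max lexx.
  have h2 : a' <= Num.max a a' by rewrite le_max lexx orbT.
  have h3 : Num.min b b' <= b by rewrite ge_min lexx.
  have h4 : Num.min b b' <= b' by rewrite ge_min lexx orbT.
  split; first exact: le_trans h1.
  - by rewrite gt_max lt_min ac a'c cb.
  - by split; [exact: ana_sub h1 h3 fa|exact: ana_sub h1 h3 la].
  - by split; [exact: ana_sub h2 h4 ga|exact: ana_sub h2 h4 la'].
have pos (a b x : R) : 0 <= a -> a < x < b -> 0 < x.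
  by move=> a0 /andP[ax _]; exact: le_lt_trans ax.
elim=> {f} [||f g _ /two Hf _ /Hf{}Hf|f g _ /two Hf _ /Hf{}Hf|f g _ /two Hf _ /Hf{}Hf] c c0.
- exists 0, (c + 1); split=> //; first by rewrite c0 ltrDl ltr01.
    by apply: ana_ext (ana_cst _ _ 1) => x _; rewrite ext_one.
  by apply: ana_ext (ana_cst _ _ 0) => x _; rewrite ext_one ln1.
- have c2 : 0 < c / 2 by lra.
  have aid : ana (c / 2) (c + 1) (ext (fun y => y)).
    apply: ana_ext (ana_id _ _) => x xc; rewrite ext_id//; exact: pos (ltW c2) xc.
  exists (c / 2), (c + 1); split=> //; [by rewrite ltW|by apply/andP; split; lra|].
  apply: (ana_ln c2) => // x xc; rewrite ext_id ?(pos _ _ _ (ltW c2) xc)//; lra.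
- have [a [b [a0 acb [fa lfa] [ga lga]]]] := Hf c c0.
  have sa : ana a b (ext (fun y => ((f y)%:num + (g y)%:num)%:pos)).
    apply: ana_ext (ana_add fa ga) => x xab; rewrite ext_add//; exact: pos xab.
  exists a, b; split=> //; have [N lN] := ana_bounded lfa.
  apply: (@ana_ln _ _ _ _ (expR (- N%:R)) (expR_gt0 _)) sa => x xab.
  rewrite ext_add; last exact: pos xab.
  have := lN x xab; rewrite ler_norml => /andP[h _].
  apply: le_trans (_ : ext f x <= _); last by rewrite lerDl ltW.
  by rewrite -(lnK (_ : ext f x \is Num.pos)) ?posrE// ler_expR.
- have [a [b [a0 acb [fa lfa] [ga lga]]]] := Hf c c0.
  exists a, b; split=> //.
    apply: ana_ext (ana_mul fa ga) => x xab; rewrite ext_mul//; exact: pos xab.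
  apply: ana_ext (ana_add lfa lga) => x xab.
  by rewrite ext_mul ?lnM ?posrE//; exact: pos xab.
- have [a [b [a0 acb [fa lfa] [ga lga]]]] := Hf c c0.
  exists a, b; split=> //.
    apply: ana_ext (ana_exp (ana_mul ga lfa)) => x xab; rewrite ext_pow//; exact: pos xab.
  apply: ana_ext (ana_mul ga lfa) => x xab.
  by rewrite ext_pow ?expRK//; exact: pos xab.
Qed.

(** The difference is analytic near every positive point, so the identity theorem spreads eventual
    equality over the half-line. This is what makes the order total on functions and not merely on
    germs. *)
Lemma skolem_ev_eq f g : Skolem f -> Skolem g -> ev (fun x => ext f x = ext g x) -> f = g.
Proof.
move=> Sf Sg fg.
have h : forall x, 0 < x -> ext f x - ext g x = 0.
  apply: (@ana_identity _ (fun x => ext f x - ext g x)).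
    have one f1 : Skolem f1 -> forall c, 0 < c -> exists a b : R, a < c < b /\ ana a b (ext f1).
      by move=> Sf1 c c0; have [a [b [_ ? ? _]]] := skolem_ana Sf1 c0; exists a, b.
    move=> c c0; have [a [b [/andP[ac cb] fa]]] := one _ Sf c c0.
    have [a' [b' [/andP[a'c cb'] ga]]] := one _ Sg c c0.
    exists (Num.max a a'), (Num.min b b'); split; first by rewrite gt_max lt_min ac a'c cb.
    apply: ana_add; last apply: ana_opp.
      by apply: ana_sub fa; rewrite ?le_max ?ge_min lexx.
    by apply: ana_sub ga; rewrite ?le_max ?ge_min lexx orbT.
  by apply: evS fg => x ->; rewrite subrr.
apply/funext => x; apply: val_inj => /=.
have : 0 < x%:num by [].
by move=> /h/eqP; rewrite !extE subr_eq0 => /eqP.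
Qed.

Lemma skolem_total f g : Skolem f -> Skolem g -> f = g \/ pfun_lt f g \/ pfun_lt g f.
Proof.
move=> Sf Sg; have [h|[h|h]] := skolem_sign 1 Sf Sg.
- left; apply: skolem_ev_eq => //; apply: evS h => x /eqP.
  by rewrite mul1r subr_eq0 => /eqP.
- right; right; apply/pfun_ltE; apply: evS h => x.
  by rewrite mul1r subr_gt0.
- right; left; apply/pfun_ltE; apply: evS h => x.
  by rewrite mul1r subr_lt0.
Qed.

Lemma arch_leE f g : arch_le f g <-> exists n : nat, ev (fun x => ext f x <= n%:R * ext g x).
Proof.
have cE n h (y : {posnum R}) : ext (fun x => (n.+1%:R * (h x)%:num)%:pos) y%:num
    = n.+1%:R * ext h y%:num by rewrite !extE.
split=> [[n [->|/pfun_ltE h]]|[n h]].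
- exists n.+1; apply: evS ev_gt0 => x /posP[y ->]; by rewrite cE.
- by exists n.+1; apply: evS2 ev_gt0 h => x /posP[y ->]; rewrite cE => /ltW.
- exists n; right; apply/pfun_ltE; apply: evS2 ev_gt0 h => x /posP[y ->] h.
  by rewrite cE; apply: le_lt_trans h _; rewrite ltr_pM2r// ltr_nat.
Qed.

Lemma arch_le_refl f : arch_le f f.
Proof. by apply/arch_leE; exists 1%N; apply: evT => x; rewrite mul1r. Qed.

Lemma arch_le_trans f g h : arch_le f g -> arch_le g h -> arch_le f h.
Proof.
move=> /arch_leE[n fg] /arch_leE[m gh]; apply/arch_leE; exists (n * m)%N.
apply: evS2 fg gh => x fg gh; apply: le_trans fg _.
by rewrite natrM -mulrA; apply: ler_wpM2l.
Qed.

Lemma pfun_lt_arch_le f g : pfun_lt f g -> arch_le f g.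
Proof.
by move=> /pfun_ltE h; apply/arch_leE; exists 1%N; apply: evS h => x /ltW; rewrite mul1r.
Qed.

Lemma arch_eq_refl f : arch_eq f f. Proof. by split; exact: arch_le_refl. Qed.

Lemma arch_eq_sym f g : arch_eq f g -> arch_eq g f. Proof. by case. Qed.

Lemma arch_eq_trans f g h : arch_eq f g -> arch_eq g h -> arch_eq f h.
Proof.
move=> [fg gf] [gh hg].
by split; [exact: arch_le_trans gh|exact: arch_le_trans gf].
Qed.

Definition arch_gt f g := forall n : nat, ev (fun x => n%:R * ext g x < ext f x).

Lemma arch_le_or_gt f g : Skolem f -> Skolem g -> arch_le f g \/ arch_gt f g.
Proof.
move=> Sf Sg; have [|nfg] := pselect (arch_le f g); [by left|right=> n].
have [h|[h|h]] := skolem_sign n%:R Sf Sg.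
- case: nfg; apply/arch_leE; exists n; apply: evS h => x /eqP.
  by rewrite subr_eq0 => /eqP->.
- by apply: evS h => x; rewrite subr_gt0.
- by case: nfg; apply/arch_leE; exists n; apply: evS h => x; rewrite subr_lt0 => /ltW.
Qed.

Lemma arch_gt_lt f g f' g' : arch_gt f g -> arch_le f f' -> arch_le g' g -> pfun_lt g' f'.
Proof.
move=> fg /arch_leE[n ff'] /arch_leE[m gg']; apply/pfun_ltE.
apply: evS3 (fg (n * m)%N) ff' gg' => x h1 h2 h3.
have h4 : n%:R * ext g' x < n%:R * ext f' x.
  apply: lt_le_trans h2; apply: le_lt_trans h1.
  by rewrite natrM -mulrA; apply: ler_wpM2l.
rewrite ltNge; apply/negP => /(ler_wpM2l (ler0n R n)); by rewrite leNgt h4.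
Qed.

(** * Transfer of Skolem functions to the ultrapower *)

Section Embedding.
Variables (U : set_system R) (UU : UltraFilter U).
Hypothesis U_ev : forall P, ev P -> U [set x | P x].
Local Notation K := (ult_field UU U_ev).
Local Notation pi := (fun f => upi UU (ext f) : K).

Lemma skS_pi f : Skolem f -> skS (pi f).
Proof.
have U0 := U_ev ev_gt0.
elim=> {f} [||f g _ Sf _ Sg|f g _ Sf _ Sg|f g _ Sf _ Sg].
- have -> : pi (fun=> 1%:pos) = 1 by apply/upi_eq; apply: UT => x; exact: ext_one.
  exact: skS_one.
- have -> : pi (fun x => x) = kX K by apply/upi_eq; apply: US U0 => x; exact: ext_id.
  exact: skS_X.
- have := skS_add Sf Sg; rewrite [_ + _]upiD; congr skS.
  by apply/upi_eq; apply: US U0 => x x0; rewrite ext_add.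
- have := skS_mul Sf Sg; rewrite [_ * _]upiM; congr skS.
  by apply/upi_eq; apply: US U0 => x x0; rewrite ext_mul.
- have := skS_pow Sf Sg; rewrite kln_upi [_ * _]upiM kexp_upi; congr skS.
  by apply/upi_eq; apply: US U0 => x x0; rewrite ext_pow.
Qed.

Lemma skS_below_pi n f : Skolem_below (@two_pow_pow R n) f -> skS_below n (pi f).
Proof.
move=> [/skS_pi Sf /pfun_ltE fn]; split=> //.
rewrite kln_upi [n.+1%:R]upi_nat [2]upi_nat !kln_upi.
have -> : kX K * upi UU (fun=> ln n.+1%:R) = upi UU (fun x => x * ln n.+1%:R).
  exact: upiM.
rewrite kexp_upi [_ * _]upiM; apply/upi_lt; apply: US2 (U_ev ev_gt0) (U_ev fn) => x /posP[y ->].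
rewrite extE [ext (two_pow_pow _) _]extE /= => h.
have : ln (f y)%:num < ln (2 `^ (n.+1%:R `^ y%:num)) by rewrite ltr_ln ?posrE.
by rewrite ln_powR /powR ifF// pnatr_eq0.
Qed.

Lemma pi_lt f g : pfun_lt f g -> pi f < pi g.
Proof. by move=> /pfun_ltE/U_ev h; apply/upi_lt. Qed.

Lemma pi_arch f g : arch_gt g f -> arch_ll (pi f) (pi g).
Proof.
by move=> gf n; rewrite [n%:R]upi_nat [_ * _]upiM; apply/upi_lt; exact: U_ev (gf n).
Qed.

Lemma order_types n : (1 <= n)%N ->
  order_type_le (@pfun_lt R) (Skolem_below (@two_pow_pow R n)) (omega_tower n.+2) /\
  order_type_le (@arch_class_lt R) (arch_classes (Skolem_below (@two_pow_pow R n)))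
    (omega_tower n.+1).
Proof.
move=> n0; have [[e eP] [e' eP']] := skS_below_embeds (@ult_gap R U UU U_ev) n0.
set A := Skolem_below _; split.
  apply: (@order_type_leP _ _ _ _ _ _ (fun f => e (pi f))).
  - by move=> f _; exact: pfun_ltxx.
  - by move=> f g [Sf _] [Sg _]; exact: skolem_total.
  - move=> f g /skS_below_pi fn /skS_below_pi gn fg.
    by apply: eP => //; exact: pi_lt.
(* Picks a member of each class; the identity function is a default for the empty set, which is not
   a class. *)
pose rep (C : set (pfun R)) := if pselect (exists f, C f) is left h
  then projT1 (cid h) else (fun x => x).
have class_self f : A f -> arch_class A f f by move=> Af; split=> //; exact: arch_eq_refl.
have repP C : arch_classes A C -> C (rep C).
  move=> [f Af <-]; rewrite /rep; case: pselect => [h|]; last first.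
    by case; exists f; exact: class_self.
  by case: (cid h).
apply: (@order_type_leP _ _ _ _ _ _ (fun C => e' (pi (rep C)))).
- move=> _ [f Af <-] h; apply: (@pfun_ltxx f).
  by apply: h; exact: class_self.
- move=> _ _ [f Af <-] [g Ag <-].
  have lt_class f1 g1 : arch_gt f1 g1 -> arch_class_lt (arch_class A g1) (arch_class A f1).
    move=> fg g' f' [_ [_ gg']] [_ [ff' _]]; exact: arch_gt_lt fg ff' gg'.
  have [fg|/lt_class] := arch_le_or_gt Af.1 Ag.1; last by right; right.
  have [gf|/lt_class] := arch_le_or_gt Ag.1 Af.1; last by right; left.
  left; have efg : arch_eq f g by [].
  apply/seteqP; split=> h [Ah eh]; split=> //.
    exact: arch_eq_trans (arch_eq_sym efg) eh.
  exact: arch_eq_trans efg eh.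
- move=> C D hC hD CD; have rC := repP _ hC; have rD := repP _ hD.
  have sub E g : arch_classes A E -> E g -> A g by move=> [f Af <-] [].
  have AC := sub _ _ hC rC; have AD := sub _ _ hD rD.
  apply: eP'; [exact: skS_below_pi|exact: skS_below_pi|].
  apply: pi_arch; have [DC|//] := arch_le_or_gt AD.1 AC.1.
  have CD' := pfun_lt_arch_le (CD _ _ rC rD).
  (* If the two representatives were comparable up to a factor, [rep D] would lie in [C] as well,
     and [C < D] would compare it with itself. *)
  case: (@pfun_ltxx (rep D)); apply: CD => //.
  case: hC rC CD' DC => f Af <- [_ efC] CD' DC; split=> //.
  exact: arch_eq_trans efC _.
Qed.

End Embedding.
End SkolemFunctions.

Theorem mainTheorem2 (R : realType) (n : nat) (hn : (1 <= n)%N) :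
  order_type_le (@pfun_lt R) (Skolem_below (@two_pow_pow R n))
    (omega_tower n.+2) /\
  order_type_le (@arch_class_lt R)
    (arch_classes (Skolem_below (@two_pow_pow R n)))
    (omega_tower n.+1).
Proof.
(* Any ultrafilter containing all end segments will do: Skolem functions are eventually comparable,
   so their order in the ultrapower does not depend on the choice. *)
have [U [UU sU]] := ultraFilterLemma (@proper_pinfty_nbhs R).
apply: (@order_types R U UU _ n hn) => P [m mP].
by apply: sU; exists m; rewrite num_real.
Qed.
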